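(* For every constant $C>0$ and every $\varepsilon\ge0$ there exist constants $c_1>c_2>0$, $c_3>0$ and $M>0$, depending only on $C$ and $\varepsilon$, such that for every positive integer $S$ and every integer $n\ge2$ with $\ln n\le C\ln S$, the estimator with $K=c_3\ln n$ (rounded down to an integer) satisfies $$\sup_{P,Q\in\mathcal{M}_S}\mathbb{E}_{P\times Q}\Big[\big|\widehat d_{\varepsilon,K,c_1,c_2}(P_n\|Q_n)-d_\varepsilon(P\|Q)\big|^2\Big]\;\le\;M\,\frac{e^\varepsilon S}{n\ln n}.$$
   Context: $\mathcal{M}_S$ is the set of probability distributions on $[S]=\{1,\dots,S\}$; $x\wedge y=\min\{x,y\}$, $x\vee y=\max\{x,y\}$, $[x]^+=\max\{x,0\}$; $d_\varepsilon(P\|Q)=\sum_{i=1}^S[p_i-e^\varepsilon q_i]^+$. Sampling: both $P$ and $Q$ are unknown. Two batches of i.i.d. samples from $P$ and two from $Q$ are drawn, all independent, each of independent size $\mathrm{Poi}(n)$. $\hat p_{i,j}$ (resp. $\hat q_{i,j}$) is the number of samples equal to $i$ in the $j$-th batch from $P$ (resp. $Q$), divided by $n$, $j\in\{1,2\}$. So all these are independent with $n\hat p_{i,j}\sim\mathrm{Poi}(np_i)$, $n\hat q_{i,j}\sim\mathrm{Poi}(nq_i)$. $\mathbb{E}_{P\times Q}$ is expectation over all samples. Unbiased monomials: $g_{i,0}(X)=\prod_{k=0}^{i-1}(X-\frac kn)$ (equal to $1$ for $i=0$); $\mathbb{E}[g_{i,0}(\hat p)]=p^i$ if $n\hat p\sim\mathrm{Poi}(np)$.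 First polynomial: let $u_K$ and $v_K$ be best uniform approximations on $[0,1]^2$ of $\sqrt x+\sqrt y$ and $[\sqrt x-\sqrt y]^+$, respectively, among bivariate polynomials of degree at most $K$ (in each variable). Put $h_{2K}(x,y)=u_K(x,y)v_K(x,y)-u_K(0,0)v_K(0,0)=\sum_{0\le i,j\le 2K,\,i+j\ge1}h_{ij}x^iy^j$, $\Delta=\frac{c_1\ln n}{n}$, and $D_K^{(1)}(x,y)=2\Delta\,h_{2K}\big(\frac{x}{2\Delta},\frac{e^\varepsilon y}{2\Delta}\big)$. Its unbiased estimator is $\tilde D_K^{(1)}(\hat p,\hat q)=\sum_{0\le i,j\le2K,\,i+j\ge1}h_{ij}(2\Delta)^{1-i-j}e^{j\varepsilon}g_{i,0}(\hat p)g_{j,0}(\hat q)$. Second polynomial: let $R_K(t)=\sum_{j=0}^Kr_jt^j$ be the best uniform approximation of $|t|$ on $[-1,1]$ by polynomials of degree at most $K$. For given $(x,y)$ with $x+e^\varepsilon y>0$ let $W=\sqrt{\frac{8c_1\ln n}{n}}\sqrt{x+e^\varepsilon y}$ and $D_K^{(2)}(p,q;x,y)=\frac12\sum_{j=0}^Kr_jW^{1-j}(e^\varepsilon q-p)^j+\frac{p-e^\varepsilon q}{2}$. Its unbiased estimator $\tilde D_K^{(2)}(\hat p,\hat q;x,y)$ is obtained by expanding $D_K^{(2)}$ as a polynomial in $(p,q)$ and replacing each monomial $p^iq^j$ by $g_{i,0}(\hat p)g_{j,0}(\hat q)$. The estimator: for each $i\in[S]$, let $T_i=\sqrt{\frac{(c_1+c_2)\ln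 n}{n}}\big(\sqrt{\hat p_{i,1}}+\sqrt{e^\varepsilon\hat q_{i,1}}\big)$ and - $\delta_i=0$ if $\hat p_{i,1}-e^\varepsilon\hat q_{i,1}<-T_i$; - $\delta_i=\hat p_{i,2}-e^\varepsilon\hat q_{i,2}$ if $\hat p_{i,1}-e^\varepsilon\hat q_{i,1}>T_i$; - $\delta_i=\tilde D_K^{(1)}(\hat p_{i,2},\hat q_{i,2})$ if $\hat p_{i,1}+e^\varepsilon\hat q_{i,1}<\frac{c_1\ln n}{n}$; - $\delta_i=\tilde D_K^{(2)}(\hat p_{i,2},\hat q_{i,2};\hat p_{i,1},\hat q_{i,1})$ in the remaining case, $|\hat p_{i,1}-e^\varepsilon\hat q_{i,1}|\le T_i$ and $\hat p_{i,1}+e^\varepsilon\hat q_{i,1}\ge\frac{c_1\ln n}{n}$. (These cases are mutually exclusive.) Then $\widehat d_{\varepsilon,K,c_1,c_2}(P_n\|Q_n)=0\vee\big(1\wedge\sum_{i=1}^S\delta_i\big)$. *)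

(* Defs.v *)
From HB Require Import structures.
From mathcomp Require Import all_boot all_order all_algebra polyXY.
From mathcomp Require Import all_classical all_reals all_analysis.

Set Implicit Arguments.
Unset Strict Implicit.
Unset Printing Implicit Defensive.

Import Order.TTheory GRing.Theory Num.Theory.
Import numFieldNormedType.Exports.

Local Open Scope classical_set_scope.
Local Open Scope ring_scope.

Definition is_pmf (R : realType) (S : nat) (p : 'I_S -> R) : Prop :=
  (forall i, 0 <= p i) /\ \sum_(i < S) p i = 1.

Definition divergence (R : realType) (S : nat) (eps : R) (p q : 'I_S -> R) : R :=
  \sum_(i < S) Num.max (p i - expR eps * q i) 0.

Definition mutually_independent (d : measure_display) (T : measurableType d)
    (R : realType) (Pr : probability T R) (J : eqType)
    (F : J -> set (set T)) : Prop :=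
  forall (s : seq J) (A : J -> set T), uniq s ->
    (forall j, j \in s -> F j (A j)) ->
    Pr (\bigcap_(j in [set` s]) A j) = (\prod_(j <- s) Pr (A j))%E.

(* Batches are indexed by (b, j): b = true for the samples from P, b = false
   for the samples from Q, and j : 'I_2 is the batch number.  The batch (b, j)
   consists of the first N b j terms of the sequence X b j.  The independent
   sources of randomness are indexed by (b, j, o), with o = None for the size
   of the batch and o = Some k for its k-th sample; each comes with the
   sigma-algebra it generates, 'I_S being discrete. *)
Definition batch_sigma (d : measure_display) (T : measurableType d)
    (R : realType) (Pr : probability T R) (S : nat)
    (N : bool -> 'I_2 -> {RV Pr >-> nat})
    (X : bool -> 'I_2 -> nat -> T -> 'I_S)
    (t : bool * 'I_2 * option nat) : set (set T) :=
  let: (b, j, o) := t in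
  if o is Some k then preimage_set_system setT (X b j k) setT
  else preimage_set_system setT (N b j) measurable.

Definition poissonized_sampling (d : measure_display) (T : measurableType d)
    (R : realType) (Pr : probability T R) (S n : nat) (p q : 'I_S -> R)
    (N : bool -> 'I_2 -> {RV Pr >-> nat})
    (X : bool -> 'I_2 -> nat -> T -> 'I_S) : Prop :=
  [/\ forall b j m, Pr (N b j @^-1` [set m]) = (poisson_pmf n%:R m)%:E,
      forall b j k i, measurable (X b j k @^-1` [set i]),
      forall b j k i,
        Pr (X b j k @^-1` [set i]) = ((if b then p else q) i)%:E
    & mutually_independent Pr (batch_sigma N X)].

Definition frequency (R : realType) (S n : nat) (T : Type)
    (N : T -> nat) (X : nat -> T -> 'I_S) (i : 'I_S) (w : T) : R :=
  (\sum_(k < N w) (X k w == i))%N%:R / n%:R.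

Definition sup_dist (R : realType) (T : Type) (D : set T) (f g : T -> R) : \bar R :=
  ereal_sup [set (`|f z - g z|)%:E | z in D].

Definition best_approx1 (R : realType) (K : nat) (a b : R) (f : R -> R)
    (r : {poly R}) : Prop :=
  (size r <= K.+1)%N /\
  forall s : {poly R}, (size s <= K.+1)%N ->
    (sup_dist `[a, b] f (horner r) <= sup_dist `[a, b] f (horner s))%E.

(* The coefficient of x ^ i * y ^ j in u : {poly {poly R}} is u`_i`_j. *)
Definition degree_le2 (R : realType) (K : nat) (u : {poly {poly R}}) : bool :=
  (size u <= K.+1)%N && (sizeY u <= K.+1)%N.

Definition best_approx2 (R : realType) (K : nat) (f : R -> R -> R)
    (u : {poly {poly R}}) : Prop :=
  let D := `[0, 1]%classic `*` `[0, 1]%classic in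
  let F z := f z.1 z.2 in
  let ev (v : {poly {poly R}}) (z : R * R) := v.[z.1, z.2] in
  degree_le2 K u /\
  forall v, degree_le2 K v ->
    (sup_dist D F (ev u) <= sup_dist D F (ev v))%E.

Definition g0 (R : realType) (n i : nat) (x : R) : R :=
  \prod_(k < i) (x - k%:R / n%:R).

(* Replaces each monomial x ^ i * y ^ j of D by g0 n i x * g0 n j y, which has
   expectation p ^ i * q ^ j when n * x ~ Poi(n * p) and n * y ~ Poi(n * q) are
   independent. *)
Definition unbiased (R : realType) (n : nat) (D : {poly {poly R}}) (x y : R) : R :=
  \sum_(i < size D) \sum_(j < size D`_i) D`_i`_j * g0 n i x * g0 n j y.

Definition h2K (R : realType) (u v : {poly {poly R}}) : {poly {poly R}} :=
  u * v - (u.[0, 0] * v.[0, 0])%:P%:P.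

Definition D1tilde (R : realType) (n K : nat) (eps c1 : R)
    (u v : {poly {poly R}}) (x y : R) : R :=
  let Delta := c1 * ln n%:R / n%:R in
  \sum_(i < (2 * K).+1) \sum_(j < (2 * K).+1 | (1 <= i + j)%N)
    (h2K u v)`_i`_j * (2 * Delta) ^ (1 - i%:Z - j%:Z) * expR (j%:R * eps)
    * g0 n i x * g0 n j y.

Definition D2poly (R : realType) (n K : nat) (eps c1 : R)
    (r : {poly R}) (x y : R) : {poly {poly R}} :=
  let W := Num.sqrt (8 * c1 * ln n%:R / n%:R) * Num.sqrt (x + expR eps * y) in
  let eqp : {poly {poly R}} := (expR eps)%:P%:P * 'Y - 'X in
  (2^-1)%:P%:P * \sum_(j < K.+1) (r`_j * W ^ (1 - j%:Z))%:P%:P * eqp ^+ j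
  - (2^-1)%:P%:P * eqp.

Definition D2tilde (R : realType) (n K : nat) (eps c1 : R) (r : {poly R})
    (phat qhat x y : R) : R :=
  unbiased n (D2poly n K eps c1 r x y) phat qhat.

(* p1, q1 (resp. p2, q2) are the frequencies in the first (resp. second)
   batches.  The order of the tests is immaterial: |p1 - e * q1| > Ti forces
   |sqrt p1 - sqrt (e * q1)| ^ 2 > (c1 + c2) * ln n / n, hence
   p1 + e * q1 >= c1 * ln n / n. *)
Definition delta (R : realType) (n K : nat) (eps c1 c2 : R)
    (u v : {poly {poly R}}) (r : {poly R}) (p1 q1 p2 q2 : R) : R :=
  let e := expR eps in
  let Ti := Num.sqrt ((c1 + c2) * ln n%:R / n%:R)
            * (Num.sqrt p1 + Num.sqrt (e * q1)) in
  if p1 - e * q1 < - Ti then 0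
  else if Ti < p1 - e * q1 then p2 - e * q2
  else if p1 + e * q1 < c1 * ln n%:R / n%:R then D1tilde n K eps c1 u v p2 q2
  else D2tilde n K eps c1 r p2 q2 p1 q1.

Definition dhat (R : realType) (S n K : nat) (eps c1 c2 : R)
    (u v : {poly {poly R}}) (r : {poly R}) (p1 q1 p2 q2 : 'I_S -> R) : R :=
  Num.max 0 (Num.min 1
    (\sum_(i < S) delta n K eps c1 c2 u v r (p1 i) (q1 i) (p2 i) (q2 i))).

Definition dhat_sample (R : realType) (S n K : nat) (eps c1 c2 : R)
    (u v : {poly {poly R}}) (r : {poly R}) (T : Type)
    (N : bool -> 'I_2 -> T -> nat) (X : bool -> 'I_2 -> nat -> T -> 'I_S)
    (w : T) : R :=
  let freq b j i := frequency R n (N b j) (X b j) i w in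
  dhat n K eps c1 c2 u v r (freq true 0) (freq false 0)
    (freq true 1) (freq false 1).

(* Main.v *)
(* By Poissonization the counts of all symbols in all batches are independent
   Poisson variables, so given the first batches the variances of the
   per-symbol estimates add up.  Write L = ln n / n.  Outside an event of
   probability O(1/n^2) per symbol, the square roots of the first-batch
   frequencies are within sqrt (2 L) of those of p_i and q_i, so the branch taken
   is the right one: the estimates 0 and the plug-in difference are used only
   where they are unbiased for [p_i - e q_i]^+.
   Since (sqrt x + sqrt y) [sqrt x - sqrt y]^+ = [x - y]^+ and |t| are
   approximated at rate 1/K, with K of order ln n, the bias of a polynomial branch
   is of order (sqrt (L (p_i + e q_i)) + L / K) / K; by Cauchy-Schwarz the biases sum
   to order sqrt (S / (n ln n)) + S / (n ln n).  A polynomial of degree K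
   bounded on a box has coefficients of size g^K, so the variances lose only a
   factor g^K, which is a small power of n and of S when c3 is small. *)

Require Import Defs.
From HB Require Import structures.
From mathcomp Require Import all_boot all_order all_algebra polyXY.
From mathcomp Require Import all_classical all_reals all_analysis.
From mathcomp Require Import measurable_realfun ring lra zify.

Set Implicit Arguments.
Unset Strict Implicit.
Unset Printing Implicit Defensive.

Import Order.TTheory GRing.Theory Num.Theory.
Import numFieldNormedType.Exports.

Local Open Scope classical_set_scope.
Local Open Scope ring_scope.

(** The samples enter through one computation only, the probability that the counts of all symbols
    in all batches take prescribed values. Since the clipped loss lies in [0, 1], its expectation is
    at most its sum over a finite box of counts plus the missing mass. What remains concerns
    truncated Poisson sums, of mass at most 1 instead of 1, and the box grows. Second moments need
    no orthogonal polynomials: the square of the unbiased estimator of a power of a linear form is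
    the unbiased estimator of another polynomial, given by a recursion that also bounds it. The
    scale is sg^2 = 8 e L: on a good first batch the square roots of the frequencies of p and of e q
    move by at most sg in total. A gap 5 sg between the observed roots then decides the sign of p -
    e q, and the level 16 sg^2 makes the rescaling of both polynomials valid at the true
    frequencies; so c1 = 128 e and c1 + c2 = 200 e. The squared bias of the sum contains w^2 with w
    = S / (n ln n); the cap of the risk at 1 brings it down to w. The hypothesis ln n <= C ln S
    serves where a variance carries no factor S. *)

(** * Polynomial approximation of square roots *)

(* With x = sin^2 t these are sin ((2m+1) t) / sin t and cos ((2m+2) t). *)
Fixpoint cheb (R : realType) (m : nat) : {poly R} * {poly R} :=
  if m is k.+1 then
    let q := (cheb R k).1 + 2 *: (cheb R k).2 in
    (q, (cheb R k).2 - 2 *: ('X * q))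
  else (1, 1 - 2 *: 'X).

Lemma size_cheb (R : realType) m :
  (size (cheb R m).1 <= m.+1)%N /\ (size (cheb R m).2 <= m.+2)%N.
Proof.
elim: m => [|m [IH1 IH2]] /=.
  rewrite size_poly1; split=> //.
  rewrite (leq_trans (size_polyD _ _))// geq_max size_poly1 size_polyN /=.
  by rewrite (leq_trans (size_scale_leq _ _))// size_polyX.
have s1 : (size ((cheb R m).1 + 2 *: (cheb R m).2)%R <= m.+2)%N.
  rewrite (leq_trans (size_polyD _ _))// geq_max (leq_trans IH1)//=.
  by rewrite (leq_trans (size_scale_leq _ _)).
split=> //.
rewrite (leq_trans (size_polyD _ _))// geq_max size_polyN (leq_trans IH2)//=.
rewrite (leq_trans (size_scale_leq _ _))//.
rewrite mulrC; have [->|q0] := eqVneq ((cheb R m).1 + 2 *: (cheb R m).2) 0.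
  by rewrite mul0r size_poly0.
by rewrite size_mulX.
Qed.

Lemma cheb_rec (R : realType) m (x : R) :
  (cheb R m.+1).1.[x] = (cheb R m).1.[x] + 2 * (cheb R m).2.[x] /\
  (cheb R m.+1).2.[x] = (cheb R m).2.[x] - 2 * x * (cheb R m.+1).1.[x].
Proof.
rewrite /= !(hornerD, hornerN, hornerZ, hornerM, hornerX); split; ring.
Qed.

(** The recursion is linear in (q, c) and preserves this quadratic form. Completing the square in
    two ways turns the identity into the bounds |cos| <= 1 and |sin| <= 1, with no trigonometric
    function involved. *)
Lemma cheb_inv (R : realType) m (x : R) :
  let q := (cheb R m).1.[x] in let c := (cheb R m).2.[x] in
  x * q ^+ 2 + 2 * x * q * c + c ^+ 2 = 1 - x.
Proof.
elim: m => [|m /= IH]; first by rewrite /= !(hornerD, hornerN, hornerZ, hornerX, hornerC); ring.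
have [-> ->] := cheb_rec m x; have [-> _] := cheb_rec m x.
rewrite -IH; ring.
Qed.

Lemma cheb2_le1 (R : realType) m (x : R) : 0 <= x < 1 -> `|(cheb R m).2.[x]| <= 1.
Proof.
move=> /andP[x0 x1]; have := cheb_inv m x; set q := _.1.[x]; set c := _.2.[x] => /= h.
rewrite -(@ler_pXn2r _ 2) ?nnegrE// expr1n real_normK ?num_real//.
have : (1 - x) * c ^+ 2 <= 1 - x.
  rewrite -{2}h -subr_ge0.
  by rewrite (_ : _ - _ = x * (q + c) ^+ 2); [rewrite mulr_ge0 ?sqr_ge0|ring].
by rewrite ger_pMr ?subr_gt0.
Qed.

Lemma cheb1_sqr_le (R : realType) m (x : R) : 0 <= x < 1 ->
  x * (cheb R m).1.[x] ^+ 2 <= 1.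
Proof.
move=> /andP[x0 x1]; have := cheb_inv m x; set q := _.1.[x]; set c := _.2.[x] => /= h.
have : (1 - x) * (x * q ^+ 2) <= 1 - x.
  rewrite -{2}h -subr_ge0.
  by rewrite (_ : _ - _ = (c + x * q) ^+ 2); [rewrite sqr_ge0|ring].
by rewrite ger_pMr ?subr_gt0.
Qed.

Lemma cheb1_le (R : realType) m (x : R) : 0 <= x < 1 ->
  `|(cheb R m).1.[x]| <= (2 * m + 1)%:R.
Proof.
move=> hx; elim: m => [|m IH]; first by rewrite /= !(hornerD, hornerN, hornerZ, hornerX, hornerC) normr1.
have [-> _] := cheb_rec m x; rewrite (le_trans (ler_normD _ _))// normrM.
rewrite (_ : (2 * m.+1 + 1)%:R = (2 * m + 1)%:R + 2); last first.
  by rewrite -natrD; congr _%:R; lia.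
rewrite lerD//; have := cheb2_le1 m hx; rewrite ger0_norm//; lra.
Qed.

Lemma cheb2_ge (R : realType) m (x : R) : 0 <= x < 1 ->
  1 - 2 * x * (m.+1)%:R ^+ 2 <= (cheb R m).2.[x].
Proof.
move=> hx; elim: m => [|m IH]; first by rewrite /= !(hornerD, hornerN, hornerZ, hornerX, hornerC); lra.
have [_ ->] := cheb_rec m x.
have := cheb1_le m.+1 hx; rewrite ler_norml => /andP[_ h].
have /andP[x0 _] := hx.
have : x * (cheb R m.+1).1.[x] <= x * (2 * m.+1 + 1)%:R by rewrite ler_wpM2l.
move: IH; rewrite -(natr1 m.+1) natrD natrM; set M := m.+1%:R; nra.
Qed.

(** Near x = 0 the kernel keeps the order of its peak 2m+1. This is what bounds its total mass from
    below. *)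
Lemma cheb1_ge (R : realType) m (x : R) : 0 <= x < 1 ->
  (2 * m + 1)%:R - 4 * x * m%:R ^+ 3 <= (cheb R m).1.[x].
Proof.
move=> hx; have /andP[x0 _] := hx.
elim: m => [|m IH]; first by rewrite /= !(hornerD, hornerN, hornerZ, hornerX, hornerC); lra.
have [-> _] := cheb_rec m x.
apply: le_trans (lerD IH (ler_wpM2l (ler0n _ 2) (cheb2_ge m hx))).
rewrite -subr_ge0 !natrD !natrM -!(natr1 m); set M := m%:R.
rewrite (_ : _ - _ = 4 * x * (2 * M ^+ 2 + M)); last by ring.
by rewrite !mulr_ge0 ?addr_ge0 ?mulr_ge0 ?sqr_ge0 ?ler0n.
Qed.

(** Termwise, t^(2j) integrates twice to t^(2j+2) / ((2j+1)(2j+2)), which is again even. The double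
    primitive of an even kernel is therefore a polynomial in x = t^2, as an approximation of t =
    sqrt x by polynomials in x requires. *)
Lemma even_double_primitive (R : realType) (k : {poly R}) :
  exists f J : {poly R}, [/\ (size f <= (size k).+1)%N,
    (f \Po 'X^2)^`() = J, J^`() = k \Po 'X^2, f.[0] = 0 & J.[0] = 0].
Proof.
pose g := \poly_(i < size k) (k`_i / (2 * i + 1)%:R).
pose f := \poly_(i < (size k).+1)
  (if i is j.+1 then k`_j / (2 * (2 * j + 1) * j.+1)%:R else 0).
have f' : f^`() = 2^-1 *: g.
  apply/polyP => i; rewrite coef_deriv coefZ !coef_poly ltnS.
  case: ifP => _; last by rewrite mul0rn mulr0.
  rewrite -[LHS]mulr_natr (natrM _ _ i.+1) (natrM _ 2).
  have : (2 * i + 1)%:R != 0 :> R by rewrite pnatr_eq0 addn1.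
  have : i.+1%:R != 0 :> R by rewrite pnatr_eq0.
  move: (i.+1%:R) ((2 * i + 1)%:R) => a b a0 b0; by field; rewrite a0 b0.
have g' : g + 2 *: ('X * g^`()) = k.
  apply/polyP => i; rewrite coefD coefZ coefXM.
  case: i => [|i].
    rewrite /= mulr0 addr0 coef_poly; case: ifP => [_|/negbT].
      by rewrite muln0 add0n divr1.
    by rewrite -leqNgt => h; rewrite nth_default.
  rewrite [_ == _]/= coef_deriv !coef_poly; case: ifP => [_|/negbT]; last first.
    by rewrite -leqNgt => h; rewrite nth_default// mul0rn mulr0 addr0.
  rewrite /= -[X in _ + _ * X]mulr_natr.
  have -> : (2 * i.+1 + 1)%:R = 1 + 2 * i.+1%:R :> R by rewrite natrD natrM; ring.
  have : 0 < 1 + 2 * i.+1%:R :> R by rewrite addr_gt0 ?mulr_gt0 ?ltr0n.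
  by move: (i.+1%:R) => a h; field; rewrite gt_eqF.
exists f, ('X * (g \Po 'X^2)); split.
- exact: size_poly.
- rewrite deriv_comp f' derivXn expr1 comp_polyZ.
  rewrite -scalerAl mulrnAr -[_ * _ *+ _]scaler_nat scalerA mulVf ?pnatr_eq0//.
  by rewrite scale1r mulrC.
- rewrite derivM derivX mul1r deriv_comp derivXn expr1 -[in RHS]g' comp_polyD.
  rewrite comp_polyZ comp_polyM comp_polyX; congr (_ + _).
  by rewrite scaler_nat !mulrnAr expr2 mulrCA -mulrA [_ * ('X * _)]mulrC mulrA.
- by rewrite horner_coef0 coef_poly.
- by rewrite hornerM hornerX mul0r.
Qed.

Lemma derive_ge0_le (R : realType) (f df : R -> R) (a b : R) : a <= b ->
  (forall x, a <= x <= b -> is_derive x 1 f (df x)) ->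
  (forall x, a <= x <= b -> 0 <= df x) -> f a <= f b.
Proof.
move=> ab fdf df0.
have [||c] := @MVT_segment R f df a b ab.
- move=> x; rewrite in_itv/= => /andP[ax xb].
  by apply: fdf; rewrite !ltW.
- apply: continuous_in_subspaceT => x; rewrite inE/= in_itv/= => /fdf h.
  by apply: differentiable_continuous; apply/derivable1_diffP; exact: (@ex_derive _ _ _ _ _ _ _ h).
- rewrite in_itv/= => /df0 c0 h.
  by rewrite -subr_ge0 h mulr_ge0// subr_ge0.
Qed.

Lemma deriv_poly_ge0_le (R : realType) (p : {poly R}) (a b : R) : a <= b ->
  (forall x, a <= x <= b -> 0 <= p^`().[x]) -> p.[a] <= p.[b].
Proof.
by move=> ab h; apply: (@derive_ge0_le _ (horner p) (horner p^`())).
Qed.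

(** Combines t |q| <= 1 with |q| (1 + N t) <= 2 N. The right side is chosen for its elementary
    primitive - 8 N^2 / (1 + N t)^2. *)
Lemma cheb1_kernel_le (R : realType) m (t : R) : 0 <= t < 1 ->
  t * ((cheb R m).1.[t ^+ 2]) ^+ 4 <=
    16 * (2 * m + 1)%:R ^+ 3 / (1 + (2 * m + 1)%:R * t) ^+ 3.
Proof.
move=> /andP[t0 t1]; set q := _.1.[_]; set N := (2 * m + 1)%:R.
have h2 : 0 <= t ^+ 2 < 1 by rewrite sqr_ge0 expr_lt1.
have N0 : 0 < N by rewrite ltr0n addn1.
have q1 : `|q| <= N := cheb1_le m h2.
have q2 : t * `|q| <= 1.
  rewrite -(@ler_pXn2r _ 2) ?nnegrE ?mulr_ge0// expr1n exprMn real_normK ?num_real//.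
  exact: cheb1_sqr_le.
have D0 : 0 < 1 + N * t by rewrite ltr_pwDl// mulr_ge0// ltW.
rewrite ler_pdivlMr ?exprn_gt0//.
have -> : q ^+ 4 = `|q| ^+ 4 by rewrite -normrX ger0_norm// (exprM q 2 2) sqr_ge0.
have h : `|q| * (1 + N * t) <= 2 * N.
  rewrite mulrDr mulr1 (_ : 2 * N = N + N * 1); last by ring.
  by rewrite lerD// mulrCA ler_wpM2l ?(ltW N0)// mulrC.
have -> : t * `|q| ^+ 4 * (1 + N * t) ^+ 3 = t * `|q| * (`|q| * (1 + N * t)) ^+ 3 by ring.
rewrite (_ : 16 * N ^+ 3 = 2 * (2 * N) ^+ 3); last by ring.
have qD : 0 <= `|q| * (1 + N * t) by rewrite mulr_ge0// ltW.
apply: ler_pM; [exact: mulr_ge0|exact: exprn_ge0|lra|].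
by rewrite lerXn2r// nnegrE mulr_ge0// ltW.
Qed.

Lemma abs_even_approx (R : realType) m : exists F : {poly R},
  (size F <= 4 * m + 2)%N /\
  forall t : R, 0 <= t <= 2^-1 -> `|t - F.[t ^+ 2]| <= 256 / (2 * m + 1)%:R.
Proof.
(* J' is an even Jackson-type kernel concentrated at scale 1 / N, so its double
   primitive, divided by c = J(1/2), is close to |t|. *)
pose k := (cheb R m).1 ^+ 4; set N : R := (2 * m + 1)%:R.
have N1 : 1 <= N by rewrite ler1n addn1.
have [f [J [sf f' J' f0 J0]]] := even_double_primitive k.
have J'E t : J^`().[t] = (cheb R m).1.[t ^+ 2] ^+ 4.
  by rewrite J' horner_comp hornerXn horner_exp.
have J'ge0 t : 0 <= J^`().[t] by rewrite J'E (exprM _ 2 2) sqr_ge0.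
have Jmono a b : a <= b -> J.[a] <= J.[b].
  by move=> ab; apply: deriv_poly_ge0_le.
pose c := J.[2^-1].
(* On [0, 1/(2N)] the lower bound on q gives J' >= (N/2)^4, so J gains at least N^4/16 times 1/(2N)
   there. *)
have c_ge : N ^+ 3 / 32 <= c.
  apply: le_trans (Jmono (2 * N)^-1 _ _); last first.
    by rewrite lef_pV2 ?posrE; lra.
  have : ('X * (N ^+ 4 / 16)%:P - J).[0] >= ('X * (N ^+ 4 / 16)%:P - J).[(2 * N)^-1].
    rewrite -lerN2 -!hornerN; apply: deriv_poly_ge0_le.
      by rewrite invr_ge0; lra.
    move=> t /andP[t0 tN].
    rewrite derivN derivB derivM derivX derivC mulr0 addr0 mul1r hornerN hornerD.
    rewrite hornerN hornerC J'E opprB subr_ge0.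
    have Nm : 0 < 2 * N by lra.
    have tN' : t ^+ 2 <= (2 * N) ^- 2.
      by rewrite -exprVn lerXn2r ?nnegrE// invr_ge0 ltW.
    have t2 : 0 <= t ^+ 2 < 1.
      rewrite sqr_ge0/=; apply: le_lt_trans tN' _.
      by rewrite invf_lt1 ?exprn_gt0// expr_gt1 ?ltW//; lra.
    have hq : N / 2 <= (cheb R m).1.[t ^+ 2].
      apply: le_trans (cheb1_ge m t2); rewrite -/N.
      have hm : 2 * m%:R <= N by rewrite /N natrD natrM; lra.
      have : 4 * t ^+ 2 * m%:R ^+ 3 <= m%:R.
        have : 4 * t ^+ 2 * m%:R ^+ 2 <= 1.
          apply: (@le_trans _ _ (4 * (2 * N) ^- 2 * N ^+ 2)).
            rewrite ler_pM ?mulr_ge0 ?sqr_ge0 ?ler_wpM2l//.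
            by rewrite lerXn2r ?nnegrE; lra.
          rewrite exprMn invfM; have : N ^+ 2 != 0 by rewrite expf_neq0//; lra.
          move=> h; rewrite (_ : _ * _ * _ = 1)//; field; lra.
        move=> h; rewrite (exprS _ 2) mulrCA -[leRHS]mulr1.
        exact: ler_wpM2l.
      lra.
    rewrite (_ : 16 = 2 ^+ 4 :> R) -?expr_div_n; last by ring.
    by rewrite lerXn2r ?nnegrE//; lra.
  rewrite !hornerD !hornerN !hornerM !hornerX !hornerC mul0r J0 subr0 subr_le0.
  apply: le_trans; rewrite le_eqVlt; apply/orP; left; apply/eqP; field; lra.
have c0 : 0 < c by apply: lt_le_trans c_ge; rewrite divr_gt0// exprn_gt0//; lra.
pose g := f \Po 'X^2.
have gE t : g.[t] = f.[t ^+ 2] by rewrite horner_comp hornerXn.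
have g0 : g.[0] = 0 by rewrite gE expr0n.
(* The left side is the integral of t J'(t) over [0, 1/2], because ['X * J - g] has derivative t J'.
   It is compared with [th], a primitive of the kernel bound. *)
have chi : 2^-1 * c - g.[2^-1] <= 8 * N ^+ 2.
  pose th (t : R) := - (8 * N ^+ 2) * ((1 + N * t) ^- 2).
  pose dth (t : R) := 16 * N ^+ 3 / (1 + N * t) ^+ 3.
  have : th 0 - ('X * J - g).[0] <= th 2^-1 - ('X * J - g).[2^-1].
    pose F := fun t : R => th t - ('X * J - g).[t].
    have half0 : 0 <= 2^-1 :> R by rewrite invr_ge0.
    apply: (derive_ge0_le (f := F)
      (df := fun t => dth t - ('X * J - g)^`().[t]) half0) => x /andP[x0 x1].
      have D0 : 1 + N * x != 0 by rewrite gt_eqF// ltr_pwDl// mulr_ge0; lra.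
      have hth : is_derive x 1 th (dth x).
        pose p : {poly R} := (1 + N *: 'X) * (1 + N *: 'X).
        have pE t : p.[t] = (1 + N * t) ^+ 2.
          by rewrite hornerM hornerD hornerZ hornerX hornerC.
        have px : p.[x] != 0 by rewrite pE expf_neq0.
        have -> : th = (- (8 * N ^+ 2)) \*: (fun y => (horner p y)^-1).
          by apply/funext => t; rewrite /th -pE.
        apply: is_derive_eq.
        rewrite pE derivM derivD derivZ derivX -polyC1 derivC add0r alg_polyC.
        rewrite hornerD !hornerM hornerD hornerZ hornerX !hornerC /dth /GRing.scale/=.
        by move: (1 + N * x) D0 => D D0; field.
      exact: (is_deriveB hth (is_derive_poly ('X * J - g) x)).
    rewrite derivB derivM derivX mul1r f' addrAC subrr add0r hornerM hornerX J'E.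
    by rewrite subr_ge0 cheb1_kernel_le//; lra.
  rewrite /th !hornerD !hornerN !hornerM !hornerX -/c g0 mul0r mulr0 addr0 expr1n.
  rewrite subrr subr0 invr1 mulr1 mulNr.
  have : 0 <= 8 * N ^+ 2 * (1 + N / 2) ^- 2.
    by rewrite mulr_ge0 ?mulr_ge0 ?sqr_ge0// invr_ge0 sqr_ge0.
  lra.
exists (c^-1 *: f); split.
  rewrite (leq_trans (size_scale_leq _ _))// (leq_trans sf)//.
  have : (size k <= (4 * m).+1)%N.
    rewrite (leq_trans (size_poly_exp_leq _ _))//.
    have [h _] := size_cheb R m; move: h; case: (size _) => [|s] /=; lia.
  lia.
move=> t /andP[t0 t1]; rewrite hornerZ -gE.
(* The derivative c - J(t) is nonnegative on [0, 1/2], so t c - g lies between 0 and its value at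
   1/2. Dividing 8 N^2 by c >= N^3/32 gives 256/N. *)
have psi0 : 0 <= t * c - g.[t].
  have : ('X * c%:P - g).[0] <= ('X * c%:P - g).[t].
    apply: deriv_poly_ge0_le => // x /andP[x0 x1].
    rewrite derivB derivM derivX derivC mulr0 addr0 mul1r f' hornerD hornerN hornerC.
    by rewrite subr_ge0 Jmono//; lra.
  by rewrite !hornerD !hornerN !hornerM !hornerX !hornerC mul0r g0 subr0.
have psi1 : t * c - g.[t] <= 8 * N ^+ 2.
  apply: le_trans chi.
  have : ('X * c%:P - g).[t] <= ('X * c%:P - g).[2^-1].
    apply: deriv_poly_ge0_le => // x /andP[x0 x1].
    rewrite derivB derivM derivX derivC mulr0 addr0 mul1r f' hornerD hornerN hornerC.
    by rewrite subr_ge0 Jmono//; lra.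
  by rewrite !hornerD !hornerN !hornerM !hornerX !hornerC.
have -> : t - c^-1 * g.[t] = (t * c - g.[t]) / c by field; lra.
rewrite ger0_norm ?divr_ge0 ?(ltW c0)// ler_pdivrMr//.
apply: (le_trans psi1).
apply: (@le_trans _ _ (256 / N * (N ^+ 3 / 32))); last first.
  by apply: (ler_wpM2l _ c_ge); exact: divr_ge0 (ler0n _ _) (le_trans ler01 N1).
rewrite le_eqVlt; apply/orP; left; apply/eqP; field; lra.
Qed.

Lemma sqrt_approx (R : realType) : exists2 C0 : R, 0 < C0 & forall K : nat,
  exists2 P : {poly R}, (size P <= K.+1)%N &
    forall x, 0 <= x <= 1 -> `|Num.sqrt x - P.[x]| <= C0 / K.+1%:R.
Proof.
(* The factor 2 undoes the substitution t = sqrt x / 2, which brings [0, 1] to [0, 1/2]; the 5 pays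
   for rounding, as K + 2 <= 5 (2m + 1) when m = K %/ 4. *)
exists (2 * 256 * 5); first by rewrite !mulr_gt0 ?ltr0n.
case=> [|K].
  exists 0; first by rewrite size_poly0.
  move=> x /andP[x0 x1]; rewrite horner0 subr0 divr1 ger0_norm ?sqrtr_ge0//.
  rewrite (@le_trans _ _ 1)//; last by lra.
  by rewrite -[leRHS]sqrtr1 ler_wsqrtr.
pose m := (K %/ 4)%N.
have [F [sF hF]] := abs_even_approx R m.
exists (2 *: (F \Po (4^-1 *: 'X))).
  rewrite (leq_trans (size_scale_leq _ _))// (leq_trans (size_comp_poly_leq _ _))//.
  rewrite ltnS; have s2 : ((size (4^-1 *: 'X : {poly R})).-1 <= 1)%N.
    by rewrite -subn1 leq_subLR (leq_trans (size_scale_leq _ _))// size_polyX.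
  rewrite (leq_trans (leq_mul (leqnn _) s2))// muln1.
  have := leq_divM K 4; rewrite -/m mulnC; lia.
move=> x /andP[x0 x1].
have t01 : 0 <= Num.sqrt x / 2 <= 2^-1.
  have := ler_wsqrtr x1; rewrite sqrtr1; have := sqrtr_ge0 x; lra.
have := hF _ t01; rewrite expr_div_n sqr_sqrtr// => h.
rewrite hornerZ horner_comp hornerZ hornerX.
have -> : Num.sqrt x - 2 * F.[4^-1 * x] = 2 * (Num.sqrt x / 2 - F.[x / 2 ^+ 2]).
  have -> : 4^-1 * x = x / 2 ^+ 2 by field.
  by field.
rewrite normrM ger0_norm//.
apply: (@le_trans _ _ (2 * (256 / (2 * m + 1)%:R))); first by rewrite ler_wpM2l.
rewrite mulrA ler_pdivrMr ?ltr0n ?addn1// mulrAC ler_pdivlMr ?ltr0n//.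
rewrite -[leRHS]mulrA; apply: ler_wpM2l; first exact: mulr_ge0 (ler0n _ _) (ler0n _ _).
rewrite -natrM ler_nat.
have := ltn_ceil K (isT : 0 < 4)%N; rewrite -/m; lia.
Qed.

Lemma abs_approx (R : realType) : exists2 C0 : R, 0 < C0 & forall K : nat,
  exists2 P : {poly R}, (size P <= K.+1)%N &
    forall t, -1 <= t <= 1 -> `| `|t| - P.[t] | <= C0 / K.+1%:R.
Proof.
have [C0 C00 hC] := sqrt_approx R; exists (2 * C0); first by rewrite mulr_gt0.
move=> K; have [P sP hP] := hC (K./2); exists (P \Po 'X^2).
  rewrite (leq_trans (size_comp_poly_leq _ _))// size_polyXn /=.
  have := odd_double_half K; move: sP; rewrite -!muln2; move: (size P) K./2 (odd K) => a b c; lia.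
move=> t ht; rewrite horner_comp hornerXn -[`|t|]sqrtr_sqr.
have t2 : 0 <= t ^+ 2 <= 1.
  by rewrite sqr_ge0/= -[t ^+ 2]real_normK ?num_real// expr_le1// ler_norml.
apply: le_trans (hP _ t2) _.
rewrite ler_pdivrMr ?ltr0n// mulrAC ler_pdivlMr ?ltr0n//.
rewrite [leRHS]mulrAC [leRHS]mulrC ler_wpM2l ?(ltW C00)// -natrM ler_nat.
have := odd_double_half K; rewrite -!muln2; move: K./2 (odd K) => b c; lia.
Qed.

(** * Bivariate polynomials of bounded degree, and the two bivariate approximations *)

Lemma degree_le2D (R : realType) K (u v : {poly {poly R}}) :
  degree_le2 K u -> degree_le2 K v -> degree_le2 K (u + v).
Proof.
rewrite /degree_le2 !sizeYE rmorphD/= => /andP[u1 u2] /andP[v1 v2].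
by rewrite !(leq_trans (size_polyD _ _))// geq_max ?u1 ?u2.
Qed.

Lemma degree_le2N (R : realType) K (u : {poly {poly R}}) :
  degree_le2 K u -> degree_le2 K (- u).
Proof. by rewrite /degree_le2 !sizeYE raddfN/= !size_polyN. Qed.

Lemma degree_le2_sum (R : realType) K (I : Type) (r : seq I) (P : pred I)
    (F : I -> {poly {poly R}}) :
  (forall i, P i -> degree_le2 K (F i)) -> degree_le2 K (\sum_(i <- r | P i) F i).
Proof.
move=> h; elim/big_ind : _ => //; last exact: degree_le2D.
by rewrite /degree_le2 sizeYE rmorph0 !size_poly0.
Qed.

Lemma degree_le2M (R : realType) K L (u v : {poly {poly R}}) :
  degree_le2 K u -> degree_le2 L v -> degree_le2 (K + L)%N (u * v).
Proof.
rewrite /degree_le2 !sizeYE rmorphM/= => /andP[u1 u2] /andP[v1 v2].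
apply/andP; split; rewrite (leq_trans (size_polyMleq _ _))// -subn1 leq_subLR.
  by rewrite (leq_trans (leq_add u1 v1))// addSn addnS.
by rewrite (leq_trans (leq_add u2 v2))// addSn addnS.
Qed.

Lemma degree_le2W (R : realType) K L (u : {poly {poly R}}) : (K <= L)%N ->
  degree_le2 K u -> degree_le2 L u.
Proof. by move=> KL /andP[u1 u2]; rewrite /degree_le2 (leq_trans u1)// (leq_trans u2). Qed.

Lemma degree_le2C (R : realType) (c : R) : degree_le2 0 c%:P%:P.
Proof.
by rewrite /degree_le2 sizeYE swapXY_polyC map_polyC/= !size_polyC_leq1.
Qed.

Lemma degree_le2X (R : realType) : degree_le2 1 ('X : {poly {poly R}}).
Proof.
by rewrite /degree_le2 sizeYE swapXY_X size_polyX (leq_trans (size_polyC_leq1 _)).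
Qed.

Lemma degree_le2Y (R : realType) : degree_le2 1 ('Y : {poly {poly R}}).
Proof.
by rewrite /degree_le2 sizeYE swapXY_Y size_polyX (leq_trans (size_polyC_leq1 _)).
Qed.

(* For z_+- = ((sqrt x +- sqrt y) / 2)^2 the sums z_+^k + z_-^k are polynomials
   in z_+ + z_- = (x + y) / 2 and z_+ z_- = ((x - y) / 4)^2. *)
Lemma power_sum_poly (R : realType) (k : nat) : exists2 V : {poly {poly R}},
  degree_le2 k V & forall s t : R,
    V.[s ^+ 2, t ^+ 2] = ((s + t) ^+ 2 / 4) ^+ k + ((s - t) ^+ 2 / 4) ^+ k.
Proof.
pose h : {poly {poly R}} := (2^-1)%:P%:P * ('X + 'Y).
pose g : {poly {poly R}} := (4^-1)%:P%:P * ('X - 'Y).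
have dh : degree_le2 1 h.
  apply: (degree_le2M (degree_le2C _)).
  by apply: degree_le2D; [exact: degree_le2X|exact: degree_le2Y].
have dg : degree_le2 1 g.
  apply: (degree_le2M (degree_le2C _)); apply: degree_le2D; first exact: degree_le2X.
  exact/degree_le2N/degree_le2Y.
have hE (x y : R) : h.[x, y] = (x + y) / 2.
  by rewrite !(hornerM, hornerD, hornerC, hornerX) mulrC.
have gE (x y : R) : g.[x, y] = (x - y) / 4.
  by rewrite !(hornerM, hornerD, hornerN, hornerC, hornerX) mulrC.
clearbody h g.
suff [] : (exists2 V : {poly {poly R}}, degree_le2 k V & forall s t : R,
    V.[s ^+ 2, t ^+ 2] = ((s + t) ^+ 2 / 4) ^+ k + ((s - t) ^+ 2 / 4) ^+ k) /\
  (exists2 V : {poly {poly R}}, degree_le2 k.+1 V & forall s t : R,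
    V.[s ^+ 2, t ^+ 2] = ((s + t) ^+ 2 / 4) ^+ k.+1 + ((s - t) ^+ 2 / 4) ^+ k.+1).
  by [].
elim: k => [|k [[V0 d0 h0] [V1 d1 h1]]].
  split; first by exists 2%:P%:P; [exact: degree_le2C|move=> s t; rewrite !hornerC !expr0].
  by exists h => // s t; rewrite hE !expr1; field.
split; first by exists V1.
exists (h * V1 - g * g * V0).
  apply: degree_le2D; first exact: (degree_le2M dh d1).
  exact/degree_le2N/(degree_le2M (degree_le2M dg dg) d0).
move=> s t; rewrite hornerD hornerN !hornerM hornerD hornerN !hornerM hE gE h0 h1.
by rewrite !exprS; field.
Qed.

Lemma sqrt_sum_approx (R : realType) : exists2 C0 : R, 0 < C0 & forall K : nat,
  exists2 u : {poly {poly R}}, degree_le2 K u &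
    forall x y, 0 <= x <= 1 -> 0 <= y <= 1 ->
      `|Num.sqrt x + Num.sqrt y - u.[x, y]| <= C0 / K.+1%:R.
Proof.
have [C0 C00 hC] := sqrt_approx R; exists (2 * C0); first by rewrite mulr_gt0.
move=> K; have [P sP hP] := hC K; exists (P^:P + P%:P).
  apply: degree_le2D; rewrite /degree_le2 sizeYE.
    by rewrite swapXY_map_polyC size_map_polyC sP (leq_trans (size_polyC_leq1 _)).
  by rewrite swapXY_polyC size_map_polyC sP (leq_trans (size_polyC_leq1 _)).
move=> x y hx hy; rewrite hornerD hornerC hornerD horner_map hornerC.
rewrite opprD addrACA mulrDl mul1r mulrDl (le_trans (ler_normD _ _))//.
by rewrite lerD// hP.
Qed.

(** With s and t the square roots, max (s - t) 0 = (s + t)/2 + |s - t|/2 - t, and the first two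
    terms are the square roots of z_+ and z_-. Approximating the three roots by the same P yields
    P(z_+) + P(z_-) - P(y); the first two terms are a combination of power sums, hence a polynomial
    in x and y of no larger degree. Three roots give the constant 3 C0. *)
Lemma sqrt_diff_approx (R : realType) : exists2 C0 : R, 0 < C0 & forall K : nat,
  exists2 v : {poly {poly R}}, degree_le2 K v &
    forall x y, 0 <= x <= 1 -> 0 <= y <= 1 ->
      `|Num.max (Num.sqrt x - Num.sqrt y) 0 - v.[x, y]| <= C0 / K.+1%:R.
Proof.
have [C0 C00 hC] := sqrt_approx R; exists (3 * C0); first by rewrite mulr_gt0.
move=> K; have [P sP hP] := hC K.
have /choice[V hV] : forall k, exists V : {poly {poly R}}, degree_le2 k V /\
   forall s t : R,
    V.[s ^+ 2, t ^+ 2] = ((s + t) ^+ 2 / 4) ^+ k + ((s - t) ^+ 2 / 4) ^+ k.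
  by move=> k; have [V] := power_sum_poly R k; exists V.
exists (\sum_(k < size P) (P`_k)%:P%:P * V k - P%:P).
  apply: degree_le2D.
    apply: degree_le2_sum => k _; apply: (@degree_le2W _ (0 + k)%N); last first.
      by apply: degree_le2M; [exact: degree_le2C|apply: (hV k).1].
    by rewrite add0n -ltnS (leq_trans (ltn_ord k)).
  apply: degree_le2N; rewrite /degree_le2 sizeYE.
  by rewrite swapXY_polyC size_map_polyC sP (leq_trans (size_polyC_leq1 _)).
move=> x y /andP[x0 x1] /andP[y0 y1].
set s := Num.sqrt x; set t := Num.sqrt y.
have s0 : 0 <= s by exact: sqrtr_ge0.
have t0 : 0 <= t by exact: sqrtr_ge0.
have s1 : s <= 1 by rewrite -[leRHS]sqrtr1 ler_wsqrtr.
have t1 : t <= 1 by rewrite -[leRHS]sqrtr1 ler_wsqrtr.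
have -> : (\sum_(k < size P) (P`_k)%:P%:P * V k - P%:P).[x, y] =
   P.[(s + t) ^+ 2 / 4] + P.[(s - t) ^+ 2 / 4] - P.[y].
  rewrite hornerD hornerN hornerC hornerD hornerN; congr (_ - _).
  rewrite !horner_sum [in RHS]horner_coef [X in _ = _ + X]horner_coef -big_split/=.
  apply: eq_bigr => k _; rewrite hornerM hornerC hornerM hornerC.
  by rewrite -{1}(sqr_sqrtr x0) -{1}(sqr_sqrtr y0) (hV k).2 mulrDr.
have hp : 0 <= (s + t) ^+ 2 / 4 <= 1.
  rewrite divr_ge0 ?sqr_ge0//= ler_pdivrMr// mul1r (_ : 4 = 2 ^+ 2); last by ring.
  by rewrite lerXn2r ?nnegrE; lra.
have hm : 0 <= (s - t) ^+ 2 / 4 <= 1.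
  rewrite divr_ge0 ?sqr_ge0//= ler_pdivrMr// mul1r (_ : 4 = 2 ^+ 2); last by ring.
  rewrite -[_ ^+ 2]real_normK ?num_real// lerXn2r ?nnegrE// ler_norml; lra.
have sq4 z : Num.sqrt (z ^+ 2 / 4) = `|z| / 2.
  rewrite (_ : 4 = 2 ^+ 2); last by ring.
  by rewrite -expr_div_n sqrtr_sqr normrM [`|2^-1|]ger0_norm ?invr_ge0.
have := hP _ hp; have := hP _ hm; have := hP y; rewrite y0 y1 => /(_ isT).
rewrite !sq4 -/t (ger0_norm (addr_ge0 s0 t0)).
set e := C0 / _; move=> e1 e2 e3.
have -> : Num.max (s - t) 0 = (s + t) / 2 + `|s - t| / 2 - t.
  have [st|st] := ger0P (s - t).
    by field.
  by field.
rewrite -mulrA -/e; move: e1 e2 e3; rewrite !ler_norml; lra.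
Qed.

(** * Coefficients of bounded polynomials *)

(** [nu] is a parameter so that the construction iterates: nested twice it is the l^1 norm of the
    coefficients of a bivariate polynomial. The l^1 norm is taken because it is submultiplicative,
    which handles the product u v. *)
Definition coef_norm (R : realType) (A : nzRingType) (nu : A -> R) (P : {poly A}) : R :=
  \sum_(i < size P) nu P`_i.

Lemma coef_norm_widen (R : realType) (A : nzRingType) (nu : A -> R) (P : {poly A}) n :
  nu 0 = 0 -> (size P <= n)%N -> coef_norm nu P = \sum_(i < n) nu P`_i.
Proof.
move=> nu0 sP; rewrite /coef_norm (big_ord_widen n (fun i => nu P`_i) sP) big_mkcond.
by apply: eq_bigr => i _; case: ltnP => // h; rewrite nth_default.
Qed.

Lemma coef_norm_ge0 (R : realType) (A : nzRingType) (nu : A -> R) (P : {poly A}) :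
  (forall a, 0 <= nu a) -> 0 <= coef_norm nu P.
Proof. by move=> h; apply: sumr_ge0. Qed.

Lemma coef_norm0 (R : realType) (A : nzRingType) (nu : A -> R) :
  coef_norm nu (0 : {poly A}) = 0.
Proof. by rewrite /coef_norm size_poly0 big_ord0. Qed.

Lemma coef_normD (R : realType) (A : nzRingType) (nu : A -> R) (P Q : {poly A}) :
  nu 0 = 0 -> (forall a b, nu (a + b) <= nu a + nu b) ->
  coef_norm nu (P + Q) <= coef_norm nu P + coef_norm nu Q.
Proof.
move=> nu0 nuD; pose n := maxn (size P) (size Q).
rewrite (coef_norm_widen nu0 (size_polyD P Q)) -/n.
rewrite (coef_norm_widen nu0 (leq_maxl (size P) (size Q))) -/n.
rewrite (coef_norm_widen nu0 (leq_maxr (size P) (size Q))) -/n.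
by rewrite -big_split ler_sum// => i _; rewrite coefD.
Qed.

Lemma coef_norm_sum (R : realType) (A : nzRingType) (nu : A -> R) n
    (F : 'I_n -> {poly A}) :
  nu 0 = 0 -> (forall a b, nu (a + b) <= nu a + nu b) ->
  coef_norm nu (\sum_(i < n) F i) <= \sum_(i < n) coef_norm nu (F i).
Proof.
move=> nu0 nuD; elim/big_ind2 : _ => //; first by rewrite coef_norm0.
by move=> P a Q b hP hQ; rewrite (le_trans (coef_normD _ _ nu0 nuD))// lerD.
Qed.

Lemma coef_normM (R : realType) (A : nzRingType) (nu : A -> R) (P Q : {poly A}) :
  nu 0 = 0 -> (forall a b, nu (a + b) <= nu a + nu b) ->
  (forall a b, nu (a * b) <= nu a * nu b) ->
  coef_norm nu (P * Q) <= coef_norm nu P * coef_norm nu Q.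
Proof.
move=> nu0 nuD nuM; rewrite -{1}[P]coefK poly_def mulr_suml.
rewrite (le_trans (coef_norm_sum _ nu0 nuD))// mulr_suml; apply: ler_sum => i _.
have sz : (size (P`_i *: 'X^i * Q)%R <= i + size Q)%N.
  rewrite (leq_trans (size_polyMleq _ _))// -subn1 leq_subLR addnA leq_add2r.
  by rewrite (leq_trans (size_scale_leq _ _))// size_polyXn add1n.
rewrite (coef_norm_widen nu0 sz) big_split_ord/= big1 ?add0r; last first.
  by move=> j _; rewrite -scalerAl coefZ coefXnM ltn_ord mulr0.
rewrite mulr_sumr ler_sum// => j _.
by rewrite -scalerAl coefZ coefXnM ltnNge leq_addr/= addKn.
Qed.

Lemma coef_normZ (R : realType) (c : R) (P : {poly R}) :
  coef_norm Num.norm (c *: P) = `|c| * coef_norm Num.norm P.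
Proof.
rewrite (@coef_norm_widen _ _ _ _ (size P)) ?normr0 ?size_scale_leq//.
by rewrite mulr_sumr; apply: eq_bigr => i _; rewrite coefZ normrM.
Qed.

Lemma coef_le_coef_norm (R : realType) (A : nzRingType) (nu : A -> R) (P : {poly A}) i :
  nu 0 = 0 -> (forall a, 0 <= nu a) -> nu P`_i <= coef_norm nu P.
Proof.
move=> nu0 nu_ge0; have [h|h] := ltnP i (size P).
  rewrite /coef_norm (bigD1 (Ordinal h))//= lerDl; exact: sumr_ge0.
by rewrite nth_default// nu0 coef_norm_ge0.
Qed.

Definition fdiff (R : realType) (f : nat -> R) : nat -> R := fun i => f i.+1 - f i.

(** Newton's forward-difference formula, by Pascal's rule. The summation range depends on n alone,
    so a single sum interpolates at all the nodes i <= n. *)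
Lemma newton_fdiff (R : realType) (f : nat -> R) (i n : nat) : (i <= n)%N ->
  f i = \sum_(k < n.+1) 'C(i, k)%:R * iter k (@fdiff R) f 0%N.
Proof.
elim: i f n => [|i IH] f n.
  move=> _; rewrite big_ord_recl/= bin0 mul1r big1 ?addr0// => k _.
  by rewrite /bump /= add1n bin0n mul0r.
case: n => // n; rewrite ltnS => le_in.
have -> : f i.+1 = f i + fdiff f i by rewrite /fdiff addrC subrK.
rewrite (IH f n.+1 (leqW le_in)) (IH (fdiff f) n le_in).
rewrite [in LHS]big_ord_recl [in RHS]big_ord_recl/= !bin0 -addrA; congr (_ + _).
rewrite -big_split/=; apply: eq_bigr => k _.
by rewrite /bump /= add1n -iterSr binS natrD mulrDl.
Qed.

Lemma fdiff_le (R : realType) (f : nat -> R) (B : R) (k : nat) :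
  (forall i, (i <= k)%N -> `|f i| <= B) -> `|iter k (@fdiff R) f 0%N| <= 2 ^+ k * B.
Proof.
elim: k f B => [|k IH] f B h; first by rewrite mul1r h.
rewrite iterSr exprSr -mulrA; apply: IH => i ik.
rewrite mulrDl mul1r (le_trans (ler_normB _ _))// lerD// h//.
exact: leqW.
Qed.

(** The binomial coefficient of M x over k, that is, the Newton basis for the nodes i / M. *)
Definition newton_poly (R : realType) (M k : nat) : {poly R} :=
  k`!%:R^-1 *: \prod_(j < k) (M%:R *: 'X - j%:R%:P).

Lemma newton_polyE (R : realType) (M k i : nat) : (0 < M)%N ->
  (newton_poly R M k).[i%:R / M%:R] = 'C(i, k)%:R.
Proof.
move=> M0; have fk : k`!%:R != 0 :> R by rewrite pnatr_eq0 -lt0n fact_gt0.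
apply: (mulfI fk); rewrite hornerZ mulVKf// horner_prod -natrM mulnC bin_ffact.
rewrite ffact_prod natr_prod.
have [ik|ki] := ltnP i k.
  rewrite (bigD1 (Ordinal ik))//= !(hornerD, hornerN, hornerZ, hornerX, hornerC).
  rewrite [M%:R * _]mulrC divfK ?pnatr_eq0 -?lt0n// subrr mul0r.
  by rewrite [RHS](bigD1 (Ordinal ik))//= subnn mul0r.
apply: eq_bigr => j _; rewrite !(hornerD, hornerN, hornerZ, hornerX, hornerC).
rewrite [M%:R * _]mulrC divfK ?pnatr_eq0 -?lt0n// natrB//.
by rewrite ltnW// (leq_trans (ltn_ord j)).
Qed.

Lemma size_newton_poly (R : realType) (M k : nat) :
  (size (newton_poly R M k) <= k.+1)%N.
Proof.
rewrite (leq_trans (size_scale_leq _ _))// (leq_trans (size_poly_prod_leq _ _))//.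
rewrite cardE size_enum_ord leq_subLR.
have : (\sum_(i < k) size (M%:R *: 'X - i%:R%:P : {poly R})%R <= \sum_(i < k) 2)%N.
  apply: leq_sum => i _; rewrite (leq_trans (size_polyD _ _))// geq_max.
  rewrite (leq_trans (size_scale_leq _ _)) ?size_polyX//= size_polyN.
  by rewrite (leq_trans (size_polyC_leq1 _)).
by rewrite sum_nat_const card_ord addnS ltnS addnn -muln2.
Qed.

(** The factors M x - j have norm at most M + j, and their product over k! is a binomial coefficient
    of upper index M + k - 1. *)
Lemma coef_norm_newton_poly (R : realType) (M k : nat) : (0 < M)%N ->
  coef_norm Num.norm (newton_poly R M k) <= 2 ^+ (M + k).
Proof.
move=> M0; rewrite coef_normZ ger0_norm ?invr_ge0//.
have h n : coef_norm Num.norm (\prod_(j < n) (M%:R *: 'X - j%:R%:P) : {poly R})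
    <= \prod_(j < n) (M + j)%:R.
  elim: n => [|n IH].
    by rewrite !big_ord0 /coef_norm size_poly1 big_ord1 coef1 normr1.
  rewrite !big_ord_recr/= (le_trans (coef_normM _ _ _ _ _)) ?normr0//.
  - exact: ler_normD.
  - by move=> a b; rewrite normrM.
  apply: ler_pM; rewrite ?coef_norm_ge0//.
  rewrite (le_trans (coef_normD _ _ _ _)) ?normr0//; first exact: ler_normD.
  rewrite natrD lerD// ?coef_normZ -?polyCN.
    by rewrite ger0_norm// /coef_norm size_polyX !big_ord_recl big_ord0 !coefX/= normr0 normr1 add0r addr0 mulr1.
  rewrite (@coef_norm_widen _ _ _ _ 1) ?normr0 ?size_polyC_leq1//.
  by rewrite big_ord1 coefC/= normrN ger0_norm.
rewrite mulrC ler_pdivrMr ?ltr0n ?fact_gt0//; apply: (le_trans (h k)).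
have -> : \prod_(j < k) (M + j)%:R = ((M + k).-1 ^_ k)%:R :> R.
  rewrite ffact_prod natr_prod (reindex_inj rev_ord_inj)/=.
  by apply: eq_bigr => j _; congr _%:R; have := ltn_ord j; lia.
rewrite -bin_ffact natrM ler_wpM2r// -natrX ler_nat.
apply: (@leq_trans (2 ^ (M + k).-1)).
  rewrite -[X in (_ <= X ^ _)%N](addn1 1) expnDn.
  have [kM|kM] := ltnP k (M + k).-1.+1; last by rewrite bin_small.
  by rewrite (bigD1 (Ordinal kM))//= !exp1n !muln1 leq_addr.
by rewrite leq_exp2l// leq_pred.
Qed.

(** P is recovered by Newton interpolation from its values at i / (K+1), i <= K. The k-th difference
    is at most 2^k B and the k-th basis polynomial has norm at most 2^(K+1+k), so the sum is at most
    B 2^(K+1) 4^(K+1). The mesh 1/(K+1), not 1/K, keeps K = 0 meaningful. *)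
Lemma coef_norm_le (R : realType) (K : nat) (B : R) (P : {poly R}) :
  (size P <= K.+1)%N -> (forall x, 0 <= x <= 1 -> `|P.[x]| <= B) ->
  coef_norm Num.norm P <= B * 8 ^+ K.+1.
Proof.
move=> sP hP; have B0 : 0 <= B by apply: le_trans (hP 0 _); rewrite ?lexx ?ler01.
pose f i := P.[i%:R / K.+1%:R].
pose d k := iter k (@fdiff R) f 0%N.
have hd k : (k <= K)%N -> `|d k| <= 2 ^+ k * B.
  move=> kK; apply: fdiff_le => i ik; apply: hP.
  by rewrite divr_ge0//= ler_pdivrMr ?ltr0n// mul1r ler_nat; lia.
have PE : P = \sum_(k < K.+1) d k *: newton_poly R K.+1 k.
  apply/eqP; rewrite -subr_eq0; apply/eqP.
  pose rs := [seq i%:R / K.+1%:R : R | i <- iota 0 K.+1].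
  apply: (@roots_geq_poly_eq0 _ _ rs).
  - apply/allP => z /mapP[i]; rewrite mem_iota add0n => /andP[_ iK] ->.
    rewrite rootE hornerD hornerN horner_sum subr_eq0; apply/eqP.
    rewrite -/(f i) (newton_fdiff f (ltnSE iK)); apply: eq_bigr => k _.
    by rewrite hornerZ newton_polyE// mulrC.
  - rewrite map_inj_uniq ?iota_uniq// => i j /divIf h.
    by apply/eqP; rewrite -(eqr_nat R); apply/eqP/h; rewrite pnatr_eq0.
  rewrite size_map size_iota (leq_trans (size_polyD _ _))// geq_max sP size_polyN/=.
  rewrite (leq_trans (size_sum _ _ _))//; apply/bigmax_leqP => k _.
  by rewrite (leq_trans (size_scale_leq _ _))// (leq_trans (size_newton_poly _ _ _)).
rewrite {1}PE (le_trans (coef_norm_sum _ _ _)) ?normr0//; first exact: ler_normD.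
apply: (@le_trans _ _ (\sum_(k < K.+1) B * 2 ^+ K.+1 * 4 ^+ k)).
  apply: ler_sum => k _; rewrite coef_normZ.
  rewrite (le_trans (ler_pM _ _ (hd k (ltnSE (ltn_ord k))) (coef_norm_newton_poly _ _ _)))//.
    by apply: coef_norm_ge0.
  rewrite exprD (_ : 4 = 2 * 2); last by ring.
  by rewrite exprMn le_eqVlt; apply/orP; left; apply/eqP; ring.
rewrite -mulr_sumr -mulrA ler_wpM2l// (_ : 8 = 2 * 4); last by ring.
rewrite exprMn ler_wpM2l ?exprn_ge0//.
elim: (K.+1) => [|n IH]; first by rewrite big_ord0.
rewrite big_ord_recr/= exprS; have : 0 <= 4 ^+ n :> R by rewrite exprn_ge0.
by move: IH; set s := \sum_(_ < _) _; lra.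
Qed.

(** The univariate bound is used twice: in x for each fixed y, which bounds every coefficient as a
    function of y, then in y. The last factor 2^(K+1) dominates the K + 1 coefficients. *)
Lemma coef_norm2_le (R : realType) (K : nat) (B : R) (u : {poly {poly R}}) :
  degree_le2 K u ->
  (forall x y, 0 <= x <= 1 -> 0 <= y <= 1 -> `|u.[x, y]| <= B) ->
  coef_norm (coef_norm Num.norm) u <= B * 128 ^+ K.+1.
Proof.
move=> /andP[su sYu] hu.
have B0 : 0 <= B by apply: le_trans (hu 0 0 _ _); rewrite ?lexx ?ler01.
have hi i : coef_norm Num.norm u`_i <= B * 8 ^+ K.+1 * 8 ^+ K.+1.
  apply: coef_norm_le; first by rewrite (leq_trans (max_size_coefXY _ _)).
  move=> y hy; pose P := map_poly (horner_eval y) u.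
  have PE x : P.[x] = u.[x, y].
    by rewrite /P -[in LHS](hornerC x y) (horner_map (horner_eval y)).
  have : coef_norm Num.norm P <= B * 8 ^+ K.+1.
    apply: coef_norm_le => [|x hx]; last by rewrite PE hu.
    by rewrite (leq_trans (size_poly _ _)).
  apply: le_trans; have := coef_le_coef_norm (nu := Num.norm) P i (normr0 _) (@normr_ge0 _ _).
  by rewrite coef_map.
rewrite (coef_norm_widen (coef_norm0 _) su).
apply: le_trans (ler_sum _ (fun (i : 'I_K.+1) _ => hi i)) _.
rewrite sumr_const card_ord -mulrnAr -mulrA ler_wpM2l// -[X in _ * X]mulr_natr mulrA -exprMn.
rewrite (_ : 128 = 8 * 8 * 2); last by ring.
rewrite [leRHS]exprMn ler_wpM2l ?exprn_ge0 ?mulr_ge0//.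
by rewrite -natrX ler_nat ltnW// ltn_expl.
Qed.

(** * Poisson moments of unbiased estimators *)

(** Also meaningful at l = 0, where 0 ^+ 0 = 1 makes it the point mass at 0: symbols may have
    probability zero. *)
Definition pois (R : realType) (l : R) (k : nat) : R :=
  l ^+ k / k`!%:R * expR (- l).

Definition pois_mass (R : realType) (l : R) (B : nat) : R := \sum_(a < B) pois l a.

Definition pois_sum2 (R : realType) (l m : R) (B : nat) (f : nat -> nat -> R) : R :=
  \sum_(a < B) \sum_(b < B) pois l a * pois m b * f a b.

Lemma pois_ge0 (R : realType) (l : R) k : 0 <= l -> 0 <= pois l k.
Proof. by move=> l0; rewrite !mulr_ge0 ?exprn_ge0 ?invr_ge0 ?expR_ge0. Qed.

Lemma series_exp_coeff_le (R : realType) (l : R) B : 0 <= l ->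
  \sum_(a < B) l ^+ a / a`!%:R <= expR l.
Proof.
move=> l0; have -> : \sum_(a < B) l ^+ a / a`!%:R = series (exp_coeff l) B.
  by rewrite seriesEord.
rewrite /expR.
apply: nondecreasing_cvgn_le; last exact: is_cvg_series_exp_coeff.
by apply: nondecreasing_series => n _ _; exact: exp_coeff_ge0.
Qed.

Lemma pois_mass_cvg (R : realType) (l : R) : pois_mass l @ \oo --> (1 : R).
Proof.
rewrite -(expRxMexpNx_1 l).
have -> : pois_mass l = (fun B => series (exp_coeff l) B * expR (- l)).
  by apply/funext => B; rewrite seriesEord/= mulr_suml.
by apply: cvgMl; exact: (is_cvg_series_exp_coeff l).
Qed.

Lemma pois_mass_le1 (R : realType) (l : R) B : 0 <= l -> pois_mass l B <= 1.
Proof.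
move=> l0; rewrite /pois_mass -mulr_suml -[leRHS](expRxMexpNx_1 l).
by rewrite ler_wpM2r ?expR_ge0// series_exp_coeff_le.
Qed.

Lemma pois_mass_ge0 (R : realType) (l : R) B : 0 <= l -> 0 <= pois_mass l B.
Proof. by move=> l0; apply: sumr_ge0 => a _; exact: pois_ge0. Qed.

(** Exact for truncated sums: dividing a! by the falling factorial shifts the index by i. For B <= i
    the truncated subtraction gives an empty mass, and all the falling factorials vanish too. *)
Lemma pois_sum_ffact (R : realType) (l : R) (B i : nat) :
  \sum_(a < B) pois l a * (a ^_ i)%:R = l ^+ i * pois_mass l (B - i).
Proof.
have [Bi|iB] := leqP B i.
  rewrite (eqP (Bi : (B - i)%N == 0%N)) /pois_mass big_ord0 mulr0 big1// => a _.
  by rewrite ffact_small ?mulr0// (leq_trans (ltn_ord a)).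
rewrite -[in LHS](subnKC (ltnW iB)) big_split_ord/= big1 ?add0r; last first.
  by move=> a _; rewrite ffact_small ?mulr0.
rewrite /pois_mass mulr_sumr; apply: eq_bigr => a _.
have := @ffact_fact (i + a) i (leq_addr _ _); rewrite addKn => /(congr1 (fun n => n%:R : R)).
rewrite natrM => h; rewrite /pois exprD -h.
have f0 n : n`!%:R != 0 :> R by rewrite pnatr_eq0 -lt0n fact_gt0.
have g0 : ((i + a) ^_ i)%:R != 0 :> R by rewrite pnatr_eq0 -lt0n ffact_gt0 leq_addr.
by field; rewrite f0 g0.
Qed.

Lemma g0S (R : realType) (n i a : nat) : (0 < n)%N ->
  g0 n i.+1 (a%:R / n%:R : R) = a%:R / n%:R * g0 n i (a.-1%:R / n%:R).
Proof.
move=> n0; rewrite /g0 big_ord_recl/= mul0r subr0.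
case: a => [|a]; first by rewrite !mul0r.
congr (_ * _); apply: eq_bigr => k _.
rewrite /bump /= add1n -!mulrBl; congr (_ / _).
by rewrite -(natr1 a) -(natr1 k); ring.
Qed.

Lemma g0_ffact (R : realType) (n i a : nat) : (0 < n)%N ->
  g0 n i (a%:R / n%:R : R) = (a ^_ i)%:R / n%:R ^+ i.
Proof.
move=> n0; elim: i a => [|i IH] a; first by rewrite /g0 big_ord0 divr1.
rewrite g0S// IH ffactnS natrM exprS.
have : n%:R != 0 :> R by rewrite pnatr_eq0 -lt0n.
by move: (n%:R) => x x0; field; rewrite x0 expf_neq0.
Qed.

Lemma pois_sum_g0 (R : realType) (n : nat) (p : R) (B i : nat) : (0 < n)%N ->
  \sum_(a < B) pois (n%:R * p) a * g0 n i (a%:R / n%:R) =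
  p ^+ i * pois_mass (n%:R * p) (B - i).
Proof.
move=> n0; under eq_bigr do rewrite g0_ffact// mulrA.
rewrite -mulr_suml pois_sum_ffact exprMn.
have : n%:R ^+ i != 0 :> R by rewrite expf_neq0// pnatr_eq0 -lt0n.
by move: (n%:R ^+ i) => x x0; field.
Qed.

Lemma pois_sum2_prod (R : realType) (l m : R) B (f g : nat -> R) :
  pois_sum2 l m B (fun a b => f a * g b) =
  (\sum_(a < B) pois l a * f a) * (\sum_(b < B) pois m b * g b).
Proof.
rewrite /pois_sum2 mulr_suml; apply: eq_bigr => a _.
by rewrite mulr_sumr; apply: eq_bigr => b _; ring.
Qed.

Lemma pois_sum2_sum (R : realType) (l m : R) B (I : Type) (r : seq I) (P : pred I)
    (f : I -> nat -> nat -> R) :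
  pois_sum2 l m B (fun a b => \sum_(i <- r | P i) f i a b) =
  \sum_(i <- r | P i) pois_sum2 l m B (f i).
Proof.
rewrite /pois_sum2 [RHS]exchange_big/=; apply: eq_bigr => a _.
rewrite [RHS]exchange_big/=; apply: eq_bigr => b _.
by rewrite mulr_sumr.
Qed.

Lemma pois_sum2Z (R : realType) (l m : R) B (c : R) (f : nat -> nat -> R) :
  pois_sum2 l m B (fun a b => c * f a b) = c * pois_sum2 l m B f.
Proof.
rewrite /pois_sum2 mulr_sumr; apply: eq_bigr => a _.
by rewrite mulr_sumr; apply: eq_bigr => b _; ring.
Qed.

Lemma pois_sum2D (R : realType) (l m : R) B (f g : nat -> nat -> R) :
  pois_sum2 l m B (fun a b => f a b + g a b) = pois_sum2 l m B f + pois_sum2 l m B g.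
Proof.
rewrite /pois_sum2 -big_split/=; apply: eq_bigr => a _.
by rewrite -big_split/=; apply: eq_bigr => b _; ring.
Qed.

Lemma pois_sum2_le (R : realType) (l m : R) B (f g : nat -> nat -> R) :
  0 <= l -> 0 <= m -> (forall a b, f a b <= g a b) ->
  pois_sum2 l m B f <= pois_sum2 l m B g.
Proof.
move=> l0 m0 fg; apply: ler_sum => a _; apply: ler_sum => b _.
by rewrite ler_wpM2l// mulr_ge0// pois_ge0.
Qed.

Lemma pois_sum2_nondecreasing (R : realType) (l m : R) (f : nat -> nat -> R) :
  0 <= l -> 0 <= m -> (forall a b, 0 <= f a b) ->
  nondecreasing_seq (fun B => pois_sum2 l m B f).
Proof.
move=> l0 m0 f0; apply/nondecreasing_seqP => B.
have t0 a b : 0 <= pois l a * pois m b * f a b by rewrite mulr_ge0 ?f0 ?(mulr_ge0 (pois_ge0 _ l0) (pois_ge0 _ m0)).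
rewrite /pois_sum2 big_ord_recr/= -[leLHS]addr0.
apply: lerD; last by apply: sumr_ge0 => b _; exact: t0.
by apply: ler_sum => a _; rewrite big_ord_recr/= lerDl t0.
Qed.

(** An expectation, read as the limit of sums over growing squares. Signed integrands need nothing
    more: means are used as limits, second moments as bounds on the partial sums. *)
Definition pois_moment (R : realType) (l m : R) (f : nat -> nat -> R) (c : R) : Prop :=
  (fun B => pois_sum2 l m B f) @ \oo --> c.

Lemma pois_moment_sum (R : realType) (l m : R) (I : Type) (r : seq I) (P : pred I)
    (f : I -> nat -> nat -> R) (c : I -> R) :
  (forall i, P i -> pois_moment l m (f i) (c i)) ->
  pois_moment l m (fun a b => \sum_(i <- r | P i) f i a b) (\sum_(i <- r | P i) c i).
Proof.
move=> h; rewrite /pois_moment.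
under eq_fun do rewrite pois_sum2_sum.
apply: cvg_big => //; exact: add_continuous.
Qed.

Lemma pois_momentZ (R : realType) (l m k : R) (f : nat -> nat -> R) (c : R) :
  pois_moment l m f c -> pois_moment l m (fun a b => k * f a b) (k * c).
Proof.
move=> h; rewrite /pois_moment.
under eq_fun do rewrite pois_sum2Z.
exact: cvgMr.
Qed.

Lemma pois_momentD (R : realType) (l m : R) (f g : nat -> nat -> R) (c d : R) :
  pois_moment l m f c -> pois_moment l m g d ->
  pois_moment l m (fun a b => f a b + g a b) (c + d).
Proof.
move=> h1 h2; rewrite /pois_moment.
under eq_fun do rewrite pois_sum2D.
exact: cvgD.
Qed.

Lemma pois_moment_g0 (R : realType) (n : nat) (p q : R) i j : (0 < n)%N ->
  pois_moment (n%:R * p) (n%:R * q)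
    (fun a b => g0 n i (a%:R / n%:R) * g0 n j (b%:R / n%:R)) (p ^+ i * q ^+ j).
Proof.
move=> n0; rewrite /pois_moment.
under eq_fun do rewrite pois_sum2_prod !pois_sum_g0//.
have h (l : R) k : (fun B => pois_mass l (B - k)%N) @ \oo --> (1 : R).
  by rewrite (cvg_centern k (pois_mass l)); exact: pois_mass_cvg.
have := cvgM (cvgMr (a := p ^+ i) (h (n%:R * p) i)) (cvgMr (a := q ^+ j) (h (n%:R * q) j)).
by rewrite !mulr1; apply; exact: eventually_filter.
Qed.

Lemma pois_sum2_le_moment (R : realType) (l m : R) (f : nat -> nat -> R) c B :
  0 <= l -> 0 <= m -> (forall a b, 0 <= f a b) ->
  pois_moment l m f c -> pois_sum2 l m B f <= c.
Proof.
move=> l0 m0 f0 h; rewrite -(cvg_lim (@Rhausdorff R) h).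
apply: nondecreasing_cvgn_le; first exact: pois_sum2_nondecreasing.
by apply/cvg_ex; exists c.
Qed.

(** * Algebra of the unbiased estimators *)

Lemma unbiased_widen (R : realType) n (D : {poly {poly R}}) (x y : R) s t :
  (size D <= s)%N -> (sizeY D <= t)%N ->
  unbiased n D x y = \sum_(i < s) \sum_(j < t) D`_i`_j * g0 n i x * g0 n j y.
Proof.
move=> sD tD; rewrite /unbiased.
under eq_bigr => i _.
  rewrite (big_ord_widen t (fun j => D`_i`_j * g0 n i x * g0 n j y)); last first.
    exact: leq_trans (max_size_coefXY _ _) tD.
  rewrite big_mkcond; under eq_bigr => j _.
    rewrite (_ : (if _ then _ else _) = D`_i`_j * g0 n i x * g0 n j y); last first.
      by case: ltnP => // h; rewrite nth_default// !mul0r.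
    over.
  over.
rewrite (big_ord_widen s (fun i => \sum_(j < t) D`_i`_j * g0 n i x * g0 n j y) sD).
rewrite big_mkcond; apply: eq_bigr => i _; case: ltnP => // h.
by rewrite nth_default// big1// => j _; rewrite coef0 !mul0r.
Qed.

Lemma unbiasedD (R : realType) n (D E : {poly {poly R}}) (x y : R) :
  unbiased n (D + E) x y = unbiased n D x y + unbiased n E x y.
Proof.
pose s := (size D + size E + size (D + E)%R)%N.
pose t := (sizeY D + sizeY E + sizeY (D + E))%N.
rewrite !(@unbiased_widen _ _ _ _ _ s t) /s /t; try lia.
rewrite -big_split/=; apply: eq_bigr => i _; rewrite -big_split/=.
by apply: eq_bigr => j _; rewrite !coefD !mulrDl.
Qed.

Lemma unbiasedCM (R : realType) n (c : R) (D : {poly {poly R}}) (x y : R) :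
  unbiased n (c%:P%:P * D) x y = c * unbiased n D x y.
Proof.
pose s := (size D + size (c%:P%:P * D)%R)%N.
pose t := (sizeY D + sizeY (c%:P%:P * D))%N.
rewrite !(@unbiased_widen _ _ _ _ _ s t) ?leq_addr ?leq_addl//.
rewrite mulr_sumr; apply: eq_bigr => i _; rewrite mulr_sumr.
by apply: eq_bigr => j _; rewrite !coefCM !mulrA.
Qed.

Lemma unbiasedN (R : realType) n (D : {poly {poly R}}) (x y : R) :
  unbiased n (- D) x y = - unbiased n D x y.
Proof.
have -> : - D = (-1)%:P%:P * D by rewrite !polyCN !mulN1r.
by rewrite unbiasedCM mulN1r.
Qed.

Lemma unbiased_sum (R : realType) n (I : Type) (r : seq I) (P : pred I)
    (F : I -> {poly {poly R}}) (x y : R) :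
  unbiased n (\sum_(i <- r | P i) F i) x y = \sum_(i <- r | P i) unbiased n (F i) x y.
Proof.
elim/big_ind2 : _ => //; last by move=> D a E b <- <-; rewrite unbiasedD.
by rewrite /unbiased size_poly0 big_ord0.
Qed.

Lemma unbiased1 (R : realType) n (x y : R) : unbiased n 1 x y = 1.
Proof.
rewrite (@unbiased_widen _ _ _ _ _ 1 1) ?size_poly1//; last first.
  by rewrite sizeYE rmorph1 size_poly1.
by rewrite !big_ord1 !(coef1, eqxx) /g0 !big_ord0 !mulr1.
Qed.

(** Multiplying by ['X] peels the first factor off each falling factorial and lowers the count by
    one. At a = 0 the prefactor vanishes, so the value of [a.-1] there is harmless. *)
Lemma unbiasedXM (R : realType) n (D : {poly {poly R}}) (a : nat) (y : R) :
  (0 < n)%N -> unbiased n ('X * D) (a%:R / n%:R) y =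
    a%:R / n%:R * unbiased n D (a.-1%:R / n%:R) y.
Proof.
move=> n0; pose s := (size D + size ('X * D)%R)%N.
pose t := (sizeY D + sizeY ('X * D))%N.
rewrite (@unbiased_widen _ _ _ _ _ s.+1 t) ?leq_addl ?leqW ?leq_addl//.
rewrite (@unbiased_widen _ _ _ _ _ s t) ?leq_addr//.
rewrite big_ord_recl big1 ?add0r => [|j _]; last by rewrite coefXM coef0 !mul0r.
rewrite mulr_sumr; apply: eq_bigr => i _; rewrite mulr_sumr; apply: eq_bigr => j _.
by rewrite lift0 coefXM g0S//=; ring.
Qed.

Lemma unbiasedYM (R : realType) n (D : {poly {poly R}}) (b : nat) (x : R) :
  (0 < n)%N -> unbiased n ('Y * D) x (b%:R / n%:R) =
    b%:R / n%:R * unbiased n D x (b.-1%:R / n%:R).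
Proof.
move=> n0; pose s := (size D + size ('Y * D)%R)%N.
pose t := (sizeY D + sizeY ('Y * D))%N.
rewrite (@unbiased_widen _ _ _ _ _ s t.+1) ?leq_addl ?leqW ?leq_addl//.
rewrite (@unbiased_widen _ _ _ _ _ s t) ?leq_addr//.
rewrite mulr_sumr; apply: eq_bigr => i _; rewrite mulr_sumr.
rewrite big_ord_recl coefCM coefXM !mul0r add0r; apply: eq_bigr => j _.
by rewrite lift0 coefXM g0S//=; ring.
Qed.

Lemma pois_moment_unbiased (R : realType) (n : nat) (p q : R) (D : {poly {poly R}}) :
  (0 < n)%N ->
  pois_moment (n%:R * p) (n%:R * q)
    (fun a b => unbiased n D (a%:R / n%:R) (b%:R / n%:R)) D.[p, q].
Proof.
move=> n0; rewrite (horner_coef D) horner_sum /unbiased; apply: pois_moment_sum => i _.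
have -> : (D`_i * p%:P ^+ i).[q] = \sum_(j < size D`_i) D`_i`_j * (p ^+ i * q ^+ j).
  rewrite hornerM -polyC_exp hornerC horner_coef mulr_suml.
  by apply: eq_bigr => j _; ring.
apply: pois_moment_sum => j _.
rewrite [X in pois_moment _ _ X](_ : _ = fun a b => D`_i`_j *
  (g0 n i (a%:R / n%:R) * g0 n j (b%:R / n%:R))); last first.
  by apply/funext => a; apply/funext => b; rewrite mulrA.
exact/pois_momentZ/pois_moment_g0.
Qed.

(** * Second moments of the estimators of powers of a linear form *)

Definition lin2 (R : realType) (al be : R) : {poly {poly R}} :=
  al%:P%:P * 'X + be%:P%:P * 'Y.

Lemma lin2E (R : realType) (al be p q : R) : (lin2 al be).[p, q] = al * p + be * q.
Proof. by rewrite !(hornerD, hornerM, hornerC, hornerX). Qed.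

Lemma unbiased_lin2M (R : realType) n (al be : R) (D : {poly {poly R}}) (a b : nat) :
  (0 < n)%N -> unbiased n (lin2 al be * D) (a%:R / n%:R) (b%:R / n%:R) =
    al * (a%:R / n%:R) * unbiased n D (a.-1%:R / n%:R) (b%:R / n%:R) +
    be * (b%:R / n%:R) * unbiased n D (a%:R / n%:R) (b.-1%:R / n%:R).
Proof.
move=> n0; rewrite mulrDl unbiasedD -!mulrA !unbiasedCM.
by rewrite unbiasedXM// unbiasedYM//; ring.
Qed.

(* The estimator of the power l^k is of binomial type: shifting a count by one
   acts on it as the derivation l^k -> k l^(k-1). *)
Lemma unbiased_lin2X_shift (R : realType) n (al be : R) (k a b : nat) : (0 < n)%N ->
  let G k (a b : nat) := unbiased n (lin2 al be ^+ k) (a%:R / n%:R) (b%:R / n%:R) in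
  G k a.+1 b = G k a b + al * k%:R / n%:R * G k.-1 a b /\
  G k a b.+1 = G k a b + be * k%:R / n%:R * G k.-1 a b.
Proof.
move=> n0 G; have GS j x y : G j.+1 x y = al * (x%:R / n%:R) * G j x.-1 y +
    be * (y%:R / n%:R) * G j x y.-1 by rewrite /G exprS unbiased_lin2M.
have G0 x y : G 0 x y = 1 by rewrite /G expr0 unbiased1.
have nn0 : n%:R != 0 :> R by rewrite pnatr_eq0 -lt0n.
move: (n%:R) nn0 G GS G0 => N N0 G GS G0.
elim: k a b => [|k IH] a b; first by rewrite !G0 !mulr0 !mul0r addr0.
have [IHa IHb] := (fun x y => (IH x y).1, fun x y => (IH x y).2).
have ha : a%:R * (G k a b - G k a.-1 b) = a%:R * (al * k%:R / N * G k.-1 a.-1 b).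
  by case: a => [|a]; rewrite ?mul0r// IHa/=; ring.
have hb : b%:R * (G k a b - G k a b.-1) = b%:R * (be * k%:R / N * G k.-1 a b.-1).
  by case: b {ha} => [|b]; rewrite ?mul0r// IHb/=; ring.
have hk : k%:R * G k a b = k%:R * (al * (a%:R / N) * G k.-1 a.-1 b +
    be * (b%:R / N) * G k.-1 a b.-1).
  by case: k {IH IHa IHb ha hb} => [|k]; rewrite ?mul0r// GS.
split; rewrite !GS /= -[k.+1%:R]natr1.
- rewrite -[a.+1%:R]natr1.
  have -> : G k a.+1 b.-1 = G k a b.-1 + al * k%:R / N * G k.-1 a b.-1 by rewrite IHa.
  apply/eqP; rewrite -subr_eq0; apply/eqP.
  transitivity (al / N * ((a%:R * (G k a b - G k a.-1 b) - a%:R * (al * k%:R / N * G k.-1 a.-1 b))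
     - (k%:R * G k a b - k%:R * (al * (a%:R / N) * G k.-1 a.-1 b + be * (b%:R / N) * G k.-1 a b.-1)))).
    by field.
  by rewrite ha hk !subrr mulr0.
- rewrite -[b.+1%:R]natr1.
  have -> : G k a.-1 b.+1 = G k a.-1 b + be * k%:R / N * G k.-1 a.-1 b by rewrite IHb.
  apply/eqP; rewrite -subr_eq0; apply/eqP.
  transitivity (be / N * ((b%:R * (G k a b - G k a b.-1) - b%:R * (be * k%:R / N * G k.-1 a b.-1))
     - (k%:R * G k a b - k%:R * (al * (a%:R / N) * G k.-1 a.-1 b + be * (b%:R / N) * G k.-1 a b.-1)))).
    by field.
  by rewrite hb hk !subrr mulr0.
Qed.

(** The polynomial that the product of the estimators of l^j and l^k estimates without bias, l being
    the linear form. In the correction term, the form with squared coefficients divided by n is the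
    variance of the estimator of l; at k = 0 the factor k / n removes it. *)
Fixpoint lin2_prod (R : realType) (n : nat) (al be : R) (j k : nat) : {poly {poly R}} :=
  if j is i.+1 then
    lin2 al be * lin2_prod n al be i k +
    (k%:R / n%:R)%:P%:P * (lin2 (al ^+ 2) (be ^+ 2) * lin2_prod n al be i k.-1)
  else lin2 al be ^+ k.

(** Peeling one l off l^j lowers a count in the first estimator only. The shift rule lowers it in
    the second as well, at the price of the term in l^(k-1); both factors then sit at the same
    counts and the induction applies. *)
Lemma unbiased_lin2_prod (R : realType) n (al be : R) (j k a b : nat) : (0 < n)%N ->
  unbiased n (lin2 al be ^+ j) (a%:R / n%:R) (b%:R / n%:R) *
  unbiased n (lin2 al be ^+ k) (a%:R / n%:R) (b%:R / n%:R) =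
  unbiased n (lin2_prod n al be j k) (a%:R / n%:R) (b%:R / n%:R).
Proof.
move=> n0; elim: j k a b => [|j IH] k a b.
  by rewrite expr0 unbiased1 mul1r.
rewrite /= unbiasedD unbiasedCM exprS !unbiased_lin2M// -!IH.
have h x y := unbiased_lin2X_shift al be k x y n0.
have ha : a%:R * unbiased n (lin2 al be ^+ k) (a%:R / n%:R) (b%:R / n%:R) =
   a%:R * (unbiased n (lin2 al be ^+ k) (a.-1%:R / n%:R) (b%:R / n%:R) +
   al * k%:R / n%:R * unbiased n (lin2 al be ^+ k.-1) (a.-1%:R / n%:R) (b%:R / n%:R)).
  by case: a => [|a]; rewrite ?mul0r// (h a b).1.
have hb : b%:R * unbiased n (lin2 al be ^+ k) (a%:R / n%:R) (b%:R / n%:R) =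
   b%:R * (unbiased n (lin2 al be ^+ k) (a%:R / n%:R) (b.-1%:R / n%:R) +
   be * k%:R / n%:R * unbiased n (lin2 al be ^+ k.-1) (a%:R / n%:R) (b.-1%:R / n%:R)).
  by case: b {ha} => [|b]; rewrite ?mul0r// (h a b).2.
move: ha hb.
have nn0 : n%:R != 0 :> R by rewrite pnatr_eq0 -lt0n.
move: (unbiased n (lin2 al be ^+ k) (a%:R / n%:R) (b%:R / n%:R)) => G.
move: (unbiased n _ _ _) => G1; move: (unbiased n _ _ _) => G2.
move: (unbiased n _ _ _) => G3; move: (unbiased n _ _ _) => G4.
move: (unbiased n _ _ _) => G5; move: (unbiased n _ _ _) => G6.
move: (n%:R) nn0 => N N0 ha hb.
rewrite mulrDl.
transitivity (al / N * G5 * (a%:R * G) + be / N * G6 * (b%:R * G)); first by field.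
by rewrite ha hb; field.
Qed.

(** w dominates both |l| and the square root of K times the variance. Each step of the recursion
    then costs 2 w: the main term gains a factor w, and the correction term gains w^2 while its
    power of l drops by one. *)
Lemma lin2_prod_le (R : realType) n (al be p q w : R) (K j k : nat) :
  `|al * p + be * q| <= w ->
  K%:R * ((al ^+ 2 * p + be ^+ 2 * q) / n%:R) <= w ^+ 2 ->
  0 <= al ^+ 2 * p + be ^+ 2 * q -> (k <= K)%N ->
  `|(lin2_prod n al be j k).[p, q]| <= 2 ^+ j * w ^+ (j + k).
Proof.
move=> hc hv v0; have w0 : 0 <= w by exact: le_trans hc.
elim: j k => [|j IH] k kK.
  rewrite /= expr0 mul1r add0n horner_exp horner_exp lin2E normrX.
  by rewrite lerXn2r.
rewrite /= hornerD hornerD !hornerM !hornerC !lin2E (le_trans (ler_normD _ _))//.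
have e1 : `|(al * p + be * q) * (lin2_prod n al be j k).[p, q]| <=
    w * (2 ^+ j * w ^+ (j + k)) by rewrite normrM ler_pM// IH.
have e2 : `|k%:R / n%:R * ((al ^+ 2 * p + be ^+ 2 * q) * (lin2_prod n al be j k.-1).[p, q])| <=
    w * (2 ^+ j * w ^+ (j + k)).
  case: k kK {e1} => [|k] kK; first by rewrite !mul0r normr0 !mulr_ge0 ?exprn_ge0.
  rewrite [X in `|X|]mulrA normrM /= addnS (exprS w (j + k)).
    have -> : w * (2 ^+ j * (w * w ^+ (j + k))) = w ^+ 2 * (2 ^+ j * w ^+ (j + k)) by ring.
  rewrite ler_pM//; last by rewrite IH// ltnW.
  rewrite ger0_norm ?mulr_ge0 ?divr_ge0//; apply: le_trans hv.
  by rewrite -mulrA [_^-1 * _]mulrC ler_wpM2r ?divr_ge0// ler_nat.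
apply: (le_trans (lerD e1 e2)).
by rewrite le_eqVlt; apply/orP; left; apply/eqP; rewrite addSn !exprS; ring.
Qed.

Lemma pois_sum2_lin2X_sqr_le (R : realType) n (al be p q w : R) (K j B : nat) :
  (0 < n)%N -> 0 <= p -> 0 <= q -> `|al * p + be * q| <= w ->
  K%:R * ((al ^+ 2 * p + be ^+ 2 * q) / n%:R) <= w ^+ 2 -> (j <= K)%N ->
  pois_sum2 (n%:R * p) (n%:R * q) B
    (fun a b => unbiased n (lin2 al be ^+ j) (a%:R / n%:R) (b%:R / n%:R) ^+ 2) <=
  (2 * w ^+ 2) ^+ j.
Proof.
move=> n0 p0 q0 hc hv jK.
have w0 : 0 <= w by exact: le_trans hc.
apply: (@le_trans _ _ (lin2_prod n al be j j).[p, q]).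
  apply: pois_sum2_le_moment; rewrite ?mulr_ge0//; first by move=> a b; exact: sqr_ge0.
  rewrite [X in pois_moment _ _ X](_ : _ = fun a b =>
    unbiased n (lin2_prod n al be j j) (a%:R / n%:R) (b%:R / n%:R)).
    exact: pois_moment_unbiased.
  by apply/funext => a; apply/funext => b; rewrite expr2 unbiased_lin2_prod.
apply: (le_trans (ler_norm _)).
have -> : (2 * w ^+ 2) ^+ j = 2 ^+ j * w ^+ (j + j) by rewrite exprMn -exprM mul2n addnn.
by apply: (@lin2_prod_le _ n al be p q w K j j hc hv) => //; rewrite addr_ge0// mulr_ge0// sqr_ge0.
Qed.

(** * Concentration of the first batch *)

(** The Chernoff bound for the level s^2, tilted by z = s / r instead of the optimal s^2 / r^2. With
    1 - 1/z <= ln z this makes the exponent an exact square of the difference of the roots. *)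
Lemma pois_chernoff (R : realType) (r s : R) B : 0 < r -> 0 < s ->
  \sum_(a < B) pois (r ^+ 2) a * expR ((a%:R - s ^+ 2) * ln (s / r)) <=
  expR (- (s - r) ^+ 2).
Proof.
move=> r0 s0; set z := s / r; have z0 : 0 < z by rewrite divr_gt0.
have -> : \sum_(a < B) pois (r ^+ 2) a * expR ((a%:R - s ^+ 2) * ln z) =
    (\sum_(a < B) (r * s) ^+ a / a`!%:R) * expR (- r ^+ 2 - s ^+ 2 * ln z).
  rewrite mulr_suml; apply: eq_bigr => a _.
  rewrite mulrBl expRD [in RHS]expRD expRM_natl lnK ?posrE// /pois.
  have -> : (r * s) ^+ a = (r ^+ 2) ^+ a * z ^+ a.
    by rewrite -exprMn; congr (_ ^+ _); rewrite /z; field; rewrite gt_eqF.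
  by ring.
have rs0 : 0 <= r * s by rewrite mulr_ge0 ?ltW.
apply: (le_trans (ler_wpM2r (expR_ge0 _) (series_exp_coeff_le B rs0))).
rewrite -expRD ler_expR.
have h : 1 - r / s <= ln z.
  rewrite -[z]invrK lnV ?posrE ?invr_gt0// lerNr.
  have -> : z^-1 = 1 + (r / s - 1) by rewrite /z invf_div; ring.
  rewrite (le_trans (le_ln1Dx _))//; last by lra.
  by rewrite ltrBDl addrN divr_gt0.
have : s ^+ 2 * (1 - r / s) <= s ^+ 2 * ln z by rewrite ler_wpM2l ?sqr_ge0.
have -> : s ^+ 2 * (1 - r / s) = s ^+ 2 - r * s by field; rewrite gt_eqF.
by rewrite !expr2; lra.
Qed.

Lemma pois_sqrt_tail (R : realType) (l t : R) B : 0 <= l -> 0 <= t ->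
  \sum_(a < B | t < (Num.sqrt a%:R - Num.sqrt l) ^+ 2) pois l a <= 2 * expR (- t).
Proof.
move=> l0 t0; have [l00|lp] := eqVneq l 0.
  rewrite big1 ?mulr_ge0 ?expR_ge0// => a; rewrite l00 sqrtr0 subr0 sqr_sqrtr//.
  case: (nat_of_ord a) => [|k _]; first by rewrite ltNge t0.
  by rewrite /pois expr0n/= !mul0r.
set r := Num.sqrt l; have r0 : 0 < r by rewrite sqrtr_gt0 lt0r lp l0.
have u0 := sqrtr_ge0 t; have ut := sqr_sqrtr t0; set u := Num.sqrt t in u0 ut.
have rl : r ^+ 2 = l by rewrite sqr_sqrtr.
(* The two tails are s = r + u and s = r - u. When r - u <= 0 the lower tail is empty, whence the
   value 0. *)
pose F s (a : nat) := if 0 < s then pois l a * expR ((a%:R - s ^+ 2) * ln (s / r)) else 0.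
have F0 s a : 0 <= F s a.
  by rewrite /F; case: ifP => // _; rewrite mulr_ge0 ?expR_ge0 ?pois_ge0.
have hF s : (s - r) ^+ 2 = t -> \sum_(a < B) F s a <= expR (- t).
  rewrite /F; case: (ltP 0 s) => [s0 <-|_ _]; last by rewrite big1// expR_ge0.
  by rewrite -rl; exact: pois_chernoff.
apply: (@le_trans _ _ (\sum_(a < B) (F (r + u) a + F (r - u) a))); last first.
  rewrite big_split/= mulr_natl mulr2n lerD// hF//; first by rewrite addrC addKr.
  by rewrite addrAC subrr add0r sqrrN.
rewrite big_mkcond; apply: ler_sum => a _; case: ifP => [|_]; last exact: addr_ge0.
have eqa : Num.sqrt a%:R ^+ 2 = a%:R :> R by rewrite sqr_sqrtr.
set x := Num.sqrt a%:R; have x0 : 0 <= x by exact: sqrtr_ge0.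
rewrite -ut -[_ ^+ 2 in X in _ < X]real_normK ?num_real// ltr_pXn2r ?nnegrE//.
have p0 := pois_ge0 a l0.
have [xr|xr] := lerP 0 (x - r); [rewrite ger0_norm//|rewrite ltr0_norm//] => hx.
  rewrite -[leLHS]addr0 lerD// /F ifT ?ltr_wpDr// ler_peMr// -[leLHS]expR0 ler_expR.
  rewrite mulr_ge0//.
    rewrite subr_ge0 -eqa lerXn2r ?nnegrE ?addr_ge0// ?(ltW r0)//.
    by rewrite -/x; lra.
  by rewrite ln_ge0// ler_pdivlMr// mul1r lerDl.
have su : 0 < r - u by lra.
rewrite -[leLHS]add0r lerD// /F ifT// ler_peMr// -[leLHS]expR0 ler_expR.
rewrite mulr_le0//.
  by rewrite subr_le0 -eqa lerXn2r ?nnegrE ?(ltW su)// -/x; lra.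
rewrite -ln1 ler_ln ?posrE ?divr_gt0// ler_pdivrMr// mul1r; lra.
Qed.

Lemma freq_sqrt_tail (R : realType) (n : nat) (p : R) B : (0 < n)%N -> 0 <= p ->
  \sum_(a < B | 2 * ln n%:R / n%:R < (Num.sqrt (a%:R / n%:R) - Num.sqrt p) ^+ 2)
    pois (n%:R * p) a <= 2 / n%:R ^+ 2.
Proof.
move=> n0 p0; have n1 : 1 <= n%:R :> R by rewrite ler1n.
have N0 : 0 < n%:R :> R by rewrite ltr0n.
have t0 : 0 <= 2 * ln n%:R :> R by rewrite mulr_ge0// ln_ge0.
have := @pois_sqrt_tail R (n%:R * p) (2 * ln n%:R) B (mulr_ge0 (ltW N0) p0) t0.
rewrite expRN expRM_natl lnK ?posrE//.
apply: le_trans; rewrite le_eqVlt; apply/orP; left; apply/eqP; apply: eq_bigl => a.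
rewrite ltr_pdivrMr// sqrtrM ?ler0n// [Num.sqrt (n%:R * p)]sqrtrM ?ler0n//.
congr (_ < _); rewrite -{2}(sqr_sqrtr (ltW N0)) -exprMn; congr (_ ^+ 2).
rewrite mulrBl sqrtrV ?ler0n// mulfVK; first by rewrite [_ * Num.sqrt n%:R]mulrC.
by rewrite gt_eqF// sqrtr_gt0.
Qed.

(** * Law of the symbol counts *)

Definition joint_fiber (I : finType) (T : Type) (Z : I -> T -> nat) (m : {ffun I -> nat}) :
  set T := [set w | [ffun i => Z i w] = m].

Lemma measurable_fun_joint (d : measure_display) (T : measurableType d) (R : realType)
    (I : finType) (Z : I -> T -> nat) (G : {ffun I -> nat} -> R) :
  (forall m, measurable (joint_fiber Z m)) ->
  measurable_fun setT (fun w => G [ffun i => Z i w]).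
Proof.
move=> mZ _ Y mY; rewrite setTI.
have -> : (fun w => G [ffun i => Z i w]) @^-1` Y =
    \bigcup_(m : {ffun I -> nat}) (if `[< Y (G m) >] then joint_fiber Z m else set0).
  apply/seteqP; split => w /=.
    move=> h; exists [ffun i => Z i w] => //=.
    by rewrite (_ : `[< _ >] = true)//; exact/asboolP.
  by move=> [m _]; case: asboolP => // h; rewrite /joint_fiber/= => ->.
apply: countable_bigcupT_measurable => // m; case: ifP => _; [exact: mZ|exact: measurable0].
Qed.

(** As G <= 1, the counts outside the image of e cost at most their mass. This is the only place
    where the expectation is unfolded into an integral. *)
Lemma expectation_le_box (d : measure_display) (T : measurableType d) (R : realType)
    (Pr : probability T R) (I F : finType) (Z : I -> T -> nat)
    (e : F -> {ffun I -> nat}) (pmf G : {ffun I -> nat} -> R) :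
  injective e -> (forall m, measurable (joint_fiber Z m)) ->
  (forall m, Pr (joint_fiber Z m) = (pmf m)%:E) ->
  (forall m, 0 <= G m <= 1) ->
  ('E_Pr[fun w => G [ffun i => Z i w]] <=
   (\sum_f pmf (e f) * G (e f) + (1 - \sum_f pmf (e f)))%:E)%E.
Proof.
move=> einj mZ PZ G01; rewrite unlock.
pose A f := joint_fiber Z (e f).
pose h f (w : T) : \bar R := ((1 - G (e f))%:E * (\1_(A f) w)%:E)%E.
have h0 f w : (0 <= h f w)%E.
  rewrite mule_ge0 ?lee_fin ?indicE//.
  by have /andP[_] := G01 (e f); rewrite subr_ge0.
have mh f : measurable_fun [set: T] (h f : T -> \bar R).
  apply: measurable_funeM; apply/measurable_EFinP; apply: measurable_indic; exact: mZ.
have mG : measurable_fun setT (fun w => (G [ffun i => Z i w])%:E).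
  by apply/measurable_EFinP; exact: measurable_fun_joint.
have Eh : (\int[Pr]_w (\sum_f h f w) = (\sum_f (1 - G (e f)) * pmf (e f))%R%:E)%E.
  rewrite ge0_integral_sum//; rewrite -sumEFin; apply: eq_bigr => f _.
  rewrite ge0_integralZl_EFin//.
  - rewrite integral_indic; [|by []|exact: mZ]. by rewrite setIT EFinM; congr (_ * _)%E; exact: PZ.
  - by apply/measurable_EFinP; apply: measurable_indic; exact: mZ.
  - by have /andP[_] := G01 (e f); rewrite subr_ge0.
(* By injectivity of e, at most one fibre contains w. If one does, its term completes G to exactly
   1; otherwise the sum is 0 and G <= 1. *)
have : (\int[Pr]_w ((G [ffun i => Z i w])%:E + \sum_f h f w) <= 1)%E.
  have <- : (\int[Pr]_(w in setT) (cst 1 w) = 1)%E.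
    by rewrite integral_cst// mul1e; exact: probability_setT.
  apply: ge0_le_integral => //.
  - by move=> w _; rewrite adde_ge0 ?sume_ge0// lee_fin; have /andP[] := G01 [ffun i => Z i w].
  - by apply: emeasurable_funD => //; exact: emeasurable_sum.
  move=> w _; rewrite /h sumEFin -EFinD lee_fin.
  have hf f : (1 - G (e f)) * \1_(A f) w = if e f == [ffun i => Z i w] then
      1 - G [ffun i => Z i w] else 0.
    rewrite indicE; case: eqP => [E|E].
      by rewrite mem_set ?mulr1 ?E// /A /joint_fiber/= E.
    by rewrite memNset ?mulr0// /A /joint_fiber/= => E'; apply: E.
  under eq_bigr do rewrite hf.
  have /andP[g0 g1] := G01 [ffun i => Z i w].
  have [[f /eqP ef]|nf] := pselect (exists f, e f == [ffun i => Z i w]).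
    rewrite (bigD1 f)//= ef eqxx big1 ?addr0 ?subrKC// => f' ff'.
    rewrite ifF//; apply/negbTE; apply: contra_neq ff' => E.
    by apply: einj; rewrite E ef.
  rewrite big1 ?addr0// => f _; case: ifPn => // E.
  by exfalso; apply: nf; exists f.
rewrite ge0_integralD//.
- rewrite Eh -leeBrDr// => /le_trans; apply.
  rewrite -EFinB lee_fin.
  under eq_bigr do rewrite mulrBl mul1r [G _ * _]mulrC.
  rewrite big_split/= sumrN; lra.
- by move=> w _; rewrite lee_fin; have /andP[] := G01 [ffun i => Z i w].
- by move=> w _; rewrite sume_ge0.
- exact: emeasurable_sum.
Qed.

(** Induction on the length, by the first letter a: removing it lowers m a by one, which leaves the
    share m a of the whole, and these shares add up to k. *)
Lemma multinomial_sum (R : realType) (S k : nat) (p : 'I_S -> R) (m : 'I_S -> nat) :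
  (\sum_i m i)%N = k ->
  \sum_(x : k.-tuple 'I_S | [forall i, count_mem i x == m i]) \prod_(a <- x) p a =
  k`!%:R * \prod_i (p i ^+ m i / (m i)`!%:R).
Proof.
elim: k m => [|k IH] m mk.
  have m0 i : m i = 0%N by apply/eqP; rewrite -leqn0 -mk (bigD1 i)//= leq_addr.
  rewrite (big_pred1 [tuple]); last first.
    move=> x; rewrite (tuple0 x); transitivity true; last exact/esym/eqP.
    by apply/forallP => i; rewrite m0.
  rewrite big_nil big1 ?mulr1// => i _; by rewrite m0 divr1.
pose e (a i : 'I_S) : nat := (m i - (i == a))%N.
rewrite (reindex (fun y : 'I_S * k.-tuple 'I_S => [tuple of y.1 :: y.2])); last first.
  exists (fun x : k.+1.-tuple 'I_S => (thead x, [tuple of behead x])).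
    by move=> [a y] _ /=; congr (_, _); exact: val_inj.
  by move=> x _; rewrite [RHS]tuple_eta.
rewrite -(pair_big_dep xpredT
  (fun a (y : k.-tuple 'I_S) => [forall i, count_mem i (a :: y) == m i])
  (fun a (y : k.-tuple 'I_S) => \prod_(b <- a :: y) p b))/=.
pose W := \prod_i (p i ^+ m i / (m i)`!%:R).
transitivity (\sum_(a : 'I_S) (m a)%:R * (k`!%:R * W)); last first.
  by rewrite -mulr_suml -natr_sum mk mulrA -natrM -factS.
apply: eq_bigr => a _.
have [ma0|ma0] := posnP (m a).
  rewrite ma0 mul0r big_pred0// => y; apply/negbTE; rewrite negb_forall.
  by apply/existsP; exists a; rewrite /= eqxx ma0.
under eq_bigr do rewrite big_cons.
rewrite -mulr_sumr.
transitivity (p a * \sum_(y : k.-tuple 'I_S | [forall i, count_mem i y == e a i])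
    \prod_(b <- y) p b).
  congr (_ * _); apply: eq_bigl => y; apply: eq_forallb => i /=.
  rewrite /e [i == a]eq_sym; case: (eqVneq a i) => [<-|_]; last by rewrite add0n subn0.
  by rewrite /= add1n subn1; case: (m a) ma0.
rewrite IH; last first.
  have he : (\sum_(i | i != a) e a i = \sum_(i | i != a) m i)%N.
    by apply: eq_bigr => i /negbTE h; rewrite /e h subn0.
  move: mk; rewrite (bigD1 a)//= [in X in _ -> X](bigD1 a)//= he /e eqxx subn1.
  by case: (m a) ma0 => // j _; rewrite addSn => -[].
rewrite mulrCA [RHS]mulrCA; congr (_ * _).
rewrite /W (bigD1 a)//= [in RHS](bigD1 a)//= /e eqxx subn1 !mulrA.
congr (_ * _); last by apply: eq_bigr => i /negbTE ->; rewrite subn0.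
case: (m a) ma0 => // j _ /=; rewrite factS natrM exprS.
have f0 : j`!%:R != 0 :> R by rewrite pnatr_eq0 -lt0n fact_gt0.
have j0 : j.+1%:R != 0 :> R by rewrite pnatr_eq0.
by move: (j`!%:R) (j.+1%:R) f0 j0 => u v u0 v0; field; rewrite u0 v0.
Qed.

Lemma poisson_splitting (R : realType) (S n k : nat) (p : 'I_S -> R) (m : 'I_S -> nat) :
  (0 < n)%N -> \sum_i p i = 1 -> (\sum_i m i)%N = k ->
  \sum_(x : k.-tuple 'I_S | [forall i, count_mem i x == m i])
    poisson_pmf n%:R k * \prod_(a <- x) p a = \prod_i pois (n%:R * p i) (m i).
Proof.
move=> n0 p1 mk; rewrite -mulr_sumr (multinomial_sum p mk) /poisson_pmf ltr0n n0.
have f0 : k`!%:R != 0 :> R by rewrite pnatr_eq0 -lt0n fact_gt0.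
transitivity (n%:R ^+ k * expR (- n%:R) * \prod_i (p i ^+ m i / (m i)`!%:R)).
  by move: (k`!%:R) f0 => u u0; field.
have -> : expR (- n%:R) = \prod_i expR (- (n%:R * p i)).
  by rewrite -expR_sum sumrN -mulr_sumr p1 mulr1.
rewrite -mk -prodrXr -!big_split/=; apply: eq_bigr => i _.
by rewrite /pois exprMn; ring.
Qed.

Definition batch_seq (R : realType) (d : measure_display) (T : measurableType d)
    (Pr : probability T R) (S : nat) (N : bool -> 'I_2 -> {RV Pr >-> nat})
    (X : bool -> 'I_2 -> nat -> T -> 'I_S) (t : bool * 'I_2) (w : T) : seq 'I_S :=
  mkseq (fun k => X t.1 t.2 k w) (N t.1 t.2 w).

(** Fixing the contents of the four batches fixes their sizes and only finitely many samples, so the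
    event is a finite intersection of generating events, to which independence applies directly. *)
Lemma batch_seq_law (R : realType) (d : measure_display) (T : measurableType d)
    (Pr : probability T R) (S n : nat) (p q : 'I_S -> R)
    (N : bool -> 'I_2 -> {RV Pr >-> nat}) (X : bool -> 'I_2 -> nat -> T -> 'I_S)
    (x : bool * 'I_2 -> seq 'I_S) :
  poissonized_sampling n p q N X ->
  measurable [set w | forall t, batch_seq N X t w = x t] /\
  Pr [set w | forall t, batch_seq N X t w = x t] =
    (\prod_t (poisson_pmf n%:R (size (x t)) *
              \prod_(a <- x t) (if t.1 then p else q) a))%:E.
Proof.
move=> [PN mX PX indep].
(* The default of [nth] is the sample itself: no element of 'I_S has to be exhibited, and positions
   past the end impose no condition. *)
pose A (j : bool * 'I_2 * option nat) : set T := let: (b, i, o) := j in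
  if o is Some k then [set w | X b i k w = nth (X b i k w) (x (b, i)) k]
  else N b i @^-1` [set size (x (b, i))].
pose os t := None :: map Some (iota 0 (size (x t))).
pose s := [seq (t, o) | t <- index_enum (bool * 'I_2)%type, o <- os t].
have us : uniq s.
  apply: allpairs_uniq_dep; first exact: index_enum_uniq.
    move=> t _; rewrite /os /= map_inj_uniq ?iota_uniq ?andbT; last by move=> ? ? [].
    by apply/mapP => -[].
  by move=> [t1 o1] [t2 o2] _ _ /= [-> ->].
have A_Some b i k : (k < size (x (b, i)))%N ->
    exists2 a, A (b, i, Some k) = X b i k @^-1` [set a] &
      forall d0, nth d0 (x (b, i)) k = a.
  move=> kx; have [a0 [l E _]] : exists a0, exists2 l, x (b, i) = a0 :: l & True.
    by case: (x (b, i)) kx => // a0 l _; exists a0; exists l.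
  exists (nth a0 (x (b, i)) k); last by move=> d0; exact: set_nth_default.
  by apply/seteqP; split => w /=; rewrite (set_nth_default a0).
have mem_None b i : (b, i, None) \in s.
  by apply/allpairsPdep; exists (b, i), None; rewrite mem_index_enum in_cons eqxx.
have mem_Some b i k : ((b, i, Some k) \in s) = (k < size (x (b, i)))%N.
  apply/idP/idP => [/allpairsPdep[[b1 i1] [z [_]]]|kx].
    rewrite in_cons => /orP[/eqP -> //|].
    by move=> /mapP[k1 + ->]; rewrite mem_iota => /andP[_ h] [-> -> ->].
  apply/allpairsPdep; exists (b, i), (Some k); rewrite mem_index_enum; split=> //.
  by rewrite in_cons mem_map ?mem_iota//= => ? ? [].
have memA j : j \in s -> batch_sigma N X j (A j).
  case: j => -[b i] [k|].
    rewrite mem_Some => /A_Some[a -> _].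
    by exists [set a] => //; rewrite setTI.
  by move=> _; exists [set size (x (b, i))] => //; rewrite setTI.
have Es : [set w | forall t, batch_seq N X t w = x t] = \bigcap_(j in [set` s]) A j.
  apply/seteqP; split => w /=.
    move=> h [[b i] [k|]] /=; last by rewrite -(h (b, i)) /batch_seq size_mkseq.
    rewrite mem_Some => kx; rewrite -{1}(h (b, i)) /batch_seq nth_mkseq//.
    by move: kx; rewrite -(h (b, i)) size_mkseq.
  move=> h [b i].
  have hN : N b i w = size (x (b, i)) by have := h (b, i, None); apply; exact: mem_None.
  rewrite /batch_seq /= hN; case E : (x (b, i)) => [//|a0 l]; rewrite -E.
  apply: (@eq_from_nth _ a0); first by rewrite size_mkseq.
  move=> k; rewrite size_mkseq => kx; rewrite nth_mkseq//.
  have := h (b, i, Some k); rewrite /= mem_Some => /(_ kx) ->.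
  exact: set_nth_default.
have mA j : j \in s -> measurable (A j).
  case: j => -[b i] [k|]; last first.
    by move=> _; exact: (measurable_funPTI (N b i)).
  by rewrite mem_Some => /A_Some[a -> _]; exact: mX.
split.
  rewrite Es; apply: fin_bigcap_measurable; first exact: finite_seq.
  by move=> j /= js; exact: mA.
rewrite Es (indep s A us memA) big_allpairs_dep -prodEFin; apply: eq_bigr => -[b i] _.
rewrite EFinM /os big_cons PN; congr (_ * _)%E.
rewrite big_map; case E : (x (b, i)) => [|a0 l]; rewrite -E.
  by rewrite E !big_nil.
rewrite (big_nth a0) -prodEFin /index_iota subn0.
rewrite !big_seq; apply: eq_bigr => k; rewrite mem_iota => /andP[_ kx].
by have [a -> h] := A_Some b i k kx; rewrite h PX.
Qed.

Lemma sum_count_mem_size (S : nat) (s : seq 'I_S) :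
  (\sum_(i < S) count_mem i s)%N = size s.
Proof.
elim: s => [|a s IH] /=; first by rewrite big1.
rewrite big_split/= IH (bigD1 a)//= eqxx big1 ?addn0// => i ia.
by rewrite eq_sym (negbTE ia).
Qed.

Definition symbol_count (R : realType) (d : measure_display) (T : measurableType d)
    (Pr : probability T R) (S : nat) (N : bool -> 'I_2 -> {RV Pr >-> nat})
    (X : bool -> 'I_2 -> nat -> T -> 'I_S) (t : bool * 'I_2 * 'I_S) (w : T) : nat :=
  count_mem t.2 (batch_seq N X t.1 w).

Lemma frequencyE (R : realType) (d : measure_display) (T : measurableType d)
    (Pr : probability T R) (S n : nat) (N : bool -> 'I_2 -> {RV Pr >-> nat})
    (X : bool -> 'I_2 -> nat -> T -> 'I_S) b j i (w : T) :
  frequency R n (N b j) (X b j) i w = (symbol_count N X (b, j, i) w)%:R / n%:R.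
Proof.
rewrite /frequency; congr (_%:R / _).
rewrite -(big_mkord xpredT (fun k => nat_of_bool (X b j k w == i))).
rewrite /symbol_count /batch_seq /= count_map -sum1_count [RHS]big_mkcond/= /index_iota.
by rewrite subn0; apply: eq_bigr => k _; case: eqP.
Qed.

(** The fibre is the disjoint union of the events that fix the contents of all batches, over the
    contents with these counts. The sum of their probabilities factors over batches by
    distributivity, then over symbols by Poisson splitting. *)
Lemma symbol_count_law (R : realType) (d : measure_display) (T : measurableType d)
    (Pr : probability T R) (S n : nat) (p q : 'I_S -> R)
    (N : bool -> 'I_2 -> {RV Pr >-> nat}) (X : bool -> 'I_2 -> nat -> T -> 'I_S)
    (m : {ffun bool * 'I_2 * 'I_S -> nat}) :
  (0 < n)%N -> is_pmf p -> is_pmf q -> poissonized_sampling n p q N X ->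
  measurable (joint_fiber (symbol_count N X) m) /\
  Pr (joint_fiber (symbol_count N X) m) =
    (\prod_t pois (n%:R * (if t.1.1 then p else q) t.2) (m t))%:E.
Proof.
move=> n0 [_ p1] [_ q1] sampling.
(* No batch with these counts is longer than the total of m, so the possible contents form a finite
   type. *)
pose B := (\sum_t m t).+1.
pose J := {k : 'I_B & k.-tuple 'I_S}.
pose sq (y : J) : seq 'I_S := tagged y.
have sq_size (y : J) : size (sq y) = tag y by rewrite size_tuple.
have sq_inj : injective sq.
  move=> [k y] [l z] E.
  have kl : k = l by apply: val_inj; have := congr1 size E; rewrite !sq_size.
  by case: l / kl z E => z E; congr existT; exact: val_inj.
pose cond t (y : J) := [forall i, count_mem i (sq y) == m (t, i)].
pose E (f : {ffun bool * 'I_2 -> J}) : set T :=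
  [set w | forall t, batch_seq N X t w = sq (f t)].
have hE f := @batch_seq_law _ _ _ Pr S n p q N X (fun t => sq (f t)) sampling.
have mM t : (\sum_i m (t, i) < B)%N.
  rewrite ltnS; have -> : (\sum_t m t = \sum_t \sum_i m (t, i))%N.
    by rewrite pair_bigA; apply: eq_bigr => -[].
  by rewrite [leqRHS](bigD1 t)//= leq_addr.
have fiberE : joint_fiber (symbol_count N X) m =
    \bigcup_(f in [set f | f \in family cond]) E f.
  apply/seteqP; split => w.
    rewrite /joint_fiber /= => hm.
    have cm t i : count_mem i (batch_seq N X t w) = m (t, i) by rewrite -hm ffunE.
    have sM t : (size (batch_seq N X t w) < B)%N.
      rewrite -sum_count_mem_size (eq_bigr (fun i => m (t, i)))//.
    exists [ffun t => existT (fun k : 'I_B => k.-tuple 'I_S)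
      (Ordinal (sM t)) (in_tuple (batch_seq N X t w))].
      apply/familyP => t; rewrite ffunE; apply/forallP => i.
      by rewrite /sq/= cm.
    by move=> t; rewrite ffunE.
  move=> [f /= /familyP hf Ef]; apply/ffunP => -[t i]; rewrite ffunE /symbol_count /= Ef.
  exact/eqP/(forallP (hf t)).
have tE : trivIset [set f | f \in family cond] E.
  move=> f g _ _ [w [hf hg]]; apply/ffunP => t; apply: sq_inj.
  by rewrite -(hf t) -(hg t).
split.
  by rewrite fiberE; apply: fin_bigcup_measurable => // f _; exact: (hE f).1.
rewrite fiberE measure_fin_bigcup//; last by move=> f _; exact: (hE f).1.
rewrite -(bigfs _ (index_enum_uniq _)); last first.
  by move=> f _; rewrite mem_index_enum.
rewrite (eq_bigr (fun f : {ffun bool * 'I_2 -> J} => (\prod_t (poisson_pmf n%:R (size (sq (f t))) *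
              \prod_(a <- sq (f t)) (if t.1 then p else q) a))%:E)); last first.
  by move=> f _; rewrite -(hE f).2.
rewrite sumEFin; congr EFin.
rewrite -(bigA_distr_big_dep _ (fun t y => poisson_pmf n%:R (size (sq y)) *
              \prod_(a <- sq y) (if t.1 then p else q) a)).
transitivity (\prod_t \prod_i pois (n%:R * (if t.1 then p else q) i) (m (t, i))); last first.
  by rewrite pair_bigA/=; apply: eq_bigr => -[].
apply: eq_bigr => t _.
rewrite -(@poisson_splitting _ _ _ (\sum_i m (t, i))%N)//; last by case: t.1.
rewrite -(sig_big_dep xpredT
  (fun (k : 'I_B) (x : k.-tuple 'I_S) => [forall i, count_mem i x == m (t, i)])
  (fun (k : 'I_B) (x : k.-tuple 'I_S) => poisson_pmf n%:R (size x) *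
     \prod_(a <- x) (if t.1 then p else q) a)).
rewrite (bigD1 (Ordinal (mM t)))//= [X in _ + X]big1 ?addr0.
  by apply: eq_bigr => x _; rewrite size_tuple.
move=> k kM; rewrite big_pred0// => x; apply/negbTE; apply: contra kM => /forallP h.
rewrite -val_eqE/= -(size_tuple x) -sum_count_mem_size; apply/eqP.
by apply: eq_bigr => i _; apply/eqP.
Qed.

(** * Bias and variance of a single symbol *)

Lemma sup_dist_le (R : realType) (T : Type) (D : set T) (f g : T -> R) (c : R) :
  (forall z, D z -> `|f z - g z| <= c) -> (sup_dist D f g <= c%:E)%E.
Proof.
by move=> h; apply: ge_ereal_sup => _ [z Dz <-]; rewrite lee_fin h.
Qed.

Lemma le_sup_dist (R : realType) (T : Type) (D : set T) (f g : T -> R) (c : R) (z : T) :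
  (sup_dist D f g <= c%:E)%E -> D z -> `|f z - g z| <= c.
Proof.
move=> h Dz; rewrite -lee_fin; apply: le_trans h.
by apply: ereal_sup_ubound; exists z.
Qed.

(** Optimality is used in this form only: any explicit competitor bounds the error of the best
    approximant. *)
Lemma best_approx1_le (R : realType) K (a b : R) f (r s : {poly R}) (c : R) :
  best_approx1 K a b f r -> (size s <= K.+1)%N ->
  (forall t, a <= t <= b -> `|f t - s.[t]| <= c) ->
  forall t, a <= t <= b -> `|f t - r.[t]| <= c.
Proof.
move=> [_ hr] ss hs t ht.
apply: (@le_sup_dist _ _ `[a, b] f (horner r) c); last by rewrite /= in_itv.
apply: le_trans (hr s ss) _; apply: sup_dist_le => z.
by rewrite /= in_itv; exact: hs.
Qed.

Lemma best_approx2_le (R : realType) K (f : R -> R -> R) (u s : {poly {poly R}}) (c : R) :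
  best_approx2 K f u -> degree_le2 K s ->
  (forall x y, 0 <= x <= 1 -> 0 <= y <= 1 -> `|f x y - s.[x, y]| <= c) ->
  forall x y, 0 <= x <= 1 -> 0 <= y <= 1 -> `|f x y - u.[x, y]| <= c.
Proof.
move=> [_ hu] ss hs x y hx hy.
apply: (@le_sup_dist _ _ (`[0, 1]%classic `*` `[0, 1]%classic)
  (fun z => f z.1 z.2) (fun z => u.[z.1, z.2]) c (x, y)); last first.
  by split; rewrite /= in_itv.
apply: le_trans (hu s ss) _; apply: sup_dist_le => -[x' y'] [/= h1 h2].
by move: h1 h2; rewrite !in_itv/=; exact: hs.
Qed.

Lemma sqr_wsum_le (R : realType) (I : Type) (r : seq I) (P : pred I) (w g : I -> R) :
  (\sum_(i <- r | P i) w i * g i) ^+ 2 <=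
  (\sum_(i <- r | P i) `|w i|) * \sum_(i <- r | P i) `|w i| * g i ^+ 2.
Proof.
elim: r => [|a r IH]; first by rewrite !big_nil expr2 mul0r.
rewrite !big_cons; case: (P a) => //.
have := IH; set s := \sum_(i <- r | P i) w i * g i.
set t := \sum_(i <- r | P i) `|w i|; set u := \sum_(i <- r | P i) `|w i| * g i ^+ 2.
move=> h.
have t0 : 0 <= t by apply: sumr_ge0.
have u0 : 0 <= u by apply: sumr_ge0 => i _; rewrite mulr_ge0 ?sqr_ge0.
set x := w a; set z := g a.
have cross : 2 * (x * z) * s <= `|x| * (u + t * z ^+ 2).
  rewrite (le_trans (ler_norm _))// !normrM [`|2|]ger0_norm//.
  have -> : 2 * (`|x| * `|z|) * `|s| = `|x| * (2 * (`|z| * `|s|)) by ring.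
  rewrite ler_wpM2l//.
  rewrite -(@ler_pXn2r _ 2) ?nnegrE ?addr_ge0 ?(mulr_ge0 t0 (sqr_ge0 z)) ?mulr_ge0//.
  have -> : (2 * (`|z| * `|s|)) ^+ 2 = 4 * z ^+ 2 * s ^+ 2.
    by rewrite !exprMn !real_normK ?num_real//; ring.
  have : 4 * z ^+ 2 * s ^+ 2 <= 4 * z ^+ 2 * (t * u).
    by apply: ler_wpM2l h; rewrite mulr_ge0 ?sqr_ge0.
  have := sqr_ge0 (u - t * z ^+ 2); rewrite !expr2; lra.
have xx : `|x| ^+ 2 = x ^+ 2 by rewrite real_normK ?num_real.
have -> : (`|x| + t) * (`|x| * z ^+ 2 + u) =
  `|x| ^+ 2 * z ^+ 2 + `|x| * (u + t * z ^+ 2) + t * u by ring.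
rewrite xx; have -> : (x * z + s) ^+ 2 = x ^+ 2 * z ^+ 2 + 2 * (x * z) * s + s ^+ 2 by ring.
by rewrite lerD// lerD.
Qed.

(** Cauchy-Schwarz instead of covariances: the terms of one symbol's estimator are dependent, and
    the l^1 norm of the coefficients is all that is charged for it. *)
Lemma pois_sum2_wsum_le (R : realType) (l m : R) B (I : Type) (r : seq I) (P : pred I)
    (w : I -> R) (g : I -> nat -> nat -> R) (M : R) :
  0 <= l -> 0 <= m ->
  (forall i, P i -> pois_sum2 l m B (fun a b => g i a b ^+ 2) <= M) ->
  pois_sum2 l m B (fun a b => (\sum_(i <- r | P i) w i * g i a b) ^+ 2) <=
  (\sum_(i <- r | P i) `|w i|) ^+ 2 * M.
Proof.
move=> l0 m0 h.
apply: le_trans (pois_sum2_le _ l0 m0 (fun a b => sqr_wsum_le r P w (fun i => g i a b))) _.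
rewrite pois_sum2Z pois_sum2_sum expr2 -mulrA ler_wpM2l ?sumr_ge0//.
rewrite mulr_suml; apply: ler_sum => i Pi.
by rewrite pois_sum2Z ler_wpM2l// h.
Qed.

Lemma g0_lin2X (R : realType) n i (a b : nat) (be : R) : (0 < n)%N ->
  unbiased n (lin2 1 0 ^+ i) (a%:R / n%:R : R) (b%:R / n%:R) = g0 n i (a%:R / n%:R) /\
  unbiased n (lin2 0 be ^+ i) (a%:R / n%:R) (b%:R / n%:R) = be ^+ i * g0 n i (b%:R / n%:R).
Proof.
move=> n0; elim: i a b => [|i IH] a b.
  by rewrite !expr0 !unbiased1 /g0 !big_ord0 mul1r.
rewrite !exprS !unbiased_lin2M// !g0S// !(IH _ _).1 !(IH _ _).2.
by split; ring.
Qed.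

(** The one-variable case of the bound for linear forms: the first count is given rate 0 and
    coefficient 0. *)
Lemma pois_sum_g0_sqr_le (R : realType) (n K i B : nat) (be p w : R) :
  (0 < n)%N -> 0 <= p -> 0 <= be -> be * p <= w -> be * (K%:R / n%:R) <= w -> (i <= K)%N ->
  \sum_(a < B) pois (n%:R * p) a * (be ^+ i * g0 n i (a%:R / n%:R)) ^+ 2 <=
  (2 * w ^+ 2) ^+ i.
Proof.
move=> n0 p0 be0 pw Kw iK; have w0 : 0 <= w by apply: le_trans pw; exact: mulr_ge0.
(* The dummy count is concentrated at 0. The box of size B + 1 contains this point even when B =
   0. *)
have m0 : 1 <= pois_mass (n%:R * 0 : R) B.+1.
  rewrite /pois_mass big_ord_recl /pois mulr0 expr0 fact0 divr1 mul1r oppr0 expR0.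
  by rewrite lerDl sumr_ge0// => a _; rewrite mulr_ge0 ?expR_ge0// divr_ge0 ?exprn_ge0.
have := @pois_sum2_lin2X_sqr_le R n 0 be 0 p w K i B.+1 n0 (lexx 0) p0.
rewrite mul0r add0r ger0_norm ?mulr_ge0// => /(_ pw).
have hv : K%:R * ((0 ^+ 2 * 0 + be ^+ 2 * p) / n%:R) <= w ^+ 2.
  have -> : K%:R * ((0 ^+ 2 * 0 + be ^+ 2 * p) / n%:R) = be * (K%:R / n%:R) * (be * p).
    by ring.
  by rewrite expr2 ler_pM ?mulr_ge0 ?divr_ge0.
move=> /(_ hv iK); apply: le_trans.
rewrite (_ : (fun a b => _) = (fun a b : nat => 1 * (be ^+ i * g0 n i (b%:R / n%:R)) ^+ 2)).
  rewrite (pois_sum2_prod _ _ _ (fun _ => 1)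
    (fun b => (be ^+ i * g0 n i (b%:R / n%:R)) ^+ 2)).
  have t0 (a : nat) : 0 <= pois (n%:R * p) a * (be ^+ i * g0 n i (a%:R / n%:R)) ^+ 2.
    by rewrite mulr_ge0 ?sqr_ge0// pois_ge0// mulr_ge0.
  under [X in _ <= X * _]eq_bigr do rewrite mulr1.
  rewrite -[leLHS]mul1r ler_pM//; first exact: sumr_ge0.
  by rewrite big_ord_recr/= lerDl.
by apply/funext => a; apply/funext => b; rewrite (g0_lin2X i a b be n0).2 mul1r.
Qed.

(* In terms of the square roots (x, y) of the observed and (r, s) of the true
   frequencies, the regimes of the estimator are x - y against 5 sg. *)
Lemma regime_neg (R : realType) (sg x y r s : R) : 0 <= x -> 0 <= y -> 0 <= r -> 0 <= s ->
  `|x - r| + `|y - s| <= sg -> x ^+ 2 - y ^+ 2 < - (5 * sg * (x + y)) ->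
  r ^+ 2 <= s ^+ 2.
Proof.
move=> x0 y0 r0 s0 h1 h2.
have sg0 : 0 <= sg by apply: le_trans h1; rewrite addr_ge0.
have h : 5 * sg < y - x.
  rewrite ltNge; apply/negP => h; move: h2; rewrite ltNge => /negP; apply.
  rewrite subr_sqr lerNl -mulNr ler_wpM2r ?addr_ge0//; lra.
rewrite lerXn2r ?nnegrE//.
have : r <= x + `|x - r| by have := ler_norm (r - x); rewrite distrC; lra.
have : y - `|y - s| <= s by have := ler_norm (y - s); lra.
by lra.
Qed.

Lemma regime_pos (R : realType) (sg x y r s : R) : 0 <= x -> 0 <= y -> 0 <= r -> 0 <= s ->
  `|x - r| + `|y - s| <= sg -> 5 * sg * (x + y) < x ^+ 2 - y ^+ 2 ->
  s ^+ 2 <= r ^+ 2.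
Proof.
move=> x0 y0 r0 s0 h1 h2; apply: (@regime_neg _ sg y x) => //; first by rewrite addrC.
by rewrite ltrNr opprB [y + x]addrC.
Qed.

(** Each observed root is at most 4 sg, so each true one is at most 5 sg, and 25 <= 32. The 32 is
    twice the threshold 16, the scale that brings the true frequencies into the unit square of the
    first polynomial. *)
Lemma regime_small (R : realType) (sg x y r s : R) : 0 <= x -> 0 <= y -> 0 <= r -> 0 <= s ->
  `|x - r| + `|y - s| <= sg -> x ^+ 2 + y ^+ 2 < 16 * sg ^+ 2 ->
  r ^+ 2 <= 32 * sg ^+ 2 /\ s ^+ 2 <= 32 * sg ^+ 2.
Proof.
move=> x0 y0 r0 s0 h1 h2.
have sg0 : 0 <= sg by apply: le_trans h1; rewrite addr_ge0.
have bnd (z : R) : 0 <= z -> z ^+ 2 <= 16 * sg ^+ 2 -> z <= 4 * sg.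
  move=> z0 hz; rewrite -(@ler_pXn2r _ 2) ?nnegrE ?mulr_ge0//.
  by rewrite exprMn (_ : 4 ^+ 2 = 16); last by ring.
have xb : x <= 4 * sg by apply: bnd => //; have := sqr_ge0 y; lra.
have yb : y <= 4 * sg by apply: bnd => //; have := sqr_ge0 x; lra.
have fin (z : R) : 0 <= z -> z <= 5 * sg -> z ^+ 2 <= 32 * sg ^+ 2.
  move=> z0 hz; apply: (@le_trans _ _ ((5 * sg) ^+ 2)).
    by rewrite lerXn2r ?nnegrE ?mulr_ge0.
  by rewrite exprMn ler_wpM2r ?sqr_ge0//; lra.
have := ler_norm (r - x); have := ler_norm (s - y).
rewrite ![`|_ - x|]distrC ![`|_ - y|]distrC => hs hr.
have := normr_ge0 (x - r); have := normr_ge0 (y - s).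
by split; apply: fin => //; lra.
Qed.

(** The lower bound forces x + y >= 4 sg, so a displacement sg changes this sum by at most a
    quarter, while |r - s| <= 6 sg. The product gives 36 (25/16) 2 <= 128, the constant for which W
    bounds |p - e q|. *)
Lemma regime_close (R : realType) (sg x y r s : R) : 0 <= x -> 0 <= y -> 0 <= r -> 0 <= s ->
  0 < sg -> `|x - r| + `|y - s| <= sg ->
  `|x ^+ 2 - y ^+ 2| <= 5 * sg * (x + y) -> 16 * sg ^+ 2 <= x ^+ 2 + y ^+ 2 ->
  [/\ (r ^+ 2 - s ^+ 2) ^+ 2 <= 128 * sg ^+ 2 * (x ^+ 2 + y ^+ 2),
      x ^+ 2 + y ^+ 2 <= 4 * (r ^+ 2 + s ^+ 2) &
      r ^+ 2 + s ^+ 2 <= 4 * (x ^+ 2 + y ^+ 2)].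
Proof.
move=> x0 y0 r0 s0 sg0 h1 h2 h3.
have nn := (normr_ge0 (x - r), normr_ge0 (y - s)).
have hsum : 4 * sg <= x + y.
  rewrite -(@ler_pXn2r _ 2) ?nnegrE ?addr_ge0 ?mulr_ge0 ?(ltW sg0)//.
  rewrite exprMn (_ : 4 ^+ 2 = 16); last by ring.
  apply: le_trans h3 _; rewrite sqrrD -addrA lerD2l lerDr.
  by rewrite mulrn_wge0// mulr_ge0.
have xy0 : 0 < x + y by lra.
have hd : `|x - y| <= 5 * sg.
  by move: h2; rewrite subr_sqr normrM [`|x + y|]ger0_norm ?ler_pM2r// ltW.
have hrs : `|r - s| <= 6 * sg.
  have -> : r - s = (x - y) - (x - r) + (y - s) by ring.
  rewrite (le_trans (ler_normD _ _))//; have := ler_normB (x - y) (x - r); lra.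
have [b1 b2] : r + s <= 5 / 4 * (x + y) /\ 3 / 4 * (x + y) <= r + s.
  have := ler_norm (x - r); have := ler_norm (y - s).
  have := ler_norm (r - x); have := ler_norm (s - y).
  rewrite ![`|_ - x|]distrC ![`|_ - y|]distrC => g1 g2 g3 g4; split; lra.
have sq2 (u v : R) : (u + v) ^+ 2 <= 2 * (u ^+ 2 + v ^+ 2).
  by have := sqr_ge0 (u - v); rewrite !expr2; lra.
have sq1 (u v : R) : 0 <= u -> 0 <= v -> u ^+ 2 + v ^+ 2 <= (u + v) ^+ 2.
  by move=> u0 v0; have := mulr_ge0 u0 v0; rewrite !expr2; lra.
have q1 : (r + s) ^+ 2 <= 25 / 16 * (x + y) ^+ 2.
  have -> : 25 / 16 * (x + y) ^+ 2 = (5 / 4 * (x + y)) ^+ 2 by field.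
  by rewrite lerXn2r ?nnegrE//; lra.
have q2 : 9 / 16 * (x + y) ^+ 2 <= (r + s) ^+ 2.
  have -> : 9 / 16 * (x + y) ^+ 2 = (3 / 4 * (x + y)) ^+ 2 by field.
  by rewrite lerXn2r ?nnegrE//; lra.
have := sq2 x y; have := sq2 r s; have := sq1 _ _ x0 y0; have := sq1 _ _ r0 s0.
move=> t1 t2 t3 t4; split; [|lra|lra].
rewrite subr_sqr exprMn.
have e1 : (r - s) ^+ 2 <= 36 * sg ^+ 2.
  rewrite -[_ ^+ 2]real_normK ?num_real//.
  have -> : 36 * sg ^+ 2 = (6 * sg) ^+ 2 by ring.
  by rewrite lerXn2r ?nnegrE//; lra.
apply: (@le_trans _ _ (36 * sg ^+ 2 * (25 / 16 * (2 * (x ^+ 2 + y ^+ 2))))).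
  by apply: ler_pM; rewrite ?sqr_ge0//; lra.
have := mulr_ge0 (sqr_ge0 sg) (addr_ge0 (sqr_ge0 x) (sqr_ge0 y)).
by lra.
Qed.

(* The estimator f of d, as a function of the second batch's counts, has mean
   within Bb^(1/2) of d and variance at most V. *)
Definition bias_variance (R : realType) (l m : R) (f : nat -> nat -> R) (d V Bb : R) : Prop :=
  exists c, [/\ pois_moment l m f c,
    forall B, pois_sum2 l m B (fun a b => f a b ^+ 2) <= V + c ^+ 2 &
    (c - d) ^+ 2 <= Bb].

Lemma bias_variance_zero (R : realType) (l m : R) :
  bias_variance l m (fun _ _ => 0) 0 0 0.
Proof.
have z B (f : nat -> nat -> R) : (forall a b, f a b = 0) -> pois_sum2 l m B f = 0.
  by move=> f0; rewrite /pois_sum2 big1// => a _; rewrite big1// => b _; rewrite f0 mulr0.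
exists 0; split; last by rewrite subrr expr0n.
  rewrite /pois_moment; under eq_fun do rewrite z//.
  exact: cvg_cst.
by move=> B; rewrite z ?expr0n ?addr0// => a b; rewrite expr0n.
Qed.

Lemma bias_variance_linear (R : realType) (n : nat) (e p q : R) :
  (0 < n)%N -> 0 <= p -> 0 <= q ->
  bias_variance (n%:R * p) (n%:R * q) (fun a b => a%:R / n%:R - e * (b%:R / n%:R))
    (p - e * q) ((p + e ^+ 2 * q) / n%:R) 0.
Proof.
move=> n0 p0 q0; exists (p - e * q); split; last by rewrite subrr expr0n.
  rewrite (_ : (fun a b => _) =
    fun a b => unbiased n (lin2 1 (- e)) (a%:R / n%:R) (b%:R / n%:R)).
    have := @pois_moment_unbiased R n p q (lin2 1 (- e)) n0.
    by rewrite lin2E mul1r mulNr.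
  apply/funext => a; apply/funext => b; rewrite -[lin2 _ _]mulr1 unbiased_lin2M//.
  by rewrite !unbiased1; ring.
move=> B.
have -> : (p + e ^+ 2 * q) / n%:R + (p - e * q) ^+ 2 = (lin2_prod n 1 (- e) 1 1).[p, q].
  rewrite /= expr1 expr0 mulr1 hornerD hornerD !hornerM !hornerC !lin2E.
  by rewrite expr1n sqrrN; ring.
apply: pois_sum2_le_moment; rewrite ?mulr_ge0//; first by move=> a b; exact: sqr_ge0.
rewrite (_ : (fun a b => _) =
    fun a b => unbiased n (lin2_prod n 1 (- e) 1 1) (a%:R / n%:R) (b%:R / n%:R)).
  exact: pois_moment_unbiased.
apply/funext => a; apply/funext => b; rewrite -unbiased_lin2_prod// -expr2.
rewrite expr1 -[lin2 _ _]mulr1 unbiased_lin2M// !unbiased1.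
by congr (_ ^+ 2); ring.
Qed.

Lemma exprz_1B (R : realType) (x : R) (i j : nat) : x != 0 ->
  x ^ (1 - i%:Z) = x / x ^+ i /\ x ^ (1 - i%:Z - j%:Z) = x / x ^+ i / x ^+ j.
Proof. by move=> x0; split; rewrite !expfzDr// expr1z !exprnN. Qed.

Lemma horner2_coef (R : realType) M (D : {poly {poly R}}) (x y : R) : degree_le2 M D ->
  D.[x, y] = \sum_(i < M.+1) \sum_(j < M.+1) D`_i`_j * (x ^+ i * y ^+ j).
Proof.
move=> /andP[sD sYD]; rewrite (horner_coef_wide _ sD) horner_sum.
apply: eq_bigr => i _; rewrite hornerM -polyC_exp hornerC.
rewrite (@horner_coef_wide _ M.+1); last exact: leq_trans (max_size_coefXY _ _) sYD.
by rewrite mulr_suml; apply: eq_bigr => j _; ring.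
Qed.

(** Writing the target as f g with f = sqrt x + sqrt y and g <= f, the error of the product is at
    most 2 f eta + eta^2. The constant removed from u v is at most eta^2, both targets being 0 at
    the origin. Approximating the factors separately is what leaves f in front of eta: the squared
    bias is proportional to x + y, which sums to a constant over the symbols. *)
Lemma h2K_approx (R : realType) (u v : {poly {poly R}}) (eta : R) :
  (forall x y, 0 <= x <= 1 -> 0 <= y <= 1 ->
     `|Num.sqrt x + Num.sqrt y - u.[x, y]| <= eta) ->
  (forall x y, 0 <= x <= 1 -> 0 <= y <= 1 ->
     `|Num.max (Num.sqrt x - Num.sqrt y) 0 - v.[x, y]| <= eta) ->
  forall x y, 0 <= x <= 1 -> 0 <= y <= 1 ->
    ((h2K u v).[x, y] - Num.max (x - y) 0) ^+ 2 <=
      16 * (x + y) * eta ^+ 2 + 8 * eta ^+ 4.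
Proof.
move=> hu hv x y hx hy.
have hu0 := hu 0 0; have hv0 := hv 0 0; move: hu0 hv0.
rewrite lexx ler01 => /(_ isT isT) hu0 /(_ isT isT).
rewrite sqrtr0 subrr maxxx add0r normrN => hv0.
rewrite sqrtr0 addr0 sub0r normrN in hu0.
have eta0 : 0 <= eta by exact: le_trans hu0.
have -> : (h2K u v).[x, y] = u.[x, y] * v.[x, y] - u.[0, 0] * v.[0, 0].
  by rewrite /h2K hornerD hornerN hornerM hornerC hornerD hornerN hornerM hornerC.
have /andP[x0 _] := hx; have /andP[y0 _] := hy.
have := hu x y hx hy; have := hv x y hx hy.
set s := Num.sqrt x; set t := Num.sqrt y.
have s0 : 0 <= s by exact: sqrtr_ge0.
have t0 : 0 <= t by exact: sqrtr_ge0.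
have sx : s ^+ 2 = x by exact: sqr_sqrtr.
have ty : t ^+ 2 = y by exact: sqr_sqrtr.
have mE : Num.max (x - y) 0 = (s + t) * Num.max (s - t) 0.
  rewrite -sx -ty subr_sqr [in RHS]mulrC maxr_pMl ?addr_ge0// mul0r.
  by [].
have g0 : 0 <= Num.max (s - t) 0 by rewrite le_max lexx orbT.
have gf : Num.max (s - t) 0 <= s + t by rewrite ge_max; apply/andP; split; lra.
rewrite mE; move: g0 gf; move: (Num.max (s - t) 0) => g g0 gf.
move: (u.[x, y]) (v.[x, y]) => U V hV hU.
have e1 : `|U * V - (s + t) * g| <= 2 * (s + t) * eta + eta ^+ 2.
  have -> : U * V - (s + t) * g =
     (s + t - U) * (g - V) - (s + t) * (g - V) - g * (s + t - U) by ring.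
  rewrite (le_trans (ler_normB _ _))//.
  have a1 : `|(s + t - U) * (g - V) - (s + t) * (g - V)| <= eta ^+ 2 + (s + t) * eta.
    rewrite (le_trans (ler_normB _ _))// !normrM expr2 lerD// ?ler_pM//.
    by rewrite ger0_norm// addr_ge0.
  have a2 : `|g * (s + t - U)| <= (s + t) * eta.
    by rewrite normrM ler_pM// ger0_norm.
  by apply: le_trans (lerD a1 a2) _; lra.
have e2 : `|u.[0, 0] * v.[0, 0]| <= eta ^+ 2 by rewrite normrM expr2 ler_pM.
have e3 : `|U * V - u.[0, 0] * v.[0, 0] - (s + t) * g| <= 2 * (s + t) * eta + 2 * eta ^+ 2.
  rewrite addrAC (le_trans (ler_normB _ _))//; lra.
have b0 : 0 <= 2 * (s + t) * eta + 2 * eta ^+ 2.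
  by rewrite addr_ge0 ?mulr_ge0 ?addr_ge0 ?sqr_ge0.
rewrite -[_ ^+ 2]real_normK ?num_real//.
apply: (@le_trans _ _ ((2 * (s + t) * eta + 2 * eta ^+ 2) ^+ 2)).
  by rewrite lerXn2r ?nnegrE.
rewrite -sx -ty -subr_ge0.
have -> : 16 * (s ^+ 2 + t ^+ 2) * eta ^+ 2 + 8 * eta ^+ 4 -
    (2 * (s + t) * eta + 2 * eta ^+ 2) ^+ 2 =
    8 * eta ^+ 2 * (s - t) ^+ 2 + 4 * eta ^+ 2 * (s + t - eta) ^+ 2 by ring.
by apply: addr_ge0; apply: mulr_ge0 (mulr_ge0 _ (sqr_ge0 _)) (sqr_ge0 _).
Qed.

Lemma coef_norm2E (R : realType) M (D : {poly {poly R}}) : degree_le2 M D ->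
  coef_norm (coef_norm Num.norm) D = \sum_(i < M.+1) \sum_(j < M.+1) `|D`_i`_j|.
Proof.
move=> /andP[sD sYD]; rewrite (coef_norm_widen (coef_norm0 _) sD).
apply: eq_bigr => i _; apply: coef_norm_widen (normr0 _) _.
exact: leq_trans (max_size_coefXY _ _) sYD.
Qed.

Lemma degree_le2_h2K (R : realType) K (u v : {poly {poly R}}) :
  degree_le2 K u -> degree_le2 K v -> degree_le2 (2 * K)%N (h2K u v).
Proof.
move=> du dv; apply: degree_le2D; first by rewrite mul2n -addnn; exact: degree_le2M.
by apply/degree_le2N/(degree_le2W _ (degree_le2C _)).
Qed.

Lemma h2K00 (R : realType) (u v : {poly {poly R}}) : (h2K u v)`_0`_0 = 0.
Proof.
have E (w : {poly {poly R}}) : w`_0`_0 = w.[0, 0].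
  by rewrite [0%:P]polyC0 !horner_coef0.
rewrite E /h2K hornerD hornerN hornerM hornerC hornerD hornerN hornerM hornerC.
by rewrite subrr.
Qed.

(** In the unit Dl both frequencies lie in [0, 1] and the normalised monomials of degrees i and j
    have second moments at most 2^i and 2^j. Since i and j are at most 2K, their product is at most
    16^K. *)
Lemma bias_variance_D1tilde (R : realType) (n K : nat) (eps c1 eta p q Dl : R)
    (u v : {poly {poly R}}) :
  (0 < n)%N -> 0 <= p -> 0 <= q -> Dl = 2 * (c1 * ln n%:R / n%:R) -> 0 < Dl ->
  p <= Dl -> expR eps * q <= Dl ->
  (2 * K)%:R / n%:R <= Dl -> expR eps * ((2 * K)%:R / n%:R) <= Dl ->
  degree_le2 K u -> degree_le2 K v ->
  (forall x y, 0 <= x <= 1 -> 0 <= y <= 1 ->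
     `|Num.sqrt x + Num.sqrt y - u.[x, y]| <= eta) ->
  (forall x y, 0 <= x <= 1 -> 0 <= y <= 1 ->
     `|Num.max (Num.sqrt x - Num.sqrt y) 0 - v.[x, y]| <= eta) ->
  bias_variance (n%:R * p) (n%:R * q)
    (fun a b => D1tilde n K eps c1 u v (a%:R / n%:R) (b%:R / n%:R))
    (Num.max (p - expR eps * q) 0)
    (coef_norm (coef_norm Num.norm) (h2K u v) ^+ 2 * (Dl ^+ 2 * 16 ^+ K))
    (16 * Dl * (p + expR eps * q) * eta ^+ 2 + 8 * Dl ^+ 2 * eta ^+ 4).
Proof.
move=> n0 p0 q0 DlE Dl0 pD qD KD eKD du dv hu hv.
set e := expR eps; have e0 : 0 <= e by exact: expR_ge0.
set h := h2K u v; have dh : degree_le2 (2 * K)%N h by exact: degree_le2_h2K.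
pose M := (2 * K).+1.
pose G (ij : 'I_M * 'I_M) (a b : nat) : R :=
  Dl * ((Dl^-1) ^+ ij.1 * g0 n ij.1 (a%:R / n%:R)) *
       ((Dl^-1 * e) ^+ ij.2 * g0 n ij.2 (b%:R / n%:R)).
pose P (ij : 'I_M * 'I_M) := (1 <= ij.1 + ij.2)%N.
have fE a b : D1tilde n K eps c1 u v (a%:R / n%:R) (b%:R / n%:R) =
    \sum_(ij | P ij) h`_ij.1`_ij.2 * G ij a b.
  rewrite /D1tilde -DlE (pair_big_dep xpredT (fun i j : 'I_M => 1 <= i + j)%N
    (fun i j : 'I_M => h`_i`_j * Dl ^ (1 - i%:Z - j%:Z) * expR (j%:R * eps) *
      g0 n i (a%:R / n%:R) * g0 n j (b%:R / n%:R)))/=.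
  apply: eq_bigr => -[i j] _; rewrite /G/= (exprz_1B i j (lt0r_neq0 Dl0)).2.
  by rewrite expRM_natl -/e !exprMn !exprVn; ring.
have sP : \sum_(ij | P ij) `|h`_ij.1`_ij.2| <= coef_norm (coef_norm Num.norm) h.
  rewrite (coef_norm2E dh) pair_bigA/= big_mkcond; apply: ler_sum => ij _.
  by case: ifP.
pose c := \sum_(ij | P ij) h`_ij.1`_ij.2 *
  (Dl * (Dl^-1) ^+ ij.1 * (Dl^-1 * e) ^+ ij.2 * (p ^+ ij.1 * q ^+ ij.2)).
(* The sum leaves out the index (0, 0), where the coefficient of h is 0, so it is the full
   polynomial. *)
have cE : c = Dl * h.[p / Dl, e * q / Dl].
  rewrite (horner2_coef _ _ dh) pair_bigA/= mulr_sumr /c [LHS]big_mkcond; apply: eq_bigr.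
  move=> [[i hi] [j hj]] _; rewrite /P /=; case: ifPn => [_|].
    by rewrite !exprMn !exprVn; ring.
  rewrite -ltnNge ltnS leqn0 addn_eq0 => /andP[/eqP -> /eqP ->].
  by rewrite h2K00 mul0r mulr0.
have x01 : 0 <= p / Dl <= 1 by rewrite divr_ge0 ?(ltW Dl0)//= ler_pdivrMr ?mul1r.
have y01 : 0 <= e * q / Dl <= 1.
  by rewrite divr_ge0 ?mulr_ge0 ?(ltW Dl0)//= ler_pdivrMr ?mul1r.
exists c; split.
- rewrite (_ : (fun a b => _) = fun a b => \sum_(ij | P ij) h`_ij.1`_ij.2 * G ij a b); last first.
    by apply/funext => a; apply/funext => b; exact: fE.
  apply: pois_moment_sum => ij _; apply: pois_momentZ.
  rewrite /G (_ : (fun a b => _) = fun a b : nat => (Dl * (Dl^-1) ^+ ij.1 * (Dl^-1 * e) ^+ ij.2) *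
    (g0 n ij.1 (a%:R / n%:R) * g0 n ij.2 (b%:R / n%:R))); last first.
    by apply/funext => a; apply/funext => b; ring.
  exact/pois_momentZ/pois_moment_g0.
- move=> B; rewrite (_ : (fun a b => _) =
    fun a b => (\sum_(ij | P ij) h`_ij.1`_ij.2 * G ij a b) ^+ 2); last first.
    by apply/funext => a; apply/funext => b; rewrite fE.
  apply: (@le_trans _ _ ((\sum_(ij | P ij) `|h`_ij.1`_ij.2|) ^+ 2 * (Dl ^+ 2 * 16 ^+ K))).
    apply: pois_sum2_wsum_le; rewrite ?mulr_ge0// => -[i j] _.
    rewrite /G /= (_ : (fun a b => _) = fun a b : nat => Dl ^+ 2 *
      (((Dl^-1) ^+ i * g0 n i (a%:R / n%:R)) ^+ 2 *
       ((Dl^-1 * e) ^+ j * g0 n j (b%:R / n%:R)) ^+ 2)); last first.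
      by apply/funext => a; apply/funext => b; rewrite -!exprMn; congr (_ ^+ 2); ring.
    rewrite pois_sum2Z ler_wpM2l ?sqr_ge0//.
    rewrite (pois_sum2_prod _ _ _ (fun a => ((Dl^-1) ^+ i * g0 n i (a%:R / n%:R)) ^+ 2)
      (fun b => ((Dl^-1 * e) ^+ j * g0 n j (b%:R / n%:R)) ^+ 2)).
    have t0 (l : R) (F : nat -> R) : 0 <= l -> 0 <= \sum_(a < B) pois l a * F a ^+ 2.
      by move=> l0; apply: sumr_ge0 => a _; rewrite mulr_ge0 ?pois_ge0 ?sqr_ge0.
    have b1 : \sum_(a < B) pois (n%:R * p) a * ((Dl^-1) ^+ i * g0 n i (a%:R / n%:R)) ^+ 2
        <= (2 * 1 ^+ 2) ^+ i.
      apply: (@pois_sum_g0_sqr_le _ _ (2 * K)%N) => //.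
      - by rewrite invr_ge0 ltW.
      - by rewrite ler_pdivrMl ?mulr1.
      - by rewrite ler_pdivrMl ?mulr1.
      - exact: ltnSE.
    have b2 : \sum_(b < B) pois (n%:R * q) b * ((Dl^-1 * e) ^+ j * g0 n j (b%:R / n%:R)) ^+ 2
        <= (2 * 1 ^+ 2) ^+ j.
      apply: (@pois_sum_g0_sqr_le _ _ (2 * K)%N) => //.
      - by rewrite mulr_ge0// invr_ge0 ltW.
      - by rewrite -mulrA ler_pdivrMl ?mulr1.
      - by rewrite -mulrA ler_pdivrMl ?mulr1.
      - exact: ltnSE.
    have l0 : 0 <= n%:R * p by rewrite mulr_ge0.
    have m0 : 0 <= n%:R * q by rewrite mulr_ge0.
    apply: le_trans (ler_pM
      (t0 _ (fun a : nat => (Dl^-1) ^+ i * g0 n i (a%:R / n%:R)) l0)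
      (t0 _ (fun b : nat => (Dl^-1 * e) ^+ j * g0 n j (b%:R / n%:R)) m0) b1 b2) _.
    rewrite expr1n mulr1 (_ : 16 = 2 ^+ 2 * 2 ^+ 2); last by ring.
    by rewrite exprMn -!exprM ler_pM ?exprn_ge0// ler_weXn2l ?ler1n//; exact: ltnSE.
  have DK : 0 <= Dl ^+ 2 * 16 ^+ K by rewrite mulr_ge0 ?sqr_ge0 ?exprn_ge0.
  have S0 : 0 <= \sum_(ij | P ij) `|h`_ij.1`_ij.2| by exact: sumr_ge0.
  rewrite -[leLHS]addr0; apply: lerD; last exact: sqr_ge0.
  apply: (ler_wpM2r DK); rewrite lerXn2r ?nnegrE//.
  exact: le_trans sP.
- have -> : Num.max (p - e * q) 0 = Dl * Num.max (p / Dl - e * q / Dl) 0.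
    rewrite maxr_pMr ?(ltW Dl0)// mulr0; congr (Num.max _ 0).
    by field; exact: lt0r_neq0.
  rewrite cE -mulrBr exprMn.
  apply: le_trans (ler_wpM2l (sqr_ge0 _) (h2K_approx hu hv x01 y01)) _.
  rewrite le_eqVlt; apply/orP; left; apply/eqP; field; exact: lt0r_neq0.
Qed.

(** The target is half of |c0| - c0 with c0 = e q - p, and |c0| = W |c0 / W| is approximated on
    [-1, 1]. The same W controls the noise: the normalised j-th power has second moment at most W^2
    2^j. *)
Lemma bias_variance_D2tilde (R : realType) (n K : nat) (eps c1 eta p q x y W : R)
    (r : {poly R}) :
  (0 < n)%N -> 0 <= p -> 0 <= q ->
  W = Num.sqrt (8 * c1 * ln n%:R / n%:R) * Num.sqrt (x + expR eps * y) -> 0 < W ->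
  `|expR eps * q - p| <= W ->
  K.+1%:R * ((p + expR eps ^+ 2 * q) / n%:R) <= W ^+ 2 ->
  (size r <= K.+1)%N ->
  (forall t, -1 <= t <= 1 -> `| `|t| - r.[t] | <= eta) ->
  bias_variance (n%:R * p) (n%:R * q)
    (fun a b => D2tilde n K eps c1 r (a%:R / n%:R) (b%:R / n%:R) x y)
    (Num.max (p - expR eps * q) 0)
    (W ^+ 2 * 2 ^+ K * (coef_norm Num.norm r ^+ 2 + 1))
    (W ^+ 2 * eta ^+ 2).
Proof.
move=> n0 p0 q0 WE W0 hW hv sr hr.
set e := expR eps in hW hv WE *; have e0 : 0 <= e by exact: expR_ge0.
pose l : {poly {poly R}} := lin2 (-1) e.
have lE : e%:P%:P * 'Y - 'X = l by rewrite /l /lin2 !polyCN mulN1r addrC.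
pose U (D : {poly {poly R}}) (a b : nat) := unbiased n D (a%:R / n%:R) (b%:R / n%:R).
have fE a b : D2tilde n K eps c1 r (a%:R / n%:R) (b%:R / n%:R) x y =
   2^-1 * (\sum_(j < K.+1) r`_j * (W / W ^+ j * U (l ^+ j) a b)) - 2^-1 * U (l ^+ 1) a b.
  rewrite /D2tilde /D2poly -WE lE unbiasedD unbiasedN !unbiasedCM expr1.
  congr (_ * _ - _); rewrite unbiased_sum; apply: eq_bigr => j _.
  by rewrite unbiasedCM (exprz_1B j 0 (lt0r_neq0 W0)).1 -[LHS]mulrA.
pose c0 := e * q - p.
have momU j : pois_moment (n%:R * p) (n%:R * q) (U (l ^+ j)) (c0 ^+ j).
  have := @pois_moment_unbiased R n p q (l ^+ j) n0.
  by rewrite !horner_exp lin2E mulN1r addrC.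
(* The range reaches K + 1 so that the linear term, j = 1, is covered when K = 0. *)
have sndU j B : (j <= K.+1)%N ->
    pois_sum2 (n%:R * p) (n%:R * q) B (fun a b => U (l ^+ j) a b ^+ 2) <= (2 * W ^+ 2) ^+ j.
  move=> jK; apply: (@pois_sum2_lin2X_sqr_le _ _ _ _ _ _ _ K.+1) => //.
    by rewrite mulN1r addrC.
  by rewrite sqrrN expr1n mul1r.
have c0W : -1 <= c0 / W <= 1.
  by rewrite -ler_norml normrM normfV (gtr0_norm W0) ler_pdivrMr ?mul1r.
pose c := 2^-1 * (W * r.[c0 / W]) - 2^-1 * c0.
have cE : c = 2^-1 * (\sum_(j < K.+1) r`_j * (W / W ^+ j * c0 ^+ j)) - 2^-1 * c0 ^+ 1.
  rewrite /c expr1 (horner_coef_wide _ sr) mulr_sumr; congr (_ * _ - _).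
  by apply: eq_bigr => j _; rewrite expr_div_n; ring.
exists c; split.
- rewrite (_ : (fun a b => _) = fun a b : nat =>
   2^-1 * (\sum_(j < K.+1) r`_j * (W / W ^+ j * U (l ^+ j) a b)) + (- 2^-1) * U (l ^+ 1) a b); last first.
    by apply/funext => a; apply/funext => b; rewrite fE mulNr.
  rewrite cE -mulNr; apply: pois_momentD; last exact: pois_momentZ.
  by apply: pois_momentZ; apply: pois_moment_sum => j _; do 2 apply: pois_momentZ.
- move=> B.
  pose S2 := pois_sum2 (n%:R * p) (n%:R * q) B.
  have np0 : 0 <= n%:R * p by rewrite mulr_ge0.
  have nq0 : 0 <= n%:R * q by rewrite mulr_ge0.
  have h1 : S2 (fun a b => (\sum_(j < K.+1) r`_j * (W / W ^+ j * U (l ^+ j) a b)) ^+ 2) <=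
      coef_norm Num.norm r ^+ 2 * (W ^+ 2 * 2 ^+ K).
    rewrite (coef_norm_widen (normr0 _) sr).
    apply: pois_sum2_wsum_le => // j _.
    rewrite (_ : (fun a b => _) = fun a b => (W / W ^+ j) ^+ 2 * U (l ^+ j) a b ^+ 2); last first.
      by apply/funext => a; apply/funext => b; rewrite exprMn.
    rewrite pois_sum2Z.
    have jK : (j <= K.+1)%N by rewrite ltnW.
    apply: le_trans (ler_wpM2l (sqr_ge0 _) (sndU j B jK)) _.
    have -> : (W / W ^+ j) ^+ 2 * (2 * W ^+ 2) ^+ j = W ^+ 2 * 2 ^+ j.
      have : W ^+ j != 0 by rewrite expf_neq0// lt0r_neq0.
      have -> : (2 * W ^+ 2) ^+ j = 2 ^+ j * (W ^+ j) ^+ 2 by rewrite exprMn -!exprM mulnC.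
      by move: (W ^+ j) => z z0; field.
    by rewrite ler_wpM2l ?sqr_ge0// ler_weXn2l ?ler1n//; exact: ltnSE.
  have h2 : S2 (fun a b => U (l ^+ 1) a b ^+ 2) <= 2 * W ^+ 2.
    by apply: le_trans (sndU 1 B _) _; rewrite ?expr1.
  have h3 : S2 (fun a b => D2tilde n K eps c1 r (a%:R / n%:R) (b%:R / n%:R) x y ^+ 2) <=
    2^-1 * S2 (fun a b => (\sum_(j < K.+1) r`_j * (W / W ^+ j * U (l ^+ j) a b)) ^+ 2) +
    2^-1 * S2 (fun a b => U (l ^+ 1) a b ^+ 2).
    rewrite /S2 -!pois_sum2Z -pois_sum2D; apply: pois_sum2_le => // a b.
    rewrite fE; set s := \sum_(_ < _) _; set t := U _ _ _.
    have := sqr_ge0 (s + t); rewrite !expr2; lra.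
  have W2 : 0 <= W ^+ 2 by exact: sqr_ge0.
  have K1 : W ^+ 2 <= W ^+ 2 * 2 ^+ K by rewrite ler_peMr// exprn_ege1// ler1n.
  have N2 : 0 <= W ^+ 2 * 2 ^+ K * coef_norm Num.norm r ^+ 2.
    by apply: mulr_ge0 (sqr_ge0 _); rewrite mulr_ge0// exprn_ge0.
  apply: (le_trans h3); have := sqr_ge0 c; move: h1 h2 K1 N2.
  by rewrite mulrDr mulr1 [coef_norm _ _ ^+ 2 * _]mulrC; lra.
have -> : c - Num.max (p - e * q) 0 = - (2^-1 * W) * (`|c0 / W| - r.[c0 / W]).
  have -> : Num.max (p - e * q) 0 = 2^-1 * `|c0| - 2^-1 * c0.
    rewrite /c0; have [h|h] := ger0P (e * q - p).
      by rewrite subrr max_r//; move: h; rewrite !subr_ge0 subr_le0.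
    have h' : 0 <= p - e * q by move: h; rewrite subr_lt0 subr_ge0 => /ltW.
    by rewrite (max_l h'); field.
  rewrite normrM normfV (gtr0_norm W0) /c; field; exact: lt0r_neq0.
have h := hr _ c0W.
have eta0 : 0 <= eta by apply: le_trans h.
rewrite exprMn sqrrN; apply: ler_pM; [exact: sqr_ge0|exact: sqr_ge0| |].
  rewrite lerXn2r ?nnegrE ?mulr_ge0 ?invr_ge0 ?(ltW W0)//; lra.
rewrite -[leLHS]real_normK ?num_real// lerXn2r ?nnegrE//.
Qed.

(** * Risk of the clipped sum *)

Lemma sum_ffun_prod_weight (R : realType) (I J : finType) (a w : I -> J -> R) :
  \sum_(f : {ffun I -> J}) (\prod_i a i (f i)) * (\prod_i w i (f i)) =
  \prod_i \sum_j a i j * w i j.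
Proof.
by rewrite bigA_distr_bigA; apply: eq_bigr => f _; rewrite big_split.
Qed.

Lemma sum_ffun_weight1 (R : realType) (I J : finType) (a : I -> J -> R) :
  \sum_(f : {ffun I -> J}) \prod_i a i (f i) = \prod_i \sum_j a i j.
Proof. by rewrite bigA_distr_bigA. Qed.

Lemma sum_ffun_marginal (R : realType) (I J : finType) (a : I -> J -> R) (i : I) (g : J -> R) :
  (forall i j, 0 <= a i j) -> (forall i, \sum_j a i j <= 1) -> (forall j, 0 <= g j) ->
  \sum_(f : {ffun I -> J}) (\prod_i a i (f i)) * g (f i) <= \sum_j a i j * g j.
Proof.
move=> a0 a1 g0.
pose w l j := if l == i then g j else 1.
have -> : \sum_(f : {ffun I -> J}) (\prod_i a i (f i)) * g (f i) =
    \sum_(f : {ffun I -> J}) (\prod_i a i (f i)) * (\prod_l w l (f l)).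
  apply: eq_bigr => f _; congr (_ * _); rewrite (bigD1 i)//= /w eqxx big1 ?mulr1//.
  by move=> l /negbTE ->.
rewrite sum_ffun_prod_weight (bigD1 i)//= {1}/w eqxx.
apply: ler_piMr; first by apply: sumr_ge0 => j _; rewrite mulr_ge0.
apply: prodr_ile1 => l li; rewrite /w (negbTE li); under eq_bigr do rewrite mulr1.
by rewrite a1 sumr_ge0.
Qed.

Lemma sum_ffun_pair_le (R : realType) (I J : finType) (a : I -> J -> R) (i k : I) (y : I -> J -> R) :
  i != k -> (forall i j, 0 <= a i j) -> (forall i, \sum_j a i j <= 1) ->
  \sum_(f : {ffun I -> J}) (\prod_i a i (f i)) * (y i (f i) * y k (f k)) <=
  `|\sum_j a i j * y i j| * `|\sum_j a k j * y k j|.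
Proof.
move=> ik a0 a1.
pose w l j := if (l == i) || (l == k) then y l j else 1.
have ki : k != i by rewrite eq_sym.
have -> : \sum_(f : {ffun I -> J}) (\prod_i a i (f i)) * (y i (f i) * y k (f k)) =
    \sum_(f : {ffun I -> J}) (\prod_i a i (f i)) * (\prod_l w l (f l)).
  apply: eq_bigr => f _; congr (_ * _); rewrite (bigD1 i)//= (bigD1 k)//= /w !eqxx orbT.
  rewrite big1 ?mulr1//; by move=> l /andP[/negbTE -> /negbTE ->].
rewrite sum_ffun_prod_weight (bigD1 i)//= (bigD1 k)//= {1 2}/w !eqxx orbT mulrA.
apply: le_trans (ler_norm _) _; rewrite !normrM ler_piMr ?mulr_ge0// normr_prod.
apply: prodr_ile1 => l /andP[li lk]; rewrite normr_ge0/= /w (negbTE li) (negbTE lk)/=.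
under eq_bigr do rewrite mulr1.
by rewrite ger0_norm ?a1// sumr_ge0.
Qed.

(** Truncated laws are only sub-probabilities, so the other symbols contribute a factor at most 1
    and a cross term is bounded by the product of the two absolute means. For centred variables
    these tend to 0 as the box grows. *)
Lemma sum_ffun_sqr_le (R : realType) (I J : finType) (a : I -> J -> R) (y : I -> J -> R) :
  (forall i j, 0 <= a i j) -> (forall i, \sum_j a i j <= 1) ->
  \sum_(f : {ffun I -> J}) (\prod_i a i (f i)) * (\sum_i y i (f i)) ^+ 2 <=
  \sum_i (\sum_j a i j * y i j ^+ 2 +
    \sum_(k | k != i) `|\sum_j a i j * y i j| * `|\sum_j a k j * y k j|).
Proof.
move=> a0 a1.
have -> : \sum_(f : {ffun I -> J}) (\prod_i a i (f i)) * (\sum_i y i (f i)) ^+ 2 =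
    \sum_i \sum_k \sum_(f : {ffun I -> J})
      (\prod_i a i (f i)) * (y i (f i) * y k (f k)).
  transitivity (\sum_(f : {ffun I -> J}) \sum_i \sum_k
      (\prod_i a i (f i)) * (y i (f i) * y k (f k))).
    apply: eq_bigr => f _; rewrite expr2 mulr_suml mulr_sumr; apply: eq_bigr => i _.
    by rewrite mulr_sumr mulr_sumr.
  rewrite exchange_big; apply: eq_bigr => i _; exact: exchange_big.
apply: ler_sum => i _; rewrite (bigD1 i)//= lerD//.
  apply: le_trans (sum_ffun_marginal i (g := fun j => y i j ^+ 2) a0 a1 (fun j => sqr_ge0 _)).
  by apply: ler_sum => f _; rewrite expr2.
by apply: ler_sum => k ki; apply: sum_ffun_pair_le; rewrite // eq_sym.
Qed.

Lemma sqr_sum_le (R : realType) (S : nat) (x : 'I_S -> R) :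
  (\sum_i x i) ^+ 2 <= S%:R * \sum_i x i ^+ 2.
Proof.
have := sqr_wsum_le (index_enum 'I_S) xpredT (fun _ => 1) x.
under eq_bigr do rewrite mul1r.
under [X in _ <= _ * X -> _]eq_bigr do rewrite normr1 mul1r.
by rewrite sumr_const card_ord normr1.
Qed.

Definition pois_pair (R : realType) (l m : R) (x : nat * nat) : R := pois l x.1 * pois m x.2.

Lemma pois_pair_sum (R : realType) (l m : R) B (f : nat -> nat -> R) :
  \sum_(x : 'I_B * 'I_B) pois_pair l m (val x.1, val x.2) * f x.1 x.2 = pois_sum2 l m B f.
Proof. by rewrite /pois_sum2 pair_bigA. Qed.

Lemma pois_pair_mass (R : realType) (l m : R) B :
  \sum_(x : 'I_B * 'I_B) pois_pair l m (val x.1, val x.2) = pois_mass l B * pois_mass m B.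
Proof.
transitivity (pois_sum2 l m B (fun _ _ => 1 * 1)).
  by rewrite -pois_pair_sum; apply: eq_bigr => x _; rewrite !mulr1.
rewrite (pois_sum2_prod _ _ _ (fun _ => 1) (fun _ => 1)).
by rewrite /pois_mass; congr (_ * _); apply: eq_bigr => x _; rewrite mulr1.
Qed.

(** Each estimator is centred at its limit mean c i. The variances add up, the biases are summed
    before squaring and so cost a factor S, and separating the two parts costs the factors 2. The
    slack eta absorbs the truncation. *)
Lemma bias_variance_sum (R : realType) (S : nat) (l m d V Bb : 'I_S -> R)
    (f : 'I_S -> nat -> nat -> R) (eta : R) :
  (forall i, 0 <= l i) -> (forall i, 0 <= m i) ->
  (forall i, bias_variance (l i) (m i) (f i) (d i) (V i) (Bb i)) -> 0 < eta ->
  \forall B \near \oo,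
    \sum_(y : {ffun 'I_S -> 'I_B * 'I_B})
      (\prod_i pois_pair (l i) (m i) (val (y i).1, val (y i).2)) *
      (\sum_i (f i (y i).1 (y i).2 - d i)) ^+ 2 <=
    2 * (\sum_i V i) + 2 * (S%:R * \sum_i Bb i) + eta.
Proof.
move=> l0 m0 /choice[c hc] eta0.
pose E i B (g : nat -> nat -> R) := pois_sum2 (l i) (m i) B g.
(* The diagonal term is E f^2 - 2 c E f + c^2 times the mass, with E f^2 <= V + c^2. It tends to V
   because E f tends to c. *)
pose T B := \sum_i ((V i + 2 * c i ^+ 2 - 2 * c i * E i B (f i)) +
  \sum_(k | k != i) `|E i B (f i) - c i * (pois_mass (l i) B * pois_mass (m i) B)| *
                    `|E k B (f k) - c k * (pois_mass (l k) B * pois_mass (m k) B)|).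
have cT : T @ \oo --> \sum_i V i.
  have cE i : E i ^~ (f i) @ \oo --> c i by have [] := hc i.
  have cY i : `|E i B (f i) - c i * (pois_mass (l i) B * pois_mass (m i) B)|
      @[B --> \oo] --> (0 : R).
    have h : c i * (pois_mass (l i) B * pois_mass (m i) B) @[B --> \oo] --> c i * (1 * 1).
      by apply: cvgMr; apply: cvgM; exact: pois_mass_cvg.
    have := cvg_norm (cvgB (cE i) h).
    rewrite !mulr1 subrr normr0. move=> h1; exact: h1.
  rewrite (_ : \sum_i V i = \sum_i ((V i + 2 * c i ^+ 2 - 2 * c i * c i) +
      \sum_(k < S | k != i) 0 * 0)); last first.
    apply: eq_bigr => i _; rewrite big1 ?addr0 => [|k _]; last by rewrite mulr0.
    by rewrite expr2 mulrA addrK.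
  apply: cvg_big => [|i _]; first exact: add_continuous.
  apply: cvgD.
    by apply: cvgB; [exact: cvg_cst|apply: cvgMr; exact: cE].
  by apply: cvg_big => [|k _]; [exact: add_continuous|apply: cvgM; exact: cY].
have : \forall B \near \oo, T B <= \sum_i V i + eta / 2.
  apply: (cvgr_le (\sum_i V i)) => //.
  by rewrite ltrDl divr_gt0.
apply: filterS => B hT /=.
pose a i (x : 'I_B * 'I_B) := pois_pair (l i) (m i) (val x.1, val x.2).
have a0 i x : 0 <= a i x by rewrite mulr_ge0 ?pois_ge0.
have a1 i : \sum_x a i x <= 1.
  by rewrite pois_pair_mass mulr_ile1 ?pois_mass_ge0 ?pois_mass_le1.
pose y i (x : 'I_B * 'I_B) := f i x.1 x.2 - c i.
have bias : (\sum_i (c i - d i)) ^+ 2 <= S%:R * \sum_i Bb i.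
  apply: le_trans (sqr_sum_le _) _; rewrite ler_wpM2l//; apply: ler_sum => i _.
  by have [] := hc i.
have split2 (z : {ffun 'I_S -> 'I_B * 'I_B}) :
    (\sum_i (f i (z i).1 (z i).2 - d i)) ^+ 2 <=
    2 * (\sum_i y i (z i)) ^+ 2 + 2 * (\sum_i (c i - d i)) ^+ 2.
  have -> : \sum_i (f i (z i).1 (z i).2 - d i) = \sum_i y i (z i) + \sum_i (c i - d i).
    by rewrite -big_split; apply: eq_bigr => i _; rewrite /y /= addrA subrK.
  set s := \sum_i y i _; set t := \sum_i _; have := sqr_ge0 (s - t); rewrite !expr2; lra.
have P0 (z : {ffun 'I_S -> 'I_B * 'I_B}) : 0 <= \prod_i a i (z i) by exact: prodr_ge0.
apply: (@le_trans _ _ (2 * (\sum_(z : {ffun 'I_S -> 'I_B * 'I_B}) (\prod_i a i (z i)) * (\sum_i y i (z i)) ^+ 2) +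
   2 * (\sum_i (c i - d i)) ^+ 2)).
  apply: (@le_trans _ _ (\sum_(z : {ffun 'I_S -> 'I_B * 'I_B}) (\prod_i a i (z i)) *
    (2 * (\sum_i y i (z i)) ^+ 2 + 2 * (\sum_i (c i - d i)) ^+ 2))).
    by apply: ler_sum => z _; exact: ler_wpM2l (P0 z) _ _ (split2 z).
  under eq_bigr do rewrite mulrDr mulrCA.
  rewrite big_split/= -mulr_sumr lerD2l -mulr_suml sum_ffun_weight1.
  apply: ler_piMl; first by rewrite mulr_ge0 ?sqr_ge0.
  by apply: prodr_ile1 => i _; rewrite a1 sumr_ge0.
have main : \sum_(z : {ffun 'I_S -> 'I_B * 'I_B}) (\prod_i a i (z i)) * (\sum_i y i (z i)) ^+ 2 <= T B.
  apply: le_trans (sum_ffun_sqr_le _ a0 a1) _; apply: ler_sum => i _.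
  have mE k : \sum_j a k j * y k j =
      E k B (f k) - c k * (pois_mass (l k) B * pois_mass (m k) B).
    rewrite /E -pois_pair_mass -pois_pair_sum mulr_sumr -sumrB; apply: eq_bigr => x _.
    by rewrite /a /y; ring.
  apply: lerD; last by apply: ler_sum => k _; rewrite !mE.
  have -> : \sum_j a i j * y i j ^+ 2 = E i B (fun s t => f i s t ^+ 2) -
      2 * c i * E i B (f i) + c i ^+ 2 * (\sum_j a i j).
    rewrite /E -!pois_pair_sum !mulr_sumr -sumrB -big_split/=; apply: eq_bigr => x _.
    by rewrite /a /y; ring.
  have [_ h2 _] := hc i; have := h2 B; rewrite -/(E i B _).
  have : c i ^+ 2 * (\sum_j a i j) <= c i ^+ 2 by rewrite ler_piMr ?sqr_ge0.
  by lra.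
lra.
Qed.

(** * The estimator of one symbol, given a good first batch *)

Lemma bias_varianceW (R : realType) (l m : R) f (d V Bb V' Bb' : R) :
  V <= V' -> Bb <= Bb' -> bias_variance l m f d V Bb -> bias_variance l m f d V' Bb'.
Proof.
move=> VV BB [c [h1 h2 h3]]; exists c; split => //; last exact: le_trans BB.
by move=> B; apply: le_trans (h2 B) _; rewrite lerD2r.
Qed.

Lemma ln_nat_ge (R : realType) (n : nat) : (2 <= n)%N -> 1 <= 2 * ln n%:R :> R.
Proof.
move=> n2; have h : 2^-1 <= ln 2 :> R.
  rewrite -ler_expR lnK ?posrE// -[leRHS]invrK -[leLHS]invrK lef_pV2 ?posrE ?invr_gt0 ?expR_gt0//.
  by rewrite -expRN; apply: le_trans (expR_ge1Dx _); lra.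
have : ln 2 <= ln n%:R :> R by rewrite ler_ln ?posrE ?ltr0n ?ler_nat// (leq_trans _ n2).
lra.
Qed.

(** The bounds of all branches are added up, so that one expression holds in every branch. It does
    not depend on the first batch and is affine in (p, q), hence easy to sum over symbols. *)
Lemma delta_bias_variance (R : realType) (n K : nat) (eps eta p q : R)
    (u v : {poly {poly R}}) (r : {poly R}) (a1 b1 : nat) :
  (2 <= n)%N -> 0 <= eps -> 0 <= p -> 0 <= q -> K%:R <= ln n%:R :> R ->
  degree_le2 K u -> degree_le2 K v -> (size r <= K.+1)%N ->
  (forall x y, 0 <= x <= 1 -> 0 <= y <= 1 ->
     `|Num.sqrt x + Num.sqrt y - u.[x, y]| <= eta) ->
  (forall x y, 0 <= x <= 1 -> 0 <= y <= 1 ->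
     `|Num.max (Num.sqrt x - Num.sqrt y) 0 - v.[x, y]| <= eta) ->
  (forall t, -1 <= t <= 1 -> `| `|t| - r.[t] | <= eta) ->
  (Num.sqrt (a1%:R / n%:R) - Num.sqrt p) ^+ 2 <= 2 * ln n%:R / n%:R ->
  (Num.sqrt (b1%:R / n%:R) - Num.sqrt q) ^+ 2 <= 2 * ln n%:R / n%:R ->
  let e := expR eps in let s2 := 8 * e * (ln n%:R / n%:R) in
  bias_variance (n%:R * p) (n%:R * q)
    (fun a b => delta n K eps (128 * e) (72 * e) u v r (a1%:R / n%:R) (b1%:R / n%:R)
                  (a%:R / n%:R) (b%:R / n%:R))
    (Num.max (p - e * q) 0)
    ((p + e ^+ 2 * q) / n%:R +
     coef_norm (coef_norm Num.norm) (h2K u v) ^+ 2 * ((32 * s2) ^+ 2 * 16 ^+ K) +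
     512 * s2 * (p + e * q) * (2 ^+ K * (coef_norm Num.norm r ^+ 2 + 1)))
    (1024 * s2 * eta ^+ 2 * (p + e * q) + 8192 * s2 ^+ 2 * eta ^+ 4).
Proof.
move=> n2 eps0 p0 q0 Kn du dv sr hu hv hr good1 good2 e s2.
have n0 : (0 < n)%N by rewrite (leq_trans _ n2).
have N0 : 0 < n%:R :> R by rewrite ltr0n.
have e1 : 1 <= e by rewrite /e -expR0 ler_expR.
have e0 : 0 < e by lra.
set L := ln n%:R / n%:R in s2 *.
have l2 := ln_nat_ge R n2.
have L0 : 0 < L by rewrite divr_gt0//; lra.
have nL : ln n%:R = n%:R * L by rewrite /L mulrC divfK// lt0r_neq0.
have s20 : 0 < s2 by apply: mulr_gt0 L0; rewrite mulr_gt0.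
set V1 := (p + e ^+ 2 * q) / n%:R.
set V2 := _ * ((32 * s2) ^+ 2 * 16 ^+ K).
set V3 := 512 * s2 * (p + e * q) * _.
have eq0 : 0 <= e * q by rewrite mulr_ge0// ltW.
have V10 : 0 <= V1 by rewrite divr_ge0// addr_ge0// mulr_ge0// sqr_ge0.
have V20 : 0 <= V2 by rewrite mulr_ge0 ?sqr_ge0// mulr_ge0 ?sqr_ge0// exprn_ge0.
have R0 : 0 <= 2 ^+ K * (coef_norm Num.norm r ^+ 2 + 1).
  by rewrite mulr_ge0 ?exprn_ge0// addr_ge0 ?sqr_ge0.
have pq0 : 0 <= p + e * q by rewrite addr_ge0.
have V30 : 0 <= V3.
  by apply: mulr_ge0 R0; apply: mulr_ge0 pq0; apply: mulr_ge0 (ltW s20); exact: ler0n.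
have B10 : 0 <= 1024 * s2 * eta ^+ 2 * (p + e * q).
  by apply: mulr_ge0 pq0; apply: mulr_ge0 (sqr_ge0 _); apply: mulr_ge0 (ltW s20); exact: ler0n.
have eta4 : 0 <= eta ^+ 4 by rewrite (exprM _ 2 2) sqr_ge0.
have B20 : 0 <= 8192 * s2 ^+ 2 * eta ^+ 4.
  by apply: mulr_ge0 eta4; apply: mulr_ge0 (sqr_ge0 _); exact: ler0n.
pose sg := Num.sqrt s2.
have sg0 : 0 < sg by rewrite sqrtr_gt0.
have sg2 : sg ^+ 2 = s2 by rewrite sqr_sqrtr// ltW.
set ph := a1%:R / n%:R in good1 *; set qh := b1%:R / n%:R in good2 *.
have ph0 : 0 <= ph by rewrite divr_ge0.
have qh0 : 0 <= qh by rewrite divr_ge0.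
have eqh0 : 0 <= e * qh by rewrite mulr_ge0// ltW.
pose x := Num.sqrt ph; pose y := Num.sqrt (e * qh).
pose rr := Num.sqrt p; pose ss := Num.sqrt (e * q).
have [x0 y0 rr0 ss0] : [/\ 0 <= x, 0 <= y, 0 <= rr & 0 <= ss] by split; exact: sqrtr_ge0.
have x2 : x ^+ 2 = ph by exact: sqr_sqrtr.
have y2 : y ^+ 2 = e * qh by exact: sqr_sqrtr.
have r2 : rr ^+ 2 = p by exact: sqr_sqrtr.
have ss2 : ss ^+ 2 = e * q by exact: sqr_sqrtr.
(* The squared deviations are at most 2 L and 2 e L, so the square of their sum is at most 4 L + 4 e
   L <= 8 e L, using e >= 1. *)
have close : `|x - rr| + `|y - ss| <= sg.
  have h1 : `|x - rr| ^+ 2 <= 2 * L.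
    rewrite real_normK ?num_real// /L mulrA; exact: good1.
  have h2 : `|y - ss| ^+ 2 <= e * (2 * L).
    rewrite real_normK ?num_real// /y /ss (sqrtrM qh (ltW e0)) (sqrtrM q (ltW e0)).
    rewrite -mulrBr exprMn (sqr_sqrtr (ltW e0)).
    by apply: (ler_wpM2l (ltW e0)); rewrite /L mulrA; exact: good2.
  rewrite -(@ler_pXn2r _ 2) ?nnegrE ?addr_ge0 ?(ltW sg0)// sg2 /s2.
  have h3 : L <= e * L by rewrite ler_peMl// ltW.
  have := sqr_ge0 (`|x - rr| - `|y - ss|); move: h1 h2 h3; rewrite !expr2; clear; lra.
have TiE : Num.sqrt ((128 * e + 72 * e) * ln n%:R / n%:R) * (Num.sqrt ph + Num.sqrt (e * qh))
    = 5 * sg * (x + y).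
  congr (_ * _); have -> : (128 * e + 72 * e) * ln n%:R / n%:R = 5 ^+ 2 * s2.
    by rewrite -[_ * ln _ / _]mulrA -/L /s2; ring.
  by rewrite sqrtrM ?sqr_ge0// sqrtr_sqr ger0_norm.
have c1E : 128 * e * ln n%:R / n%:R = 16 * sg ^+ 2.
  by rewrite sg2 -[_ * ln _ / _]mulrA -/L /s2; ring.
have KL : K%:R / n%:R <= L by rewrite ler_pM2r ?invr_gt0.
have s2L : 8 * L <= s2.
  by rewrite /s2 -mulrA ler_wpM2l// ler_peMl// ltW.
pose D (a b : nat) : R :=
    if x ^+ 2 - y ^+ 2 < - (5 * sg * (x + y)) then 0
    else if 5 * sg * (x + y) < x ^+ 2 - y ^+ 2 then a%:R / n%:R - e * (b%:R / n%:R)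
    else if x ^+ 2 + y ^+ 2 < 16 * sg ^+ 2 then
      D1tilde n K eps (128 * e) u v (a%:R / n%:R) (b%:R / n%:R)
    else D2tilde n K eps (128 * e) r (a%:R / n%:R) (b%:R / n%:R) ph qh.
rewrite [X in bias_variance _ _ X](_ : _ = D); last first.
  by apply/funext => a; apply/funext => b; rewrite /delta -/e TiE c1E /D x2 y2.
rewrite /D {D}.
case: ltP => [negc|nneg].
  have := regime_neg x0 y0 rr0 ss0 close negc; rewrite r2 ss2 => pq.
  rewrite max_r ?subr_le0//; apply: bias_varianceW (bias_variance_zero _ _).
    by rewrite !addr_ge0.
  by rewrite addr_ge0.
case: ltP => [posc|npos].
  have := regime_pos x0 y0 rr0 ss0 close posc; rewrite r2 ss2 => pq.
  rewrite max_l ?subr_ge0//; apply: bias_varianceW (bias_variance_linear e n0 p0 q0).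
    by rewrite -addrA lerDl addr_ge0.
  by rewrite addr_ge0.
case: ltP => [small|large].
  have := regime_small x0 y0 rr0 ss0 close small; rewrite r2 ss2 sg2 => -[pD qD].
  have K2 : (2 * K)%:R / n%:R <= 2 * L by rewrite natrM -mulrA ler_wpM2l.
  apply: bias_varianceW (@bias_variance_D1tilde R n K eps (128 * e) eta p q (32 * s2) u v
    n0 p0 q0 _ _ pD qD _ _ du dv hu hv).
  - by rewrite -addrA addrCA lerDl addr_ge0.
  - rewrite exprMn; have : 0 <= s2 * (p + e * q) * eta ^+ 2.
      by rewrite mulr_ge0 ?sqr_ge0// mulr_ge0// ltW.
    rewrite -/e; clear; lra.
  - by rewrite -[_ * ln _ / _]mulrA -/L /s2; ring.
  - by rewrite mulr_gt0.
  - by apply: le_trans K2 _; move: s2L L0; clear; lra.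
  - rewrite -/e; apply: (@le_trans _ _ (e * (2 * L))); first by rewrite ler_wpM2l// ltW.
    have : 0 <= e * L by rewrite mulr_ge0// ltW.
    by rewrite /s2; clear; lra.
have absc : `|x ^+ 2 - y ^+ 2| <= 5 * sg * (x + y) by rewrite ler_norml nneg npos.
have [c1 c2 c3] := regime_close x0 y0 rr0 ss0 sg0 close absc large.
rewrite x2 y2 r2 ss2 sg2 in c1 c2 c3.
pose W := Num.sqrt (8 * (128 * e) * ln n%:R / n%:R) * Num.sqrt (ph + e * qh).
have pos1 : 0 < ph + e * qh.
  by rewrite -x2 -y2; apply: lt_le_trans large; rewrite mulr_gt0// exprn_gt0.
have A0 : 0 < 8 * (128 * e) * ln n%:R / n%:R.
  by rewrite -[_ * ln _ / _]mulrA -/L; apply: mulr_gt0 L0; rewrite mulr_gt0// mulr_gt0.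
have W0 : 0 < W by rewrite mulr_gt0 ?sqrtr_gt0.
have W2 : W ^+ 2 = 128 * s2 * (ph + e * qh).
  rewrite exprMn !sqr_sqrtr ?(ltW A0) ?(ltW pos1)//; congr (_ * _).
  by rewrite -[_ * ln _ / _]mulrA -/L /s2; ring.
have Wle : W ^+ 2 <= 512 * s2 * (p + e * q).
  rewrite W2 (_ : 512 = 128 * 4); last by ring.
  move: (ler_wpM2l (ltW s20) c2); clear; lra.
apply: bias_varianceW (@bias_variance_D2tilde R n K eps (128 * e) eta p q ph qh W r
    n0 p0 q0 (erefl _) W0 _ _ sr hr).
- rewrite -addrA -[leLHS]add0r -/e; apply: lerD => //; rewrite -[leLHS]add0r.
  by apply: lerD => //; rewrite -[leLHS]mulrA; apply: ler_wpM2r.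
- rewrite -/e; apply: (@le_trans _ _ (1024 * s2 * eta ^+ 2 * (p + e * q))); last by rewrite lerDl.
  rewrite [leRHS]mulrAC; apply: ler_wpM2r (sqr_ge0 _) _ _ _; apply: (le_trans Wle).
  by apply: ler_wpM2r; [rewrite addr_ge0// mulr_ge0// ltW|apply: (ler_wpM2r (ltW s20)); rewrite ler_nat].
- rewrite -(@ler_pXn2r _ 2) ?nnegrE ?(ltW W0)// real_normK ?num_real// -sqrrN opprB W2.
  exact: c1.
- rewrite -/e W2.
  (* The noise condition on W: the variance is within a factor 4 e of the observed p + e q over n,
     and K + 1 <= 3 ln n, which gives 12 e L against the 1024 e L of W^2. *)
  have h1 : p + e ^+ 2 * q <= e * (p + e * q).
    rewrite mulrDr expr2 mulrA lerD2r; exact: ler_peMl.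
  have h2 : K.+1%:R / n%:R <= 3 * L.
    rewrite -natr1 /L ler_pdivrMr// -mulrA divfK ?lt0r_neq0//; move: Kn (ln_nat_ge R n2); clear; lra.
  rewrite mulrA mulrAC; apply: (@le_trans _ _ (3 * L * (e * (4 * (ph + e * qh))))).
    apply: ler_pM; [by rewrite divr_ge0|by rewrite addr_ge0// mulr_ge0// sqr_ge0|by []|].
    by apply: le_trans h1 _; rewrite ler_wpM2l// ltW.
  have := mulr_ge0 (mulr_ge0 (ltW L0) (ltW e0)) (ltW pos1).
  by rewrite /s2; clear; lra.
Qed.

(** * Clipping, and averaging over the first batch *)

Lemma clip_contract (R : realType) (s D : R) : 0 <= D <= 1 ->
  `|Num.max 0 (Num.min 1 s) - D| ^+ 2 <= (s - D) ^+ 2 /\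
  0 <= `|Num.max 0 (Num.min 1 s) - D| ^+ 2 <= 1.
Proof.
move=> /andP[D0 D1]; rewrite real_normK ?num_real// sqr_ge0/=.
have [s1|s1] := leP 1 s.
  rewrite max_r ?ler01//; split.
    rewrite lerXn2r ?nnegrE ?subr_ge0//; first exact: le_trans s1.
    by rewrite lerD2r.
  by rewrite expr_le1// ?subr_ge0// lerBlDr lerDl.
have [s0|s0] := leP 0 s.
  by split=> //; rewrite -[_ ^+ 2]real_normK ?num_real// expr_le1// ler_norml; apply/andP; split; lra.
rewrite sub0r sqrrN; split; last by rewrite expr_le1.
have -> : (s - D) ^+ 2 = (D - s) ^+ 2 by rewrite -sqrrN opprB.
by rewrite lerXn2r ?nnegrE//; lra.
Qed.

Definition box_pmf (R : realType) (S B : nat) (l m : 'I_S -> R)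
    (y : {ffun 'I_S -> 'I_B * 'I_B}) : R :=
  \prod_i pois_pair (l i) (m i) (val (y i).1, val (y i).2).

Lemma box_pmf_ge0 (R : realType) (S B : nat) (l m : 'I_S -> R)
    (y : {ffun 'I_S -> 'I_B * 'I_B}) :
  (forall i, 0 <= l i) -> (forall i, 0 <= m i) -> 0 <= box_pmf l m y.
Proof. by move=> l0 m0; apply: prodr_ge0 => i _; rewrite mulr_ge0 ?pois_ge0. Qed.

Lemma box_pmf_sum_le1 (R : realType) (S B : nat) (l m : 'I_S -> R) :
  (forall i, 0 <= l i) -> (forall i, 0 <= m i) ->
  \sum_(y : {ffun 'I_S -> 'I_B * 'I_B}) box_pmf l m y <= 1.
Proof.
move=> l0 m0; rewrite (sum_ffun_weight1 (fun i (x : 'I_B * 'I_B) =>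
  pois_pair (l i) (m i) (val x.1, val x.2))).
apply: prodr_ile1 => i _; rewrite pois_pair_mass mulr_ge0 ?pois_mass_ge0//=.
by rewrite mulr_ile1 ?pois_mass_ge0 ?pois_mass_le1.
Qed.

Lemma box_pmf_sum_cvg (R : realType) (S : nat) (l m : 'I_S -> R) :
  (fun B => \sum_(y : {ffun 'I_S -> 'I_B * 'I_B}) box_pmf l m y) @ \oo --> (1 : R).
Proof.
have -> : (fun B => \sum_(y : {ffun 'I_S -> 'I_B * 'I_B}) box_pmf l m y) =
    (fun B => \prod_i (pois_mass (l i) B * pois_mass (m i) B)).
  apply/funext => B; rewrite (sum_ffun_weight1 (fun i (x : 'I_B * 'I_B) =>
    pois_pair (l i) (m i) (val x.1, val x.2))).
  by apply: eq_bigr => i _; rewrite pois_pair_mass.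
have h : \prod_i (pois_mass (l i) B * pois_mass (m i) B) @[B --> \oo] -->
    (\prod_(i < S) (1 * 1) : R).
  apply: cvg_big => [|i _]; first exact: mul_continuous.
  by apply: cvgM; exact: pois_mass_cvg.
by move: h; rewrite mulr1 big1.
Qed.

(** A union bound over the S symbols and the two distributions; the remaining truncated masses are
    at most 1. *)
Lemma box_pmf_bad_le (R : realType) (S B n : nat) (p q : 'I_S -> R)
    (bad : R -> nat -> bool) (t : R) :
  (forall i, 0 <= p i) -> (forall i, 0 <= q i) ->
  (forall p B, 0 <= p -> \sum_(a < B | bad p a) pois (n%:R * p) a <= t) ->
  \sum_(y : {ffun 'I_S -> 'I_B * 'I_B} |
      [exists i, bad (p i) (y i).1 || bad (q i) (y i).2])
    box_pmf (fun i => n%:R * p i) (fun i => n%:R * q i) y <= S%:R * (2 * t).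
Proof.
move=> p0 q0 ht.
have np0 i : 0 <= n%:R * p i by rewrite mulr_ge0.
have nq0 i : 0 <= n%:R * q i by rewrite mulr_ge0.
pose a i (x : 'I_B * 'I_B) := pois_pair (n%:R * p i) (n%:R * q i) (val x.1, val x.2).
have a0 i x : 0 <= a i x by rewrite mulr_ge0 ?pois_ge0.
have a1 i : \sum_x a i x <= 1.
  by rewrite pois_pair_mass mulr_ile1 ?pois_mass_ge0 ?pois_mass_le1.
pose g i (x : 'I_B * 'I_B) : R := (bad (p i) x.1)%:R + (bad (q i) x.2)%:R.
have g0 i x : 0 <= g i x by rewrite addr_ge0.
have P0 (y : {ffun 'I_S -> 'I_B * 'I_B}) : 0 <= \prod_i a i (y i) by exact: prodr_ge0.
apply: (@le_trans _ _ (\sum_(y : {ffun 'I_S -> 'I_B * 'I_B})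
    \sum_i (\prod_i a i (y i)) * g i (y i))).
  rewrite big_mkcond; apply: ler_sum => y _; rewrite -mulr_sumr.
  case: ifP => [/existsP[i hi]|_]; last by rewrite mulr_ge0// sumr_ge0.
  rewrite -[leLHS]mulr1; apply: (ler_wpM2l (P0 y)).
  rewrite (bigD1 i)//= -[leLHS]addr0 lerD ?sumr_ge0// /g.
  by case/orP: hi => ->; rewrite ?lerDl ?lerDr.
rewrite exchange_big/= mulr_natl -[X in _ *+ X]card_ord -sumr_const.
apply: ler_sum => i _.
apply: le_trans (sum_ffun_marginal i a0 a1 (g0 i)) _.
have -> : \sum_j a i j * g i j =
    (\sum_(b < B | bad (p i) b) pois (n%:R * p i) b) * pois_mass (n%:R * q i) B +
    pois_mass (n%:R * p i) B * (\sum_(b < B | bad (q i) b) pois (n%:R * q i) b).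
  rewrite [X in X * _ + _]big_mkcond [X in _ + _ * X]big_mkcond/=.
  rewrite -(pair_bigA _ (fun s t => a i (s, t) * g i (s, t)))/= !mulr_suml -big_split/=.
  apply: eq_bigr => s _; rewrite !mulr_sumr -big_split/=; apply: eq_bigr => z _.
  by rewrite /a /g /pois_pair/=; case: (bad (p i) s); case: (bad (q i) z); rewrite /=; ring.
have s0 (P : pred 'I_B) (z : R) : 0 <= z -> 0 <= \sum_(b < B | P b) pois z b.
  by move=> z0; apply: sumr_ge0 => b _; exact: pois_ge0.
rewrite [leRHS]mulr_natl mulr2n; apply: lerD.
  by apply: le_trans (ht _ B (p0 i)); rewrite ler_piMr ?s0 ?pois_mass_le1.
by apply: le_trans (ht _ B (q0 i)); rewrite ler_piMl ?s0 ?pois_mass_le1.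
Qed.

(** A bad first batch costs at most 1 times its probability, thanks to clipping. On a good one,
    clipping only brings the sum closer to the target, and the bias-variance bound applies with the
    first batch frozen. *)
Lemma clipped_risk_le (R : realType) (S n : nat) (p q : 'I_S -> R)
    (del : R -> R -> R -> R -> R) (bad : R -> nat -> bool) (t : R) (D V Bb : 'I_S -> R)
    (d : measure_display) (T : measurableType d) (Pr : probability T R)
    (N : bool -> 'I_2 -> {RV Pr >-> nat}) (X : bool -> 'I_2 -> nat -> T -> 'I_S) :
  (0 < n)%N -> is_pmf p -> is_pmf q -> poissonized_sampling n p q N X ->
  0 <= \sum_i D i <= 1 -> (forall i, 0 <= V i) -> (forall i, 0 <= Bb i) ->
  (forall p B, 0 <= p -> \sum_(a < B | bad p a) pois (n%:R * p) a <= t) ->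
  (forall i a1 b1, ~~ bad (p i) a1 -> ~~ bad (q i) b1 ->
    bias_variance (n%:R * p i) (n%:R * q i)
      (fun a b => del (a1%:R / n%:R) (b1%:R / n%:R) (a%:R / n%:R) (b%:R / n%:R))
      (D i) (V i) (Bb i)) ->
  ('E_Pr[fun w => (`|Num.max 0 (Num.min 1 (\sum_i
        del (frequency R n (N true 0) (X true 0) i w)
            (frequency R n (N false 0) (X false 0) i w)
            (frequency R n (N true 1) (X true 1) i w)
            (frequency R n (N false 1) (X false 1) i w))) -
      \sum_i D i| ^+ 2)%R] <=
   (Num.min 1 (S%:R * (2 * t) + (2 * (\sum_i V i) + 2 * (S%:R * \sum_i Bb i))))%:E)%E.
Proof.
move=> n0 hp hq sampling hD V0 Bb0 ht hbv.
have [[p0 _] [q0 _]] := (hp, hq).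
pose Q := 2 * (\sum_i V i) + 2 * (S%:R * \sum_i Bb i).
have Q0 : 0 <= Q by rewrite addr_ge0 ?mulr_ge0 ?sumr_ge0.
pose est (f : bool -> 'I_2 -> 'I_S -> R) : R := Num.max 0 (Num.min 1 (\sum_i
  del (f true 0 i) (f false 0 i) (f true 1 i) (f false 1 i))).
pose G (m : {ffun bool * 'I_2 * 'I_S -> nat}) : R :=
  `|est (fun b j i => (m (b, j, i))%:R / n%:R) - \sum_i D i| ^+ 2.
have G01 m : 0 <= G m <= 1 by exact: (clip_contract _ hD).2.
have -> : (fun w => `|Num.max 0 (Num.min 1 (\sum_i
        del (frequency R n (N true 0) (X true 0) i w)
            (frequency R n (N false 0) (X false 0) i w)
            (frequency R n (N true 1) (X true 1) i w)
            (frequency R n (N false 1) (X false 1) i w))) -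
      \sum_i D i| ^+ 2) = (fun w => G [ffun t => symbol_count N X t w]).
  apply/funext => w; rewrite /G /est; congr (`|Num.max 0 (Num.min 1 _) - _| ^+ 2).
  by apply: eq_bigr => i _; rewrite !frequencyE !ffunE.
pose pmf (m : {ffun bool * 'I_2 * 'I_S -> nat}) :=
  \prod_t pois (n%:R * (if t.1.1 then p else q) t.2) (m t).
have law m := symbol_count_law m n0 hp hq sampling.
rewrite -/Q; have [_|_] := leP 1 (S%:R * (2 * t) + Q).
  (* The empty box yields the trivial bound 1. *)
  have emp : injective (fun i : 'I_0 => [ffun _ : bool * 'I_2 * 'I_S => nat_of_ord i]).
    by case.
  have := expectation_le_box emp (fun m => (law m).1) (fun m => (law m).2) G01.
  by rewrite !big_ord0 add0r subr0.
apply/lee_addgt0Pr => eta eta0; rewrite -EFinD.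
pose l i := n%:R * p i; pose k i := n%:R * q i.
have l0 i : 0 <= l i by rewrite mulr_ge0.
have k0 i : 0 <= k i by rewrite mulr_ge0.
pose W B (y : {ffun 'I_S -> 'I_B * 'I_B}) := box_pmf l k y.
have W0 B (y : {ffun 'I_S -> 'I_B * 'I_B}) : 0 <= W B y by exact: box_pmf_ge0.
(* One third for the truncated inner risk, and one for the mass missing from each of the two
   boxes. *)
have e3 : 0 < eta / 3 by rewrite divr_gt0.
have near1 : \forall B \near \oo, 1 - eta / 3 <=
    \sum_(y : {ffun 'I_S -> 'I_B * 'I_B}) W B y.
  apply: (cvgr_ge (1 : R)); first exact: box_pmf_sum_cvg.
  by rewrite gtrBl.
have [B1 mass1] := filter_ex near1.
pose isbad (y : {ffun 'I_S -> 'I_B1 * 'I_B1}) :=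
  [exists i, bad (p i) (y i).1 || bad (q i) (y i).2].
pose H B (y : {ffun 'I_S -> 'I_B1 * 'I_B1}) (z : {ffun 'I_S -> 'I_B * 'I_B}) : R :=
  (\sum_i (del ((y i).1%:R / n%:R) ((y i).2%:R / n%:R)
               ((z i).1%:R / n%:R) ((z i).2%:R / n%:R) - D i)) ^+ 2.
(* The second box is chosen after the first: the inner limits need not be uniform in the first
   batch, but only finitely many of its values remain. *)
have near2 : \forall B \near \oo, forall y, ~~ isbad y ->
    \sum_(z : {ffun 'I_S -> 'I_B * 'I_B}) W B z * H B y z <= Q + eta / 3.
  apply: filter_forall => y.
  have [bady|goody] := boolP (isbad y); first by apply: nearW => B; move=> /negP.
  have bv i : bias_variance (l i) (k i)
      (fun a b => del ((y i).1%:R / n%:R) ((y i).2%:R / n%:R) (a%:R / n%:R) (b%:R / n%:R))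
      (D i) (V i) (Bb i).
    by apply: hbv; move: goody; rewrite negb_exists => /forallP/(_ i); rewrite negb_or => /andP[].
  have := bias_variance_sum l0 k0 bv e3.
  by apply: filterS => B hB _; exact: hB.
have [B2 [mass2 inner]] := filter_ex (filterI near1 near2).
pose e (yz : {ffun 'I_S -> 'I_B1 * 'I_B1} * {ffun 'I_S -> 'I_B2 * 'I_B2}) :
    {ffun bool * 'I_2 * 'I_S -> nat} :=
  [ffun t => if t.1.2 == 0 then (if t.1.1 then val (yz.1 t.2).1 else val (yz.1 t.2).2)
             else (if t.1.1 then val (yz.2 t.2).1 else val (yz.2 t.2).2)].
have einj : injective e.
  move=> [y z] [y1 z1] /ffunP E.
  have h b j i := E (b, j, i).
  congr (_, _); apply/ffunP => i.
    have := h true 0 i; have := h false 0 i; rewrite !ffunE/=.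
    by case: (y i) (y1 i) => [s t'] [s1 t1] /= /val_inj -> /val_inj ->.
  have := h true 1 i; have := h false 1 i; rewrite !ffunE/=.
  by case: (z i) (z1 i) => [s t'] [s1 t1] /= /val_inj -> /val_inj ->.
have pmfE yz : pmf (e yz) = W B1 yz.1 * W B2 yz.2.
  transitivity (\prod_b \prod_j \prod_i pois (n%:R * (if b then p else q) i) (e yz (b, j, i))).
    by rewrite /pmf pair_bigA/= pair_bigA/=; apply: eq_bigr => -[[b j] i].
  rewrite big_bool/= !big_ord_recl !big_ord0 !mulr1 mulrACA.
  by congr (_ * _); rewrite -big_split/=; apply: eq_bigr => i _; rewrite !ffunE.
have GH y z : G (e (y, z)) <= H B2 y z.
  apply: le_trans (clip_contract _ hD).1 _; rewrite /H sumrB le_eqVlt; apply/orP; left.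
  apply/eqP; congr ((_ - _) ^+ 2); apply: eq_bigr => i _; by rewrite !ffunE.
apply: le_trans (expectation_le_box einj (fun m => (law m).1) (fun m => (law m).2) G01) _.
rewrite lee_fin.
have sumE (g : _ -> _ -> R) : \sum_yz pmf (e yz) * g yz.1 yz.2 =
    \sum_y W B1 y * \sum_z W B2 z * g y z.
  rewrite [RHS](eq_bigr (fun y => \sum_z W B1 y * (W B2 z * g y z))); last first.
    by move=> y _; rewrite mulr_sumr.
  by rewrite pair_bigA/=; apply: eq_bigr => -[y z] _; rewrite pmfE/= mulrA.
have massE : \sum_yz pmf (e yz) = (\sum_y W B1 y) * (\sum_z W B2 z).
  rewrite mulr_suml -[LHS](eq_bigr _ (fun yz _ => mulr1 (pmf (e yz)))) (sumE (fun _ _ => 1)).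
  by apply: eq_bigr => y _; congr (_ * _); apply: eq_bigr => z _; rewrite mulr1.
have m1 := box_pmf_sum_le1 B1 l0 k0; have m2 := box_pmf_sum_le1 B2 l0 k0.
have part1 : \sum_yz pmf (e yz) * G (e yz) <= S%:R * (2 * t) + (Q + eta / 3).
  have -> : \sum_yz pmf (e yz) * G (e yz) = \sum_y W B1 y * \sum_z W B2 z * G (e (y, z)).
    by rewrite -(sumE (fun y z => G (e (y, z)))); apply: eq_bigr => -[].
  rewrite (bigID isbad)/=; apply: lerD.
    apply: le_trans (box_pmf_bad_le B1 p0 q0 ht); apply: ler_sum => y _.
    rewrite -[leRHS]mulr1; apply: (ler_wpM2l (W0 _ y)); apply: le_trans m2.
    apply: ler_sum => z _; rewrite ler_piMr//.
    by have /andP[] := G01 (e (y, z)).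
  apply: (@le_trans _ _ (\sum_(y | ~~ isbad y) W B1 y * (Q + eta / 3))).
    apply: ler_sum => y goody; apply: (ler_wpM2l (W0 _ y)).
    apply: le_trans (inner y goody); apply: ler_sum => z _.
    exact: (ler_wpM2l (W0 _ z)).
  rewrite -mulr_suml ler_piMl//; first by rewrite addr_ge0// ltW.
  apply: le_trans m1; rewrite [leRHS](bigID isbad)/= lerDr; apply: sumr_ge0 => y _; exact: W0.
(* For masses a and b at most 1, 1 - a b <= (1 - a) + (1 - b). *)
have part2 : 1 - \sum_yz pmf (e yz) <= eta / 3 + eta / 3.
  rewrite massE; move: mass1 mass2 m1 m2; rewrite -/W.
  set a := \sum_y _; set b := \sum_z _ => h1 h2 h3 h4.
  have : 0 <= (1 - a) * (1 - b) by rewrite mulr_ge0// subr_ge0.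
  lra.
move: part1 part2; lra.
Qed.

(** * From the explicit risk bound to the rate *)

Lemma expr_le_expR (R : realType) (k : nat) (x : R) : 0 <= x ->
  x ^+ k.+1 <= k.+1%:R ^+ k.+1 * expR x.
Proof.
move=> x0; have -> : x = k.+1%:R * (x / k.+1%:R) by rewrite mulrC divfK// pnatr_eq0.
rewrite exprMn expRM_natl ler_wpM2l ?exprn_ge0// lerXn2r ?nnegrE ?expR_ge0 ?divr_ge0//.
by apply: le_trans (expR_ge1Dx _); rewrite lerDr.
Qed.

(** The condition on c3 keeps g^K below the square roots of both n and S; the other square root
    absorbs the powers of ln n, with 216 = 3^3 2^3 and 16 = 2^2 2^2. The bound by n serves the first
    polynomial, whose total variance has a factor S, and the bound by S serves the second. *)
Lemma power_growth (R : realType) (S n K : nat) (C g c3 : R) :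
  (0 < S)%N -> (2 <= n)%N -> 0 < C -> ln n%:R <= C * ln S%:R -> 1 <= g ->
  K%:R <= c3 * ln n%:R -> c3 * ln g * (1 + C) <= 2^-1 -> 0 <= c3 ->
  ln n%:R ^+ 3 * g ^+ K <= 216 * n%:R /\
  ln n%:R ^+ 2 * g ^+ K <= 16 * C ^+ 2 * S%:R.
Proof.
move=> S0 n2 C0 hC g1 hK hc c30.
have n0 : 0 < n%:R :> R by rewrite ltr0n (leq_trans _ n2).
have s0 : 0 < S%:R :> R by rewrite ltr0n.
have y0 : 0 < ln n%:R :> R by have := ln_nat_ge R n2; lra.
have lg0 : 0 <= ln g by rewrite ln_ge0.
(* As n >= 2, the hypothesis ln n <= C ln S excludes S = 1. *)
have z0 : 0 < ln S%:R :> R by rewrite -(pmulr_rgt0 _ C0); exact: lt_le_trans hC.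
have cg0 : 0 <= c3 * ln g by rewrite mulr_ge0.
have cC0 : 0 <= c3 * ln g * C by rewrite mulr_ge0// ltW.
have gE : g ^+ K = expR (K%:R * ln g) by rewrite expRM_natl lnK// posrE; lra.
have hKg : K%:R * ln g <= c3 * ln g * ln n%:R.
  by rewrite [leRHS]mulrAC ler_wpM2r.
split.
  have h1 : K%:R * ln g <= ln n%:R / 2.
    apply: le_trans hKg _; rewrite [leRHS]mulrC ler_wpM2r ?(ltW y0)//; lra.
  apply: (@le_trans _ _ (216 * expR (ln n%:R / 2) * expR (ln n%:R / 2))).
    apply: ler_pM; rewrite ?exprn_ge0 ?(ltW y0)//; first lra.
      have := @expr_le_expR R 2 (ln n%:R / 2) (divr_ge0 (ltW y0) (ler0n _ 2)).
      rewrite expr_div_n ler_pdivrMr ?exprn_gt0// => /le_trans; apply.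
      rewrite le_eqVlt; apply/orP; left; apply/eqP; ring.
    by rewrite gE ler_expR.
  by rewrite -mulrA -expRD -splitr lnK ?posrE.
have h1 : K%:R * ln g <= ln S%:R / 2.
  apply: le_trans hKg _; apply: (@le_trans _ _ (c3 * ln g * (C * ln S%:R))).
    by rewrite ler_wpM2l.
  rewrite mulrA [leRHS]mulrC ler_wpM2r ?(ltW z0)//; lra.
apply: (@le_trans _ _ (16 * C ^+ 2 * expR (ln S%:R / 2) * expR (ln S%:R / 2))).
  apply: ler_pM; rewrite ?exprn_ge0 ?(ltW y0)//; first lra.
    apply: (@le_trans _ _ ((C * ln S%:R) ^+ 2)).
      by rewrite lerXn2r ?nnegrE ?(ltW y0) ?mulr_ge0 ?(ltW C0) ?(ltW z0).
    have := @expr_le_expR R 1 (ln S%:R / 2) (divr_ge0 (ltW z0) (ler0n _ 2)).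
    rewrite expr_div_n ler_pdivrMr ?exprn_gt0// exprMn => h.
    apply: le_trans (ler_wpM2l (sqr_ge0 C) h) _.
    rewrite le_eqVlt; apply/orP; left; apply/eqP; ring.
  by rewrite gE ler_expR.
by rewrite -mulrA -expRD -splitr lnK ?posrE.
Qed.

Lemma coef_norm_h2K_le (R : realType) (K : nat) (b : R) (u v : {poly {poly R}}) :
  degree_le2 K u -> degree_le2 K v ->
  (forall x y, 0 <= x <= 1 -> 0 <= y <= 1 -> `|u.[x, y]| <= b) ->
  (forall x y, 0 <= x <= 1 -> 0 <= y <= 1 -> `|v.[x, y]| <= b) ->
  coef_norm (coef_norm Num.norm) (h2K u v) <= 2 * (b * 128 ^+ K.+1) ^+ 2.
Proof.
move=> du dv hu hv.
have h00 : 0 <= (0 : R) <= 1 by rewrite lexx ler01.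
have b0 : 0 <= b by exact: le_trans (hu _ _ h00 h00).
have nD (p q : {poly R}) : coef_norm Num.norm (p + q) <=
    coef_norm Num.norm p + coef_norm Num.norm q.
  by apply: coef_normD; [exact: normr0|exact: ler_normD].
have nM (p q : {poly R}) : coef_norm Num.norm (p * q) <=
    coef_norm Num.norm p * coef_norm Num.norm q.
  by apply: coef_normM; [exact: normr0|exact: ler_normD|move=> ? ?; rewrite normrM].
have n0 := coef_norm0 (@Num.norm R R).
have ge0 (w : {poly {poly R}}) : 0 <= coef_norm (coef_norm Num.norm) w.
  by apply: coef_norm_ge0 => a; exact: coef_norm_ge0.
apply: le_trans (coef_normD _ _ n0 nD) _; rewrite mulr_natl mulr2n; apply: lerD.
  apply: le_trans (coef_normM _ _ n0 nD nM) _; rewrite expr2.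
  by apply: ler_pM => //; exact: coef_norm2_le.
rewrite -!polyCN (coef_norm_widen n0 (size_polyC_leq1 _)) big_ord1 coefC/=.
rewrite (coef_norm_widen (normr0 _) (size_polyC_leq1 _)) big_ord1 coefC/= normrN normrM.
rewrite expr2; apply: ler_pM => //; [apply: le_trans (hu _ _ h00 h00) _|apply: le_trans (hv _ _ h00 h00) _];
  by rewrite ler_peMr// exprn_ege1// ler1n.
Qed.

Lemma dhat_risk_le (R : realType) (S n K : nat) (eps eta e s2 : R) (p q : 'I_S -> R)
    (u v : {poly {poly R}}) (r : {poly R})
    (d : measure_display) (T : measurableType d) (Pr : probability T R)
    (N : bool -> 'I_2 -> {RV Pr >-> nat}) (X : bool -> 'I_2 -> nat -> T -> 'I_S) :
  (2 <= n)%N -> 0 <= eps -> is_pmf p -> is_pmf q -> poissonized_sampling n p q N X ->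
  K%:R <= ln n%:R :> R -> degree_le2 K u -> degree_le2 K v -> (size r <= K.+1)%N ->
  (forall x y, 0 <= x <= 1 -> 0 <= y <= 1 ->
     `|Num.sqrt x + Num.sqrt y - u.[x, y]| <= eta) ->
  (forall x y, 0 <= x <= 1 -> 0 <= y <= 1 ->
     `|Num.max (Num.sqrt x - Num.sqrt y) 0 - v.[x, y]| <= eta) ->
  (forall t, -1 <= t <= 1 -> `| `|t| - r.[t] | <= eta) ->
  e = expR eps -> s2 = 8 * e * (ln n%:R / n%:R) ->
  ('E_Pr[fun w => (`|dhat_sample n K eps (128 * e) (72 * e) u v r N X w
                     - divergence eps p q| ^+ 2)%R] <=
   (Num.min 1 (S%:R * (2 * (2 / n%:R ^+ 2)) +
     (2 * ((1 + e ^+ 2) / n%:R +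
           S%:R * (coef_norm (coef_norm Num.norm) (h2K u v) ^+ 2 *
                   ((32 * s2) ^+ 2 * 16 ^+ K)) +
           512 * s2 * (1 + e) * (2 ^+ K * (coef_norm Num.norm r ^+ 2 + 1))) +
      2 * (S%:R * (1024 * s2 * eta ^+ 2 * (1 + e) +
                   S%:R * (8192 * s2 ^+ 2 * eta ^+ 4))))))%:E)%E.
Proof.
move=> n2 eps0 hp hq sampling Kn du dv sr hu hv hr eE s2E.
have n0 : (0 < n)%N by rewrite (leq_trans _ n2).
have [[p0 p1] [q0 q1]] := (hp, hq).
have e0 : 0 <= e by rewrite eE expR_ge0.
have s20 : 0 <= s2 by rewrite s2E !mulr_ge0 ?invr_ge0 ?ln_ge0 ?ler1n.
pose H := coef_norm (coef_norm Num.norm) (h2K u v).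
pose rn := coef_norm Num.norm r.
pose V i := (p i + e ^+ 2 * q i) / n%:R + H ^+ 2 * ((32 * s2) ^+ 2 * 16 ^+ K) +
  512 * s2 * (p i + e * q i) * (2 ^+ K * (rn ^+ 2 + 1)).
pose Bb i := 1024 * s2 * eta ^+ 2 * (p i + e * q i) + 8192 * s2 ^+ 2 * eta ^+ 4.
have pq0 i : 0 <= p i + e * q i by rewrite addr_ge0 ?mulr_ge0.
have c0 : 0 <= 512 * s2 by apply: mulr_ge0; [exact: ler0n|exact: s20].
have w0 : 0 <= 2 ^+ K * (rn ^+ 2 + 1) by rewrite mulr_ge0 ?exprn_ge0 ?addr_ge0 ?sqr_ge0.
have V0 i : 0 <= V i.
  apply: addr_ge0; last by apply: mulr_ge0; [exact: mulr_ge0 c0 (pq0 i)|exact: w0].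
  apply: addr_ge0.
    by rewrite divr_ge0// addr_ge0// mulr_ge0// exprn_ge0.
  by rewrite mulr_ge0 ?sqr_ge0// mulr_ge0 ?sqr_ge0// exprn_ge0.
have Bb0 i : 0 <= Bb i.
  apply: addr_ge0; last first.
    by apply: mulr_ge0; [exact: mulr_ge0 (ler0n _ _) (sqr_ge0 _)|rewrite exprn_even_ge0].
  apply: mulr_ge0 (pq0 i); apply: mulr_ge0 (sqr_ge0 _).
  exact: mulr_ge0 (ler0n _ _) s20.
have hD : 0 <= \sum_i Num.max (p i - e * q i) 0 <= 1.
  rewrite sumr_ge0/= -?p1; last by move=> i _; rewrite le_max lexx orbT.
  by apply: ler_sum => i _; rewrite ge_max p0 andbT gerBl mulr_ge0.
have pqE : \sum_i (p i + e * q i) = 1 + e by rewrite big_split/= -mulr_sumr p1 q1 mulr1.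
have pq2E : \sum_i (p i + e ^+ 2 * q i) = 1 + e ^+ 2.
  by rewrite big_split/= -mulr_sumr p1 q1 mulr1.
have cE (x : R) : \sum_(i < S) x = S%:R * x by rewrite sumr_const card_ord mulr_natl.
have VE : \sum_i V i = (1 + e ^+ 2) / n%:R + S%:R * (H ^+ 2 * ((32 * s2) ^+ 2 * 16 ^+ K)) +
    512 * s2 * (1 + e) * (2 ^+ K * (rn ^+ 2 + 1)).
  rewrite big_split/= big_split/= cE -mulr_suml pq2E -mulr_suml -mulr_sumr pqE.
  reflexivity.
have BE : \sum_i Bb i = 1024 * s2 * eta ^+ 2 * (1 + e) + S%:R * (8192 * s2 ^+ 2 * eta ^+ 4).
  by rewrite big_split/= cE -mulr_sumr pqE.
rewrite -VE -BE /divergence -eE.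
apply: (@clipped_risk_le R S n p q (delta n K eps (128 * e) (72 * e) u v r)
  (fun p a => 2 * ln n%:R / n%:R < (Num.sqrt (a%:R / n%:R) - Num.sqrt p) ^+ 2)
  _ _ V Bb d T Pr N X n0 hp hq sampling hD V0 Bb0).
- by move=> x B x0; exact: freq_sqrt_tail.
- move=> i a1 b1; rewrite -!leNgt => good1 good2.
  have := @delta_bias_variance R n K eps eta (p i) (q i) u v r a1 b1 n2 eps0 (p0 i) (q0 i) Kn
    du dv sr hu hv hr good1 good2.
  by rewrite /= -eE -s2E.
Qed.

(** Here y stands for ln n, and every term is compared with w = S / (N y): bad batches through y <=
    N, the plug-in variance through y <= C S, and the polynomial variances through the two growth
    bounds. *)
Lemma risk_rate (R : realType) (K : nat) (C e b g kappa eta s2 H rn y N S : R) :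
  1 <= e -> 0 < C -> 0 < y -> 1 <= N -> 1 <= S -> y <= N -> y <= C * S -> 0 <= kappa ->
  s2 = 8 * e * (y / N) -> s2 * eta ^+ 2 <= kappa / (N * y) ->
  0 <= b -> 0 <= g -> H ^+ 2 * 16 ^+ K <= b * g ^+ K -> 2 ^+ K * (rn ^+ 2 + 1) <= b * g ^+ K ->
  y ^+ 3 * g ^+ K <= 216 * N -> y ^+ 2 * g ^+ K <= 16 * C ^+ 2 * S ->
  Num.min 1 (S * (2 * (2 / N ^+ 2)) +
     (2 * ((1 + e ^+ 2) / N + S * (H ^+ 2 * ((32 * s2) ^+ 2 * 16 ^+ K)) +
           512 * s2 * (1 + e) * (2 ^+ K * (rn ^+ 2 + 1))) +
      2 * (S * (1024 * s2 * eta ^+ 2 * (1 + e) + S * (8192 * s2 ^+ 2 * eta ^+ 4))))) <=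
  (1 + 4 + 2 * ((1 + e ^+ 2) * C + 216 * b * (256 * e) ^+ 2 +
                16 * b * C ^+ 2 * (4096 * e * (1 + e))) +
   2 * (1024 * kappa * (1 + e) + 8192 * kappa ^+ 2)) * (e * S / (N * y)).
Proof.
move=> e1 C0 y0 N1 S1 yN yS k0 s2E hs b0 g0 hH hr h1 h2.
have N0 : 0 < N by exact: lt_le_trans N1.
have S0 : 0 < S by exact: lt_le_trans S1.
have e0 : 0 < e by exact: lt_le_trans e1.
have Ny : 0 < N * y by rewrite mulr_gt0.
have gK0 : 0 <= g ^+ K by exact: exprn_ge0.
pose w := S / (N * y); have w0 : 0 <= w by rewrite divr_ge0// ltW.
pose A1 := (1 + e ^+ 2) * C + 216 * b * (256 * e) ^+ 2 +
  16 * b * C ^+ 2 * (4096 * e * (1 + e)).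
pose A2 := 1024 * kappa * (1 + e) + 8192 * kappa ^+ 2.
have t0 : S * (2 * (2 / N ^+ 2)) <= 4 * w.
  have -> : S * (2 * (2 / N ^+ 2)) = 4 * (S * (N ^+ 2)^-1) by field; rewrite gt_eqF.
  rewrite ler_wpM2l ?ler0n// /w; apply: (ler_wpM2l (ltW S0)).
  rewrite lef_pV2 ?posrE ?exprn_gt0//; exact: (ler_wpM2l (ltW N0)).
have t1 : (1 + e ^+ 2) / N <= (1 + e ^+ 2) * C * w.
  rewrite -mulrA ler_wpM2l ?addr_ge0 ?sqr_ge0// /w mulrA ler_pdivlMr//.
  by rewrite mulKf ?gt_eqF.
have t2 : S * (H ^+ 2 * ((32 * s2) ^+ 2 * 16 ^+ K)) <= 216 * b * (256 * e) ^+ 2 * w.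
  have -> : S * (H ^+ 2 * ((32 * s2) ^+ 2 * 16 ^+ K)) =
      (H ^+ 2 * 16 ^+ K) * ((256 * e) ^+ 2 * ((y / N) ^+ 2 * S)) by rewrite s2E; ring.
  have c0 : 0 <= (256 * e) ^+ 2 * ((y / N) ^+ 2 * S).
    by apply: mulr_ge0 (sqr_ge0 _) _; apply: mulr_ge0 (sqr_ge0 _) (ltW S0).
  apply: le_trans (ler_wpM2r c0 hH) _.
  have -> : b * g ^+ K * ((256 * e) ^+ 2 * ((y / N) ^+ 2 * S)) =
      b * (256 * e) ^+ 2 * w * (y ^+ 3 * g ^+ K / N) by rewrite /w; field; rewrite !gt_eqF.
  have c1 : 0 <= b * (256 * e) ^+ 2 * w by apply: mulr_ge0 w0; exact: mulr_ge0 b0 (sqr_ge0 _).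
  have -> : 216 * b * (256 * e) ^+ 2 * w = b * (256 * e) ^+ 2 * w * 216 by ring.
  by apply: (ler_wpM2l c1); rewrite ler_pdivrMr.
have t3 : 512 * s2 * (1 + e) * (2 ^+ K * (rn ^+ 2 + 1)) <=
    16 * b * C ^+ 2 * (4096 * e * (1 + e)) * w.
  have c0 : 0 <= 4096 * e * (1 + e).
    by apply: mulr_ge0; [exact: mulr_ge0 (ler0n _ _) (ltW e0)|rewrite addr_ge0// ltW].
  have c1 : 0 <= 512 * s2 * (1 + e).
    apply: mulr_ge0; last by rewrite addr_ge0// ltW.
    by apply: mulr_ge0 (ler0n _ _) _; rewrite s2E mulr_ge0 ?divr_ge0 ?mulr_ge0// ltW.
  apply: le_trans (ler_wpM2l c1 hr) _.
  have -> : 512 * s2 * (1 + e) * (b * g ^+ K) =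
    4096 * e * (1 + e) * b / (N * y) * (y ^+ 2 * g ^+ K).
    by rewrite s2E; field; rewrite !gt_eqF.
  have -> : 16 * b * C ^+ 2 * (4096 * e * (1 + e)) * w =
    4096 * e * (1 + e) * b / (N * y) * (16 * C ^+ 2 * S) by rewrite /w; ring.
  apply: ler_wpM2l h2; apply: mulr_ge0; first exact: mulr_ge0.
  by rewrite invr_ge0 ltW.
have t4 : S * (1024 * s2 * eta ^+ 2 * (1 + e)) <= 1024 * kappa * (1 + e) * w.
  have -> : S * (1024 * s2 * eta ^+ 2 * (1 + e)) = 1024 * (1 + e) * S * (s2 * eta ^+ 2) by ring.
  have -> : 1024 * kappa * (1 + e) * w = 1024 * (1 + e) * S * (kappa / (N * y)).
    by rewrite /w; ring.
  apply: ler_wpM2l hs; apply: mulr_ge0 (ltW S0); apply: mulr_ge0 (ler0n _ _) _.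
  by rewrite addr_ge0// ltW.
have t5 : S * (S * (8192 * s2 ^+ 2 * eta ^+ 4)) <= 8192 * kappa ^+ 2 * w ^+ 2.
  have -> : S * (S * (8192 * s2 ^+ 2 * eta ^+ 4)) = 8192 * S ^+ 2 * (s2 * eta ^+ 2) ^+ 2 by ring.
  have -> : 8192 * kappa ^+ 2 * w ^+ 2 = 8192 * S ^+ 2 * (kappa / (N * y)) ^+ 2.
    by rewrite /w; ring.
  apply: ler_wpM2l; first exact: mulr_ge0 (ler0n _ _) (sqr_ge0 _).
  rewrite lerXn2r ?nnegrE ?divr_ge0 ?(ltW Ny)//.
  by rewrite mulr_ge0 ?sqr_ge0// s2E mulr_ge0 ?divr_ge0 ?mulr_ge0// ltW.
have k2 : 0 <= 8192 * kappa ^+ 2 by exact: mulr_ge0 (ler0n _ _) (sqr_ge0 _).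
have A10 : 0 <= A1.
  have c0 : 0 <= 4096 * e * (1 + e).
    by apply: mulr_ge0; [exact: mulr_ge0 (ler0n _ _) (ltW e0)|rewrite addr_ge0// ltW].
  apply: addr_ge0; last apply: mulr_ge0 c0.
    apply: addr_ge0; first by rewrite mulr_ge0 ?addr_ge0 ?sqr_ge0// ltW.
    by apply: mulr_ge0 (sqr_ge0 _); exact: mulr_ge0 (ler0n _ _) b0.
  by apply: mulr_ge0 (sqr_ge0 _); exact: mulr_ge0 (ler0n _ _) b0.
have A20 : 0 <= A2.
  apply: addr_ge0 k2; apply: mulr_ge0; first exact: mulr_ge0 (ler0n _ _) k0.
  by rewrite addr_ge0// ltW.
have M0 : 0 <= 1 + 4 + 2 * A1 + 2 * A2.
  by rewrite !addr_ge0 ?(mulr_ge0 (ler0n _ 2) A10) ?(mulr_ge0 (ler0n _ 2) A20).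
apply: (@le_trans _ _ ((1 + 4 + 2 * A1 + 2 * A2) * w)); last first.
  apply: (ler_wpM2l M0); rewrite -mulrA -/w; exact: ler_peMl.
have -> : (1 + 4 + 2 * A1 + 2 * A2) * w = 5 * w + 2 * (A1 * w) + 2 * (A2 * w) by ring.
have Aw : 0 <= A1 * w /\ 0 <= A2 * w by split; exact: mulr_ge0.
(* The last bias term is of order w^2. It is at most of order w if w <= 1, and otherwise the cap 1
   is already below w. *)
rewrite ge_min; have [w1|w1] := leP w 1; apply/orP; [right|left]; last first.
  apply: le_trans (ltW w1) _; rewrite -[leLHS]addr0; apply: lerD; last exact: mulr_ge0 Aw.2.
  by rewrite -[leLHS]addr0 lerD ?ler_peMl ?ler1n// (mulr_ge0 _ Aw.1).
have t5' : S * (S * (8192 * s2 ^+ 2 * eta ^+ 4)) <= 8192 * kappa ^+ 2 * w.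
  apply: le_trans t5 _; apply: (ler_wpM2l k2); by rewrite expr2 ler_piMl.
have B1 := lerD (lerD t1 t2) t3; rewrite -!mulrDl -/A1 in B1.
have B2 := lerD t4 t5'; rewrite -mulrDl -mulrDr -/A2 in B2.
rewrite addrA; apply: lerD; last by rewrite ler_wpM2l.
apply: lerD; last by rewrite ler_wpM2l.
by apply: le_trans t0 _; rewrite ler_wpM2r// ler_nat.
Qed.

Lemma h2K_norm_rate (R : realType) (K : nat) (B : R) (u v : {poly {poly R}}) :
  degree_le2 K u -> degree_le2 K v ->
  (forall x y, 0 <= x <= 1 -> 0 <= y <= 1 -> `|u.[x, y]| <= B) ->
  (forall x y, 0 <= x <= 1 -> 0 <= y <= 1 -> `|v.[x, y]| <= B) ->
  coef_norm (coef_norm Num.norm) (h2K u v) ^+ 2 * 16 ^+ K <=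
    4 * B ^+ 4 * 128 ^+ 4 * (16 * 128 ^+ 4) ^+ K.
Proof.
move=> du dv hu hv.
have H0 : 0 <= coef_norm (coef_norm Num.norm) (h2K u v).
  by apply: coef_norm_ge0 => a; exact: coef_norm_ge0.
have hH := coef_norm_h2K_le du dv hu hv.
move: H0 hH; move: (coef_norm _ _) (128 : R) => H L H0 hH.
have -> : 4 * B ^+ 4 * L ^+ 4 * (16 * L ^+ 4) ^+ K =
    (2 * (B * L ^+ K.+1) ^+ 2) ^+ 2 * 16 ^+ K.
  by rewrite exprMn -!exprM !exprS mulnC exprM; ring.
by rewrite ler_wpM2r ?exprn_ge0// lerXn2r ?nnegrE// (le_trans H0).
Qed.

(** The natural base here is 2 * 64. It is enlarged to the base of the first polynomial so that one
    c3 serves both. *)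
Lemma coef_norm_rate (R : realType) (K : nat) (B : R) (r : {poly R}) :
  (size r <= K.+1)%N -> (forall x, 0 <= x <= 1 -> `|r.[x]| <= B) ->
  2 ^+ K * (coef_norm Num.norm r ^+ 2 + 1) <=
    (64 * B ^+ 2 + 1) * (16 * 128 ^+ 4) ^+ K.
Proof.
move=> sr hr.
have H0 : 0 <= coef_norm Num.norm r by exact: coef_norm_ge0.
have hH := coef_norm_le sr hr.
move: H0 hH; move: (coef_norm _ _) => H H0 hH.
have hsq : H ^+ 2 <= (B * 8 ^+ K.+1) ^+ 2 by rewrite lerXn2r ?nnegrE// (le_trans H0).
apply: (@le_trans _ _ (2 ^+ K * ((64 * B ^+ 2 + 1) * 64 ^+ K))).
  rewrite ler_wpM2l ?exprn_ge0// mulrDl lerD//; last by rewrite mul1r exprn_ege1// ler1n.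
  apply: le_trans hsq _; rewrite le_eqVlt; apply/orP; left; apply/eqP.
  by rewrite (_ : 64 = 8 ^+ 2) -?exprM 1?mulnC ?exprM ?exprS; ring.
have c0 : 0 <= 64 * B ^+ 2 + 1 by apply: addr_ge0 => //; exact: mulr_ge0 (ler0n _ _) (sqr_ge0 B).
rewrite mulrCA -exprMn (ler_wpM2l c0)//.
have h : 2 * 64 <= 16 * 128 ^+ 4 :> R.
  by apply: ler_pM; rewrite ?ler_nat// (le_trans (_ : 64 <= 128)) ?ler_nat// ler_eXnr ?ler1n.
by apply: lerXn2r h; rewrite nnegrE; [exact: mulr_ge0|exact: mulr_ge0 (ler0n _ _) (exprn_ge0 _ (ler0n _ _))].
Qed.

Theorem theorem7 (R : realType) (C eps : R) (hC : 0 < C) (heps : 0 <= eps) :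
  exists c1 c2 c3 M : R,
    [/\ c2 < c1, 0 < c2, 0 < c3 & 0 < M] /\
    forall S n : nat, (0 < S)%N -> (2 <= n)%N -> ln n%:R <= C * ln S%:R ->
    let K := Num.truncn (c3 * ln n%:R) in
    forall (u v : {poly {poly R}}) (r : {poly R}),
      best_approx2 K (fun x y => Num.sqrt x + Num.sqrt y) u ->
      best_approx2 K (fun x y => Num.max (Num.sqrt x - Num.sqrt y) 0) v ->
      best_approx1 K (-1) 1 (fun t => `|t|) r ->
    forall p q : 'I_S -> R, is_pmf p -> is_pmf q ->
    forall (d : measure_display) (T : measurableType d) (Pr : probability T R)
      (N : bool -> 'I_2 -> {RV Pr >-> nat})
      (X : bool -> 'I_2 -> nat -> T -> 'I_S),
      poissonized_sampling n p q N X ->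
    ('E_Pr[fun w => (`|dhat_sample n K eps c1 c2 u v r N X w
                       - divergence eps p q| ^+ 2)%R]
       <= (M * (expR eps * S%:R / (n%:R * ln n%:R)))%:E)%E.
Proof.
have sq1 (x : R) : 0 <= x <= 1 -> 0 <= Num.sqrt x <= 1.
  by move=> /andP[x0 x1]; rewrite sqrtr_ge0 -sqrtr1 ler_sqrt.
have sum02 (x y : R) : 0 <= x <= 1 -> 0 <= y <= 1 -> 0 <= Num.sqrt x + Num.sqrt y <= 2.
  by move=> /sq1 hx /sq1 hy; lra.
have diff2 (x y : R) : 0 <= x <= 1 -> 0 <= y <= 1 -> Num.sqrt x - Num.sqrt y <= 2.
  by move=> /sq1 hx /sq1 hy; lra.
have [Cu Cu0 appu] := sqrt_sum_approx R.
have [Cv Cv0 appv] := sqrt_diff_approx R.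
have [Cr Cr0 appr] := abs_approx R.
pose C0 := Cu + Cv + Cr; have C00 : 0 < C0 by rewrite !addr_gt0.
have [CuC CvC CrC] : [/\ Cu <= C0, Cv <= C0 & Cr <= C0] by split; rewrite /C0; lra.
pose e := expR eps; have e1 : 1 <= e by rewrite -expR0 ler_expR.
have e0 : 0 < e by exact: expR_gt0.
(* 16 comes from the second moments of the normalised monomials. 128 is the base of the coefficient
   bound for u and for v, and the norm of their product is squared, whence the fourth power. *)
pose g : R := 16 * 128 ^+ 4.
have g1 : 1 <= g by rewrite -[leLHS]mulr1 ler_pM ?exprn_ege1 ?ler1n.
(* Then g ^ K is at most the square roots of n and of S. *)
pose c3 := (2 * ((1 + C) * (1 + ln g)))^-1.
have lg0 : 0 <= ln g by exact: ln_ge0.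
have c3d : 1 <= (1 + C) * (1 + ln g) by rewrite -[leLHS]mulr1 ler_pM ?lerDl ?(ltW hC)//.
have c3p : 1 <= 2 * ((1 + C) * (1 + ln g)) by rewrite -[leLHS]mulr1 ler_pM ?ler1n.
have c30 : 0 < c3 by rewrite invr_gt0 (lt_le_trans ltr01).
have c31 : c3 <= 1 by rewrite invf_le1// (lt_le_trans ltr01).
have c3g : c3 * ln g * (1 + C) <= 2^-1.
  have lg1 : 0 < 1 + ln g by rewrite ltr_pwDl.
  have C1 : 0 < 1 + C by rewrite addr_gt0.
  have -> : 2^-1 = c3 * (1 + ln g) * (1 + C) by rewrite /c3; field; rewrite !gt_eqF.
  by rewrite ler_wpM2r ?(ltW C1)// ler_wpM2l ?(ltW c30)// lerDr.
(* The targets lie in [0, 2] and the approximation errors are at most C0, so B bounds u, v and r. *)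
pose B := 2 + C0; have B0 : 0 <= B by rewrite addr_ge0// ltW.
pose b := 4 * B ^+ 4 * 128 ^+ 4 + (64 * B ^+ 2 + 1).
have b10 : 0 <= 4 * B ^+ 4 * 128 ^+ 4.
  by apply: mulr_ge0; [apply: mulr_ge0|]; rewrite ?exprn_ge0.
have b20 : 0 <= 64 * B ^+ 2 + 1.
  by apply: addr_ge0 => //; exact: mulr_ge0 (ler0n _ _) (sqr_ge0 _).
have b0 : 0 <= b by exact: addr_ge0.
(* Rounding down gives K + 1 > c3 ln n, so eta <= C0 / (c3 ln n) and s2 eta^2 is at most kappa / (n
   ln n). *)
pose kappa := 8 * e * (C0 / c3) ^+ 2.
have kappa0 : 0 <= kappa by apply: mulr_ge0 (sqr_ge0 _); rewrite mulr_ge0// ltW.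
pose M := 1 + 4 + 2 * ((1 + e ^+ 2) * C + 216 * b * (256 * e) ^+ 2 +
    16 * b * C ^+ 2 * (4096 * e * (1 + e))) +
  2 * (1024 * kappa * (1 + e) + 8192 * kappa ^+ 2).
have M0 : 0 < M.
  have p1 : 0 <= 1 + e by rewrite addr_ge0// ltW.
  have q1 : 0 <= 1024 * kappa * (1 + e).
    by apply: mulr_ge0 p1; exact: mulr_ge0 (ler0n _ _) kappa0.
  have q2 : 0 <= 8192 * kappa ^+ 2 by exact: mulr_ge0 (ler0n _ _) (sqr_ge0 _).
  have q3 : 0 <= 16 * b * C ^+ 2 * (4096 * e * (1 + e)).
    apply: mulr_ge0; first by apply: mulr_ge0 (sqr_ge0 _); exact: mulr_ge0.
    by apply: mulr_ge0 p1; exact: mulr_ge0 (ler0n _ _) (ltW e0).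
  have q4 : 0 <= 216 * b * (256 * e) ^+ 2.
    by apply: mulr_ge0 (sqr_ge0 _); exact: mulr_ge0 (ler0n _ _) b0.
  have q5 : 0 <= (1 + e ^+ 2) * C by rewrite mulr_ge0 ?addr_ge0 ?sqr_ge0// ltW.
  apply: ltr_pwDl; last exact: mulr_ge0 (ler0n _ 2) (addr_ge0 q1 q2).
  by apply: ltr_pwDl; last exact: mulr_ge0 (ler0n _ 2) (addr_ge0 (addr_ge0 q5 q4) q3).
(* With sg ^ 2 = 8 * e * ln n / n, the thresholds are 16 * sg ^ 2 for the sum of
   the frequencies and 5 * sg for the difference of their square roots. *)
exists (128 * e), (72 * e), c3, M; split.
  by split=> //; [rewrite ltr_pM2r// ltr_nat|exact: mulr_gt0].
move=> S n S0 n2 hn K u v r hu hv hr p q hp hq d T Pr N X sampling.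
have y0 : 0 < ln n%:R :> R by rewrite ln_gt0// ltr1n.
have n0 : 0 < n%:R :> R by rewrite ltr0n (leq_trans _ n2).
have cy0 : 0 <= c3 * ln n%:R by rewrite mulr_ge0 ?(ltW c30) ?(ltW y0).
have /andP[Kle Kgt] := truncn_itv cy0; rewrite -/K in Kle Kgt.
have Kn : K%:R <= ln n%:R :> R by apply: le_trans Kle _; rewrite ler_piMl ?(ltW y0).
pose eta := C0 / K.+1%:R.
have etaE c : c <= C0 -> c / K.+1%:R <= eta by move=> h; rewrite ler_wpM2r ?invr_ge0.
have eta0 : 0 <= eta by rewrite divr_ge0// ltW.
have etaC : eta <= C0 by rewrite ler_pdivrMr ?ltr0n// ler_peMr ?ler1n// ltW.
have hu' x y : 0 <= x <= 1 -> 0 <= y <= 1 -> `|Num.sqrt x + Num.sqrt y - u.[x, y]| <= eta.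
  have [w dw hw] := appu K.
  apply: (best_approx2_le hu dw) => x' y' hx hy.
  by apply: le_trans (hw _ _ hx hy) (etaE _ CuC).
have hv' x y : 0 <= x <= 1 -> 0 <= y <= 1 ->
    `|Num.max (Num.sqrt x - Num.sqrt y) 0 - v.[x, y]| <= eta.
  have [w dw hw] := appv K.
  apply: (best_approx2_le hv dw) => x' y' hx hy.
  by apply: le_trans (hw _ _ hx hy) (etaE _ CvC).
have hr' t : -1 <= t <= 1 -> `| `|t| - r.[t] | <= eta.
  have [w dw hw] := appr K; apply: (best_approx1_le hr dw) => t' ht.
  by apply: le_trans (hw _ ht) (etaE _ CrC).
have bound f z : 0 <= f <= 2 -> `|f - z| <= eta -> `|z| <= B.
  move=> /andP[f0 f2] h; rewrite -[z](subKr f) (le_trans (ler_normB _ _))//.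
  by rewrite lerD ?(ger0_norm f0)// (le_trans h).
have bu x y : 0 <= x <= 1 -> 0 <= y <= 1 -> `|u.[x, y]| <= B.
  by move=> hx hy; apply: bound (hu' x y hx hy); exact: sum02.
have bv x y : 0 <= x <= 1 -> 0 <= y <= 1 -> `|v.[x, y]| <= B.
  move=> hx hy; apply: bound (hv' x y hx hy).
  by rewrite le_max lexx orbT/= ge_max ler0n andbT diff2.
have br x : 0 <= x <= 1 -> `|r.[x]| <= B.
  move=> /andP[x0 x1]; apply: bound (hr' x _); last by rewrite x1 andbT (le_trans _ x0)// lerN10.
  by rewrite normr_ge0 ger0_norm// (le_trans x1)// ler1n.
have [gr1 gr2] := power_growth S0 n2 hC hn g1 Kle c3g (ltW c30).
have gK0 : 0 <= g ^+ K by rewrite exprn_ge0// (le_trans ler01).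
apply: le_trans (dhat_risk_le n2 heps hp hq sampling Kn hu.1 hv.1 hr.1 hu' hv' hr' erefl erefl) _.
rewrite lee_fin -/e; apply: (@risk_rate R K C e b g kappa eta) => //.
- by rewrite ler1n (leq_trans _ n2).
- by rewrite ler1n.
- exact: ltW (ln_sublinear n0).
- apply: le_trans hn _; rewrite ler_wpM2l ?(ltW hC)// ltW// ln_sublinear// ltr0n//.
- have -> : kappa / (n%:R * ln n%:R) =
      8 * e * (ln n%:R / n%:R) * (C0 / (c3 * ln n%:R)) ^+ 2.
    by rewrite /kappa; field; rewrite !gt_eqF.
  have d0 : 0 <= 8 * e * (ln n%:R / n%:R).
    by rewrite mulr_ge0 ?divr_ge0 ?mulr_ge0// ltW.
  apply: (ler_wpM2l d0); rewrite lerXn2r ?nnegrE// ?divr_ge0 ?(ltW C00)//.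
  apply: ler_wpM2l; first exact: ltW.
  by rewrite lef_pV2 ?posrE ?mulr_gt0 ?ltr0n// ltW.
- exact: le_trans ler01 g1.
- apply: le_trans (h2K_norm_rate hu.1 hv.1 bu bv) _.
  by apply: (ler_wpM2r gK0); rewrite lerDl.
- apply: le_trans (coef_norm_rate hr.1 br) _.
  by apply: (ler_wpM2r gK0); rewrite lerDr.
Qed.
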